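(* In the setting described in the context (conforming $\mathcal{Q}^p$ finite elements, $p\ge1$, GLL nodal basis, admissible hierarchy), assume that the geometry maps from the reference element to the fine elements in physical space are multilinear and that the coarse polynomial degree satisfies $p'\ge1$. Then for every $i=1,\dots,J$ and every $v_i\in V_i$, $$\|v_i-Q_iv_i\|_{D_i}^2\lesssim p^{4+d}\,\frac{H_i^2}{h^2}\Bigl(1+l_i^2p^d+{p'}^{-2}\Bigr)|v_i|^2_{H^1(\Omega_i)},$$ i.e. $$\mu_i^{-1}(V_i^c)\lesssim p^{4+d}\,\frac{H_i^2}{h^2}\Bigl(1+l_i^2p^d+{p'}^{-2}\Bigr).$$
   Context: **Mesh and space.** $\Omega\subset\mathbb{R}^d$, $d\in\{2,3\}$, is an open, bounded, simply connected Lipschitz domain; $\mathcal{T}_h=\{\tau_1,\dots,\tau_N\}$ is a shape-regular, geometrically conforming, quasi-uniform mesh of disjoint open quadrilaterals/hexahedra with $\bigcup\bar\tau_i=\bar\Omega$ and $h=\max_i\mathrm{diam}(\tau_i)$. $V$ is the space of continuous functions on $\bar\Omega$ vanishing on $\partial\Omega$ whose restriction to each $\tau_i$ belongs to $\mathcal{Q}^p(\tau_i)$ (tensor-product polynomials of degree $p$ in each variable), $p\ge1$. The basis is the tensor-product Lagrange basis with Gauss-Lobatto-Legendre (GLL) nodes on each element; the nodes are called support points. $A(u,v)=\int_\Omega\nabla u\cdot\nabla v\,dx$; $A$ also denotes the corresponding operator/stiffness matrix on $V$, and $D=\mathrm{diag}(A)$ its diagonal in the nodal basis, $\|v\|_D^2=(Dv,v)$.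 **Agglomerates.** $B_1,\dots,B_J$ are axis-aligned bounding boxes (produced by an R-tree clustering of the mesh cells or of the support points). The set of all support points (including those on $\partial\Omega$) is a disjoint union of sets $\mathcal{P}_i=\{p^i_1,\dots,p^i_{l_i}\}\subset B_i$, $i=1,\dots,J$ (points owned by $B_i$). $\Omega_i$ is the union of all elements $\tau_j$ with $\mathcal{P}_i\cap\bar\tau_j\ne\emptyset$; $H_i=\mathrm{diam}(\Omega_i)$, $H=\max_iH_i$. $\Omega_{i,h}$ is the union of the elements $\tau_j\subset\Omega_i$ not all of whose support points lie in $\mathcal{P}_i$, and $\Omega_i^\circ=\Omega_i\setminus\Omega_{i,h}$. **Local spaces.** $V_i=\mathrm{span}\{\phi^i_j:\ j=1,\dots,l_i\}$, where $\phi^i_j$ is the nodal basis function (no boundary condition imposed) equal to $1$ at $p^i_j$ and $0$ at all other support points. $\Pi_i:V_i\to V$ is nodal interpolation into $V$ (it keeps the values at support points off $\partial\Omega$ and sets the values on $\partial\Omega$ to zero). $I_h^{V_i}v=\sum_{j=1}^{l_i}v(p^i_j)\phi^i_j$. $A_i=\Pi_i'A\Pi_i$, $D_i=\Pi_i'D\Pi_i$, so $\|v_i\|_{A_i}^2=|\Pi_iv_i|^2_{H^1(\Omega)}$ and $\|v_i\|_{D_i}=\|\Pi_iv_i\|_D$. **Coarse spaces.** $V_i^c=\{I_h^{V_i}q:\ q\in\mathcal{Q}^{p'}(B_i)\}$, with $\mathcal{Q}^{p'}(B_i)$ the polynomials of degree at most $p'$ in each variable. $Q_i:V_i\to V_i^c$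 is the orthogonal projection with respect to $(u_i,v_i)_{D_i}=(D_iu_i,v_i)$ (so $\|v_i-Q_iv_i\|_{D_i}=\min_{v^c\in V_i^c}\|v_i-v^c\|_{D_i}$). Define $$\mu_i^{-1}(V_i^c)=\max_{v_i\in V_i}\min_{v_i^c\in V_i^c}\frac{\|v_i-v_i^c\|_{D_i}^2}{\|v_i\|_{A_i}^2}=\max_{v_i\in V_i}\frac{\|v_i-Q_iv_i\|_{D_i}^2}{\|v_i\|_{A_i}^2}$$ (maximum over $v_i$ with $\|v_i\|_{A_i}\neq0$). **Standing assumptions (admissible hierarchy)**, for a fixed constant $\kappa\ge1$ and all $i$: (1) the aspect ratio of $B_i$ is at most $\kappa$; $\Omega_i^\circ$ is connected, occupies a nondegenerate portion of $B_i$ (measure at least $\kappa^{-1}|B_i|$), and satisfies the Poincaré inequality and polynomial approximation estimates (approximation of $v\in H^1(\Omega_i^\circ)$ in $L^2(\Omega_i^\circ)$ by polynomials of total degree at most $q$, with error at most $\kappa H_iq^{-1}|v|_{H^1(\Omega_i^\circ)}$ for $q\ge1$, and $\kappa H_i|v|_{H^1(\Omega_i^\circ)}$ for constants). (2) $\Omega_{i,h}$ consists of at most $\kappa$ layers of fine cells, hence has thickness $O(h)$, and each point lies in at most $\kappa$ of the sets $\Omega_{i,h}$. (3) $\partial\Omega_{i,h}$ is uniformly shape-regular and its $(d-1)$-dimensional measure is between $\kappa^{-1}H^{d-1}$ and $\kappa H^{d-1}$. (4) $p'\le p$ and the points $\mathcal{P}_i$ are uniformly unisolvent and stable for interpolation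 from $\mathcal{Q}^{p'}(B_i)$: $\|q\|_{L^\infty(B_i)}\le\kappa\max_{x\in\mathcal{P}_i}|q(x)|$ for $q\in\mathcal{Q}^{p'}(B_i)$. **Notation.** $a\lesssim b$ means $a\le Cb$ with $C$ independent of $h$, $H$, $p$, $p'$ (it may depend only on $d$, $\Omega$, the mesh regularity constants and $\kappa$). *)

(* Defs.v *)
From HB Require Import structures.
From mathcomp Require Import all_boot all_order all_algebra.
From mathcomp Require Import all_classical all_reals all_analysis.
Set Implicit Arguments. Unset Strict Implicit. Unset Printing Implicit Defensive.
Import Order.TTheory GRing.Theory Num.Theory.
Import numFieldNormedType.Exports.
Local Open Scope classical_set_scope.
Local Open Scope ring_scope.

(* Points of R^d are row vectors [x : 'rV[R]_d] with coordinates [x ord0 k]. *)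

(* ['rV[R]_n] carries the product sigma-algebra, generated by the coordinates;
   it is the Borel sigma-algebra of the topology of ['rV[R]_n]. *)
Definition rV_display : measure_display. Proof. exact. Qed.

Section measurable_rV.
Context {R : realType} (n : nat).

Let coord (i : 'I_n) (v : 'rV[R]_n) : measurableTypeR R := v ord0 i.

Let rV_set0 : g_sigma_preimage coord set0.
Proof. exact: sigma_algebra0. Qed.

Let rV_setC A : g_sigma_preimage coord A -> g_sigma_preimage coord (~` A).
Proof. exact: sigma_algebraC. Qed.

Let rV_bigcup (F : (set _)^nat) : (forall i, g_sigma_preimage coord (F i)) ->
  g_sigma_preimage coord (\bigcup_i (F i)).
Proof. exact: sigma_algebra_bigcup. Qed.

HB.instance Definition _ := @isMeasurable.Build rV_display
  'rV[R]_n (g_sigma_preimage coord) rV_set0 rV_setC rV_bigcup.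

Lemma measurable_coord (i : 'I_n) :
  measurable_fun [set: 'rV[R]_n] (fun v => v ord0 i : measurableTypeR R).
Proof.
move=> _ Y mY; rewrite setTI; apply: sub_sigma_algebra => /=.
rewrite -bigcup_seq/=; exists i => /=; first by rewrite mem_index_enum.
by exists Y => //; rewrite setTI.
Qed.

Lemma measurable_to_rV d (T : measurableType d) (f : T -> 'rV[R]_n) :
  (forall i, measurable_fun setT (fun t => f t ord0 i : measurableTypeR R)) ->
  measurable_fun setT f.
Proof.
move=> mf _ A; rewrite setTI; move: A.
pose S := [set A | measurable (f @^-1` A)].
have sS : sigma_algebra setT S.
  split; rewrite /S /=; first by rewrite preimage_set0.
  - by move=> A mA; rewrite setTD preimage_setC; exact: measurableC.
  - by move=> F mF; rewrite preimage_bigcup; exact: bigcupT_measurable.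
apply: smallest_sub => // A; rewrite -bigcup_seq => -[i _ [B mB <-]].
by rewrite setTI /S /=; have := mf i measurableT _ mB; rewrite setTI.
Qed.

End measurable_rV.

Section lebesgue_rV.
Context {R : realType}.

Definition cons_rV n (xv : measurableTypeR R * 'rV[R]_n) : 'rV[R]_n.+1 :=
  \row_i oapp (fun j => xv.2 ord0 j) xv.1 (unlift ord0 i).

Definition uncons_rV n (v : 'rV[R]_n.+1) : measurableTypeR R * 'rV[R]_n :=
  (v ord0 ord0, \row_j v ord0 (lift ord0 j)).

Lemma cons_rVK n : cancel (@cons_rV n) (@uncons_rV n).
Proof.
move=> [x v]; rewrite /uncons_rV mxE unlift_none /=; congr pair.
by apply/rowP => j; rewrite !mxE liftK.
Qed.

Lemma uncons_rVK n : cancel (@uncons_rV n) (@cons_rV n).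
Proof.
by move=> v; apply/rowP => i; rewrite mxE; case: unliftP => [j|] -> /=; rewrite ?mxE.
Qed.

Lemma measurable_cons_rV n : measurable_fun setT (@cons_rV n).
Proof.
apply: measurable_to_rV => i.
case: (unliftP ord0 i) => [j|] ->.
  rewrite (_ : (fun _ => _) = (fun v : 'rV[R]_n => v ord0 j) \o snd).
    by apply: measurableT_comp; [exact: measurable_coord|exact: measurable_snd].
  by apply/funext => xv /=; rewrite mxE liftK.
rewrite (_ : (fun _ => _) = fst); first exact: measurable_fst.
by apply/funext => xv /=; rewrite mxE unlift_none.
Qed.

Lemma measurable_uncons_rV n : measurable_fun setT (@uncons_rV n).
Proof.
apply/measurable_fun_pairP; split; first exact: measurable_coord.
apply: measurable_to_rV => j.
rewrite (_ : (fun _ => _) = (fun v : 'rV[R]_n.+1 => v ord0 (lift ord0 j))).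
  exact: measurable_coord.
by apply/funext => v /=; rewrite mxE.
Qed.

Section step.
Variables (n : nat) (m : {sigma_finite_measure set 'rV[R]_n -> \bar R}).

Definition lebesgue_step : set 'rV[R]_n.+1 -> \bar R :=
  pushforward (@lebesgue_measure R \x m)%E (@cons_rV n).

Let step0 : lebesgue_step set0 = 0%E.
Proof. by rewrite /lebesgue_step /pushforward preimage_set0 measure0. Qed.

Let step_ge0 A : (0 <= lebesgue_step A)%E.
Proof. by rewrite /lebesgue_step /pushforward; apply: (@measure_ge0 _ _ _ (@lebesgue_measure R \x m)%E). Qed.

Let step_sigma_additive : semi_sigma_additive lebesgue_step.
Proof.
move=> F mF tF mUF; rewrite /lebesgue_step /pushforward preimage_bigcup.
apply: measure_semi_sigma_additive.
- by move=> k; rewrite -[X in measurable X]setTI; exact: measurable_cons_rV.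
- apply/trivIsetP => /= i j _ _ ij; rewrite -preimage_setI.
  by move/trivIsetP : tF => /(_ _ _ _ _ ij) ->//; rewrite preimage_set0.
- rewrite -preimage_bigcup -[X in measurable X]setTI.
  exact: measurable_cons_rV.
Qed.

HB.instance Definition _ := isMeasure.Build _ _ _ lebesgue_step
  step0 step_ge0 step_sigma_additive.

Let step_sigma_finite : sigma_finite setT lebesgue_step.
Proof.
have /sigma_finiteP[F [FT ndF Foo]] := sigma_finiteT (@lebesgue_measure R).
have /sigma_finiteP[G [GT ndG Goo]] := sigma_finiteT m.
exists (fun k => @uncons_rV n @^-1` (F k `*` G k)).
  apply/esym; rewrite -subTset => v _.
  have [k _ Fk] : (\bigcup_k F k) (uncons_rV v).1 by rewrite -FT.
  have [l _ Gl] : (\bigcup_k G k) (uncons_rV v).2 by rewrite -GT.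
  exists (maxn k l) => //; split.
    by move: Fk; exact/subsetPset/ndF/leq_maxl.
  by move: Gl; exact/subsetPset/ndG/leq_maxr.
move=> k; have [mF Fk] := Foo k; have [mG Gk] := Goo k; split.
  rewrite -[X in measurable X]setTI; apply: measurable_uncons_rV => //.
  exact: measurableX.
rewrite /lebesgue_step /pushforward.
rewrite (_ : _ @^-1` _ = F k `*` G k).
  by rewrite product_measure1E// lte_mul_pinfty// ge0_fin_numE.
rewrite -comp_preimage (_ : _ \o _ = id) ?preimage_id//.
by apply/funext => x; rewrite /comp cons_rVK.
Qed.

HB.instance Definition _ := Measure_isSigmaFinite.Build _ _ _ lebesgue_step
  step_sigma_finite.
End step.

Fixpoint lebesgue_rV n : {sigma_finite_measure set 'rV[R]_n -> \bar R} :=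
  match n with
  | 0 => \d_(0 : 'rV[R]_0)
  | n.+1 => lebesgue_step (lebesgue_rV n)
  end.

End lebesgue_rV.

Section geometry.
Context {R : realType} {d : nat}.
Implicit Types (x y e : 'rV[R]_d) (A : set 'rV[R]_d).

Definition dotp x y : R := \sum_k x ord0 k * y ord0 k.

(* The norm [`|x|] of the library is the maximum norm; it induces the same
   topology. *)
Definition enorm x : R := Num.sqrt (dotp x x).

Definition diam A : R := sup [set enorm (x - y) | x in A & y in A].

Definition boundary A := closure A `\` interior A.

(* Locally Omega is the strict epigraph of a Lipschitz function over the
   hyperplane orthogonal to a unit vector e. *)
Definition lipschitz_domain (Omega : set 'rV[R]_d) :=
  forall x, boundary Omega x ->
  exists e (r L : R) (gamma : 'rV[R]_d -> R),
  [/\ dotp e e = 1, 0 < r,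
      forall y z, `|gamma y - gamma z| <= L * enorm (y - z) &
      forall y, enorm (y - x) < r ->
        (Omega y <-> gamma (y - dotp y e *: e) < dotp y e)].

Definition path_in (Omega : set 'rV[R]_d) (g : R -> 'rV[R]_d) :=
  {within `[0, 1], continuous g} /\ (forall t, `[0, 1]%classic t -> Omega (g t)).

Definition simply_connected (Omega : set 'rV[R]_d) :=
  (forall x y, Omega x -> Omega y ->
     exists g, [/\ path_in Omega g, g 0 = x & g 1 = y]) /\
  (forall g, path_in Omega g -> g 0 = g 1 ->
     exists F : R * R -> 'rV[R]_d,
     [/\ {within `[0, 1]%classic `*` `[0, 1]%classic, continuous F},
         forall s t, `[0, 1]%classic s -> `[0, 1]%classic t -> Omega (F (s, t)),
         forall t, `[0, 1]%classic t -> F (0, t) = g t /\ F (1, t) = g 0 &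
         forall s, `[0, 1]%classic s -> F (s, 0) = g 0 /\ F (s, 1) = g 0]).

Definition admissible_domain (Omega : set 'rV[R]_d) :=
  [/\ Omega !=set0, open Omega, bounded_set Omega, simply_connected Omega &
      lipschitz_domain Omega].

(* omega_s = (2 pi / s) omega_(s-2). *)
Fixpoint unit_ball_volume (s : nat) : R :=
  match s with
  | 0 => 1
  | 1 => 2
  | m.+2 => 2 * pi / m.+2%:R * unit_ball_volume m
  end.

Local Open Scope ereal_scope.

(* s-dimensional Hausdorff (outer) measure, s >= 1, normalised so as to agree
   with the s-dimensional area of s-dimensional surfaces. *)
Definition hausdorff (s : nat) A : \bar R :=
  ereal_sup [set ereal_inf
    [set \sum_(0 <= k <oo) (unit_ball_volume s * (diam (U k) / 2) ^+ s)%:E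
      | U in [set U : nat -> set 'rV[R]_d |
          A `<=` \bigcup_k U k /\
          forall k, bounded_set (U k) /\ (diam (U k) <= delta)%R]]
    | delta in [set delta : R | (0 < delta)%R]].

(* Uniform s-dimensional regularity of a surface S: its s-dimensional measure in
   a ball of radius r centred on S is comparable to r ^ s. *)
Definition uniformly_regular (kappa : R) (s : nat) (S : set 'rV[R]_d) :=
  forall x (r : R), S x -> (0 < r <= diam S)%R ->
  (kappa^-1 * r ^+ s)%:E <= hausdorff s (S `&` [set y | (enorm (y - x) < r)%R])
    <= (kappa * r ^+ s)%:E.

End geometry.

Section functions.
Context {R : realType} {d : nat}.
Implicit Types (u v f psi : 'rV[R]_d -> R) (G : set 'rV[R]_d).
Local Notation mu := (@lebesgue_rV R d).

Definition Qpoly (q : nat) : set ('rV[R]_d -> R) :=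
  [set f | exists c : {ffun 'I_d -> 'I_q.+1} -> R,
    forall x : 'rV[R]_d, f x = \sum_a c a * \prod_k x ord0 k ^+ a k].

Definition Ppoly (q : nat) : set ('rV[R]_d -> R) :=
  [set f | exists c : {ffun 'I_d -> 'I_q.+1} -> R,
    forall x : 'rV[R]_d, f x =
      \sum_(a : {ffun 'I_d -> 'I_q.+1} | (\sum_k a k <= q)%N)
        c a * \prod_k x ord0 k ^+ a k].

Definition partial u (k : 'I_d) : 'rV[R]_d -> R :=
  fun x => 'D_(delta_mx ord0 k) u x.

Fixpoint Cn (n : nat) f : Prop :=
  match n with
  | 0 => continuous f
  | m.+1 => continuous f /\
      forall k, (forall x, derivable f x (delta_mx ord0 k)) /\ Cn m (partial f k)
  end.

Definition test_function G psi :=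
  (forall n, Cn n psi) /\
  exists2 K, compact K & K `<=` G /\ forall x, ~ K x -> psi x = 0.

Definition L2 G v :=
  measurable_fun G v /\ mu.-integrable G (fun x => ((v x) ^+ 2)%:E).

(* v belongs to H^1(G) and g is its weak gradient on the open set G. *)
Definition H1 G v (g : 'I_d -> 'rV[R]_d -> R) :=
  [/\ L2 G v, forall k, L2 G (g k) &
      forall psi, test_function G psi -> forall k,
        \int[mu]_(x in G) (v x * partial psi k x) =
        - \int[mu]_(x in G) (g k x * psi x)].

Definition mean G v : R := (fine (mu G))^-1 * \int[mu]_(x in G) v x.

(* [K] is to bound the L2(G)-distances divided by the H^1(G)-seminorm. *)
Definition poincare (K : R) G := forall v g, H1 G v g ->
  \int[mu]_(x in G) (v x - mean G v) ^+ 2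
  <= K ^+ 2 * \int[mu]_(x in G) (\sum_k g k x ^+ 2).

Definition polynomial_approximation (K : R) G := forall v g, H1 G v g ->
  (exists c : R, \int[mu]_(x in G) (v x - c) ^+ 2
     <= K ^+ 2 * \int[mu]_(x in G) (\sum_k g k x ^+ 2)) /\
  (forall q : nat, (1 <= q)%N ->
     exists2 f, Ppoly q f & \int[mu]_(x in G) (v x - f x) ^+ 2
       <= (K / q%:R) ^+ 2 * \int[mu]_(x in G) (\sum_k g k x ^+ 2)).

End functions.

(* The cells are the images of the open reference cube ]-1, 1[^d under the
   geometry maps [gmap]. *)
Record mesh (R : realType) (d : nat) := Mesh {
  ncell : nat;
  gmap : 'I_ncell -> 'rV[R]_d -> 'rV[R]_d }.

Section mesh_theory.
Context {R : realType} {d : nat}.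
Implicit Types (T : mesh R d) (Omega : set 'rV[R]_d).

Definition ref_open : set 'rV[R]_d :=
  [set x | forall k, `|x ord0 k| < 1].
Definition ref_closed : set 'rV[R]_d :=
  [set x | forall k, `|x ord0 k| <= 1].

Definition cell T (j : 'I_(ncell T)) := gmap j @` ref_open.

Definition meshsize T : R := \big[Num.max/0]_(j < ncell T) diam (cell j).

(* The face of the closed reference cube on which the coordinate k is fixed to
   1 if [s k = Some true], to -1 if [s k = Some false], and is free otherwise. *)
Definition ref_face (s : 'I_d -> option bool) : set 'rV[R]_d :=
  [set x | ref_closed x /\
    forall k b, s k = Some b -> x ord0 k = if b then 1 else - 1].

Definition ref_vertex : set 'rV[R]_d :=
  [set x | forall k, x ord0 k = 1 \/ x ord0 k = - 1].

(* Two distinct closed cells are disjoint or share exactly a common vertex, edge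
   or face (as point sets, with the same vertices). *)
Definition conforming T := forall i j : 'I_(ncell T), i != j ->
  closure (cell i) `&` closure (cell j) = set0 \/
  exists s t : 'I_d -> option bool,
  [/\ exists k, s k != None, exists k, t k != None,
      gmap i @` ref_face s = closure (cell i) `&` closure (cell j),
      gmap j @` ref_face t = closure (cell i) `&` closure (cell j) &
      gmap i @` (ref_face s `&` ref_vertex) =
      gmap j @` (ref_face t `&` ref_vertex)].

Definition multilinear_maps T :=
  forall (j : 'I_(ncell T)) k, Qpoly 1 (fun x => gmap j x ord0 k).

(* The Jacobians of the geometry maps are uniformly comparable to the cell
   diameters: all their singular values lie between sigma^-1 diam and
   sigma diam. *)
Definition shape_regular (sigma : R) T :=
  forall (j : 'I_(ncell T)) x, ref_closed x -> forall xi : 'rV[R]_d,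
    sigma^-1 * diam (cell j) * enorm xi <= enorm ('D_xi (gmap j) x)
    <= sigma * diam (cell j) * enorm xi.

Definition quasi_uniform (rho : R) T :=
  forall j : 'I_(ncell T), meshsize T <= rho * diam (cell j).

Record admissible_mesh Omega (sigma rho : R) T : Prop := {
  mesh_multilinear : multilinear_maps T;
  mesh_injective : forall j : 'I_(ncell T), {in ref_closed &, injective (gmap j)};
  mesh_open : forall j : 'I_(ncell T), open (cell j);
  mesh_disjoint : trivIset setT (@cell T);
  mesh_cover : \bigcup_(j in [set: 'I_(ncell T)]) closure (cell j)
               = closure Omega;
  mesh_conforming : conforming T;
  mesh_shape_regular : shape_regular sigma T;
  mesh_quasi_uniform : quasi_uniform rho T }.

(* The open region formed by a set of cells: the interior of the union of the
   closed cells, i.e. the interfaces between these cells are included. *)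
Definition region T (S : set 'I_(ncell T)) : set 'rV[R]_d :=
  interior (\bigcup_(j in S) closure (cell j)).

(* Gradient of a mesh-piecewise smooth function; it exists on the open cells,
   and is set to 0 on the mesh skeleton, a null set. *)
Definition grad T (u : 'rV[R]_d -> R) (k : 'I_d) : 'rV[R]_d -> R :=
  partial u k \_ (\bigcup_(j in [set: 'I_(ncell T)]) @cell T j).

Definition H1seminorm2 T (G : set 'rV[R]_d) (u : 'rV[R]_d -> R) : R :=
  \int[@lebesgue_rV R d]_(x in G) (\sum_k grad T u k x ^+ 2).

End mesh_theory.

Section gll_nodes.
Context {R : realType}.

(* Rodrigues' formula. *)
Definition legendre (n : nat) : {poly R} :=
  ((2 ^ n * n`!)%:R)^-1 *: (('X^2 - 1) ^+ n)^`(n).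

(* The nodes of the (p+1)-point rule on [-1, 1], in increasing order. *)
Definition is_gll (p : nat) (g : 'I_p.+1 -> R) :=
  (forall i j : 'I_p.+1, (i < j)%N -> g i < g j) /\
  (forall i, root ((1 - 'X^2) * (legendre p)^`()) (g i)).

End gll_nodes.

(* [gll] are the one-dimensional nodes; [phi x] is the nodal basis function of
   the support point x, its value at other indices x being irrelevant. *)
Record discretization (R : realType) (d : nat) := Discretization {
  dmesh :> mesh R d;
  deg : nat;
  gll : 'I_deg.+1 -> R;
  phi : 'rV[R]_d -> 'rV[R]_d -> R }.
Arguments gll {R d} X : rename.

Section finite_elements.
Context {R : realType} {d : nat}.
Variables (Omega : set 'rV[R]_d) (X : discretization R d).
Implicit Types (u v : 'rV[R]_d -> R).

Definition cell_points (j : 'I_(ncell X)) : seq 'rV[R]_d :=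
  [seq gmap j (\row_k gll X (a k)) | a : {ffun 'I_d -> 'I_(deg X).+1}].

Definition support_points : seq 'rV[R]_d :=
  undup (flatten [seq cell_points j | j : 'I_(ncell X)]).

(* Functions matter on the closure of Omega only; their values elsewhere are
   irrelevant. *)
Definition fe_space : set ('rV[R]_d -> R) :=
  [set u | {within closure Omega, continuous u} /\
    forall j : 'I_(ncell X), exists2 q, Qpoly (deg X) q &
      forall x, ref_closed x -> u (gmap j x) = q x].

Definition V : set ('rV[R]_d -> R) :=
  [set u | fe_space u /\ forall x, boundary Omega x -> u x = 0].

Definition interior_points : seq 'rV[R]_d :=
  [seq x <- support_points | x \notin boundary Omega].

(* The basis functions of the support points off the boundary of Omega form the
   nodal basis of V. *)
Definition is_nodal_basis :=
  (forall x, x \in support_points -> fe_space (phi X x)) /\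
  (forall x, x \in interior_points -> V (phi X x)) /\
  {in support_points &, forall x y, phi X x y = (x == y)%:R}.

Definition Aform u v : R :=
  \int[@lebesgue_rV R d]_(x in Omega) (\sum_k grad X u k x * grad X v k x).

(* (D u, v), the vectors of nodal values representing the elements of V. *)
Definition Dform u v : R :=
  \sum_(x <- interior_points) Aform (phi X x) (phi X x) * u x * v x.

Definition interp (s : seq 'rV[R]_d) v : 'rV[R]_d -> R :=
  fun y => \sum_(x <- s) v x * phi X x y.

End finite_elements.

Record hierarchy (R : realType) (d : nat) := Hierarchy {
  nagg : nat;
  lower : 'I_nagg -> 'rV[R]_d;
  upper : 'I_nagg -> 'rV[R]_d;
  owned : 'I_nagg -> seq 'rV[R]_d }.

Section agglomerates.
Context {R : realType} {d : nat}.
Variables (Omega : set 'rV[R]_d) (X : discretization R d) (B : hierarchy R d).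
Implicit Types (i : 'I_(nagg B)) (u v q : 'rV[R]_d -> R).
Local Notation mu := (@lebesgue_rV R d).

Definition box i : set 'rV[R]_d :=
  [set x | forall k, lower i ord0 k <= x ord0 k <= upper i ord0 k].

Definition agg_cells i : set 'I_(ncell X) :=
  [set j | exists2 x, x \in owned i & closure (cell j) x].

Definition layer_cells i : set 'I_(ncell X) :=
  [set j | agg_cells i j /\ exists2 x, x \in cell_points j & x \notin owned i].

(* Omega_i, Omega_{i,h} and the core Omega_i \ Omega_{i,h}. *)
Definition agg i := region (agg_cells i).
Definition agg_layer i := region (layer_cells i).
Definition agg_core i := region (agg_cells i `\` layer_cells i).

Definition aggsize i : R := diam (agg i).
Definition maxsize : R := \big[Num.max/0]_(i < nagg B) aggsize i.

Definition is_hierarchy :=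
  (forall i k, lower i ord0 k < upper i ord0 k) /\
  (forall i x, x \in owned i -> box i x) /\
  perm_eq (flatten [seq owned i | i : 'I_(nagg B)]) (support_points X).

(* [in_layer i n j]: j is a cell of Omega_{i,h} of the layer number n, counted
   from 0 starting from the boundary of Omega_i. *)
Fixpoint in_layer i (n : nat) (j : 'I_(ncell X)) : Prop :=
  layer_cells i j /\
  match n with
  | 0 => closure (cell j) `&` boundary (agg i) !=set0
  | m.+1 => exists2 k, in_layer i m k &
              closure (cell j) `&` closure (cell k) !=set0
  end.

Record admissible_hierarchy (kappa : R) (p' : nat) : Prop := {
  hier_aspect : forall i k l,
    upper i ord0 k - lower i ord0 k <= kappa * (upper i ord0 l - lower i ord0 l);
  hier_connected : forall i, connected (agg_core i);
  hier_volume : forall i, ((kappa^-1)%:E * mu (box i) <= mu (agg_core i))%E;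
  hier_poincare : forall i, poincare (kappa * aggsize i) (agg_core i);
  hier_approximation : forall i,
    polynomial_approximation (kappa * aggsize i) (agg_core i);
  hier_layers : forall i j, layer_cells i j ->
    exists2 n : nat, n.+1%:R <= kappa & in_layer i n j;
  hier_overlap : forall x,
    #|[pred i : 'I_(nagg B) | x \in agg_layer i]|%:R <= kappa;
  hier_boundary_regular : forall i,
    uniformly_regular kappa d.-1 (boundary (agg_layer i));
  hier_boundary_area : forall i,
    ((kappa^-1 * maxsize ^+ d.-1)%:E <= hausdorff d.-1 (boundary (agg_layer i))
      <= (kappa * maxsize ^+ d.-1)%:E)%E;
  hier_degree : (p' <= deg X)%N;
  hier_unisolvent : forall i q, Qpoly p' q -> forall y, box i y ->
    `|q y| <= kappa * \big[Num.max/0]_(x <- owned i) `|q x| }.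

Definition local_space i : set ('rV[R]_d -> R) :=
  [set v | exists c : 'rV[R]_d -> R, v = interp X (owned i) c].

(* Pi_i: the values at the support points on the boundary are dropped. *)
Definition interpV v := interp X (interior_points Omega X) v.

Definition Aform_loc u v := Aform Omega X (interpV u) (interpV v).
Definition Dform_loc u v := Dform Omega X (interpV u) (interpV v).

Definition coarse_space (p' : nat) i : set ('rV[R]_d -> R) :=
  [set interp X (owned i) q | q in Qpoly p'].

(* D_i may be degenerate on V_i (support points on the boundary of Omega), so
   that Q_i need not be unique; its residual norms are. *)
Definition is_D_projection (p' : nat) i (Q : ('rV[R]_d -> R) -> 'rV[R]_d -> R) :=
  forall v, local_space i v -> coarse_space p' i (Q v) /\
    forall w, coarse_space p' i w -> Dform_loc (v - Q v) w = 0.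

(* The supremum is in \bar R, so that no boundedness is presupposed. *)
Definition mu_inv (p' : nat) i : \bar R :=
  ereal_sup
    [set (inf [set Dform_loc (v - w) (v - w) | w in coarse_space p' i]
          / Aform_loc v v)%:E
      | v in [set v | local_space i v /\ Aform_loc v v != 0]].

End agglomerates.

(* Main.v *)
(* It suffices to approximate v_i by a constant. All estimates are discrete: on a
   cell, with q the pullback of v_i and M the maximum of the partial derivatives of
   q, the nodal values differ by at most 2 d M. By Markov's inequality some partial
   derivative of q stays above M / 2 on a cube of radius ~ p^-2, whose image contains
   a cube of radius ~ h p^-2; hence the squared differences are at most
   C p^(2d) h^(2-d) times the Dirichlet energy of the cell. By Fejer's bound
   |l_i| <= 1 for the Lagrange polynomials at the Gauss-Lobatto nodes and by Markov,
   the diagonal entries of D are at most C p^4 h^(d-2).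
   A walk through neighbouring cells, all of whose points are owned, either reaches a
   layer cell, where v_i has a zero (constant 0), or covers the whole mesh, by
   connectedness of Omega (constant v_i(x0)). A walk visits at most C l_i cells,
   because by volume packing each point lies in boundedly many closed cells; the sum
   over the l_i owned points then gives C l_i^2 p^(4 + 2d), and H_i >= h / rho.
   For mu_i, the same bound is applied to Pi_i v_i on Omega. *)

Require Import Defs.
From mathcomp Require Import all_boot all_order all_algebra.
From mathcomp Require Import all_classical all_reals all_analysis.
From mathcomp Require Import measurable_realfun ring lra zify.
Import Order.TTheory GRing.Theory Num.Theory.
Import numFieldNormedType.Exports.
Local Open Scope classical_set_scope.
Local Open Scope ring_scope.

Set Implicit Arguments. Unset Strict Implicit. Unset Printing Implicit Defensive.


(** * Gauss-Lobatto-Legendre nodes *)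

(** No change of variables is made. An energy is bounded below on disjoint cubes inside the cells
    and above by means of cubes that contain them, so a geometry map enters only through the
    two-sided bounds on its derivative and a quantitative open mapping property ([g_open]). The
    maximum norm is used throughout because its balls are cubes, whose measure is explicit; a
    passage to or from [enorm] costs at most a factor d. [Rintegral] returns 0 on an infinite
    integral, so lower bounds on energies need finiteness first, hence measurable and bounded
    gradients of finite element functions. The Lipschitz property of the domain is what puts the
    open cells inside Omega itself, although the mesh covers only its closure; both the
    connectedness argument and the bound over Omega rest on this. *)

Section Lagrange.
Context {F : fieldType} {n : nat} (g : 'I_n.+1 -> F).

Definition lagr (i : 'I_n.+1) : {poly F} :=
  \prod_(j < n.+1 | j != i) ((g i - g j)^-1 *: ('X - (g j)%:P)).

Hypothesis g_inj : injective g.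

Lemma lagr_node i j : (lagr i).[g j] = (i == j)%:R.
Proof.
rewrite /lagr horner_prod; have [->|ij] := eqVneq i j.
  rewrite big1// => k kj; rewrite hornerZ hornerXsubC mulVf// subr_eq0.
  by apply: contra kj => /eqP/g_inj ->.
rewrite (bigD1 j) 1?eq_sym//= hornerZ hornerXsubC subrr mulr0 mul0r.
by [].
Qed.

Lemma size_lagr i : (size (lagr i) <= n.+1)%N.
Proof.
apply: leq_trans (size_poly_prod_leq _ _) _.
rewrite leq_subLR; apply: (@leq_trans (2 * #|[pred j : 'I_n.+1 | j != i]|).+1).
  rewrite ltnS mulnC -sum_nat_const; apply: leq_sum => j _.
  by apply: leq_trans (size_scale_leq _ _) _; rewrite size_XsubC.
have := cardC (pred1 i); rewrite card1 card_ord => ci.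
have -> : #|[pred j : 'I_n.+1 | j != i]| = n.
  move: ci; rewrite add1n => -[ci]; apply: etrans ci.
  by apply: eq_card => j; rewrite !inE.
lia.
Qed.

Lemma lagr_uniq (q r : {poly F}) : (size q <= n.+1)%N -> (size r <= n.+1)%N ->
  (forall i, q.[g i] = r.[g i]) -> q = r.
Proof.
move=> sq sr qr; apply/eqP; rewrite -subr_eq0; apply/negPn/negP => qr0.
have := max_poly_roots qr0 (rs := [seq g i | i <- enum 'I_n.+1]).
have -> : all (root (q - r)) [seq g i | i <- enum 'I_n.+1].
  by apply/allP => _ /mapP[i _ ->]; rewrite rootE hornerD hornerN qr subrr.
rewrite map_inj_uniq// enum_uniq size_map size_enum_ord => /(_ isT isT).
apply/negP; rewrite -leqNgt; apply: leq_trans (size_polyD _ _) _.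
by rewrite size_polyN geq_max sq sr.
Qed.

Lemma lagr_interp (q : {poly F}) : (size q <= n.+1)%N ->
  q = \sum_i q.[g i] *: lagr i.
Proof.
move=> sq; apply: lagr_uniq => //.
  apply: leq_trans (size_sum _ _ _) _; apply/bigmax_leqP => i _.
  exact: leq_trans (size_scale_leq _ _) (size_lagr i).
move=> i; rewrite horner_sum (bigD1 i)//= hornerZ lagr_node eqxx mulr1.
rewrite big1 ?addr0// => j /negbTE ji.
by rewrite hornerZ lagr_node ji mulr0.
Qed.

Definition nodal : {poly F} := \prod_j ('X - (g j)%:P).

(** Transfers derivatives of [nodal] to [lagr i]: at [g i] the first derivative of [nodal] is [w],
    and its second is [2 w] times the first derivative of [lagr i]. *)
Lemma nodal_lagr i : exists2 w : F, w != 0 & nodal = w *: (('X - (g i)%:P) * lagr i).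
Proof.
exists (\prod_(j < n.+1 | j != i) (g i - g j)).
  apply/prodf_neq0 => j ji; rewrite subr_eq0; apply: contra ji => /eqP/g_inj ->; exact: eqxx.
rewrite /nodal (bigD1 i)//= scalerAr; congr (_ * _).
rewrite /lagr scaler_prod scalerA -big_split/= [X in X *: _]big1 ?scale1r// => j ji.
rewrite divff// subr_eq0; apply: contra ji => /eqP/g_inj ->; exact: eqxx.
Qed.

Lemma nodal_dvd (q : {poly F}) : (forall i, q.[g i] = 0) -> nodal %| q.
Proof.
move=> q0; have -> : nodal = \prod_(z <- [seq g i | i <- enum 'I_n.+1]) ('X - z%:P).
  by rewrite big_map enumT.
apply: uniq_roots_dvdp.
  by apply/allP => _ /mapP[i _ ->]; rewrite rootE q0.
by rewrite uniq_rootsE map_inj_uniq// enum_uniq.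
Qed.

Lemma size_nodal : size nodal = n.+2.
Proof. by rewrite /nodal size_prod_XsubC /index_enum -enumT size_enum_ord. Qed.

Lemma nodal_neq0 : nodal != 0.
Proof. by rewrite -size_poly_eq0 size_nodal. Qed.

Lemma nodal_monic : nodal \is monic.
Proof. exact: monic_prod_XsubC. Qed.

End Lagrange.

Section Legendre.
Context {R : realType}.
Implicit Types f u : {poly R}.

Lemma derivnXM f m :
  ('X * f)^`(m.+1) = 'X * f^`(m.+1) + f^`(m) *+ m.+1.
Proof.
have := derivnMXaddC m f 0; rewrite addr0 mulrC => ->.
by rewrite addrC [X in X + _]mulrC.
Qed.

Let u n : {poly R} := ('X^2 - 1) ^+ n.

(** With [u = (X^2 - 1)^n] one has [(X^2 - 1) u' = 2 n X u]; differentiating [n + 1] times gives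
    Legendre's equation for the n-th derivative. In [du] all products are by [X] alone, so that
    [derivnXM] suffices. *)
Lemma rodrigues_ode n : (0 < n)%N ->
  let y := (u n)^`(n) in
  ('X^2 - 1) * y^`()^`() + ('X * y^`()) *+ 2 = y *+ (n * n.+1).
Proof.
case: n => // m _ /=.
set n := m.+1; set y := (u n)^`(n).
have du : 'X * ('X * (u n)^`()) - (u n)^`() = ('X * u n) *+ (2 * n).
  rewrite /u deriv_exp derivB derivXn derivC subr0 expr1 -/n.
  have -> : ('X^2 - 1) ^+ n = ('X^2 - 1) * ('X^2 - 1) ^+ m :> {poly R} by exact: exprS.
  rewrite -[n.-1]/m; ring.
have := congr1 (fun f => f^`(m.+2)) du.
rewrite derivnB derivnMn !derivnXM -!derivSn => E.
rewrite /y -!derivnS; move: E.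
move: (u n)^`(m.+3) (u n)^`(m.+2) (u n)^`(m.+1) => y2 y1 y0 /eqP; rewrite -subr_eq0.
move=> E; apply/eqP; rewrite -subr_eq0; move: E; congr (is_true (_ == 0)).
by rewrite /n; ring.
Qed.
End Legendre.

Section Gll.
Context {R : realType}.

(** In characteristic 0 the leading coefficient is multiplied by a nonzero falling factorial, so the
    degree drops by exactly [n]. *)
Lemma size_derivn (q : {poly R}) n m : size q = (n + m).+1 -> size q^`(n) = m.+1.
Proof.
move=> sq; apply/eqP; rewrite eqn_leq; apply/andP; split.
  apply/leq_sizeP => j mj; rewrite coef_derivn nth_default ?mul0rn// sq.
  lia.
apply: contraT; rewrite -ltnNge ltnS => /leq_sizeP/(_ m (leqnn _))/eqP.
rewrite coef_derivn -mulr_natr mulf_eq0 pnatr_eq0.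
have := lead_coef_eq0 q; rewrite lead_coefE sq/= => ->.
by rewrite -size_poly_eq0 sq/= eqn0Ngt ffact_gt0 leq_addr.
Qed.

Lemma size_XX1 : size ('X^2 - 1 : {poly R}) = 3%N.
Proof. exact: size_XnsubC. Qed.

Lemma size_legendre n : size (legendre n : {poly R}) = n.+1.
Proof.
rewrite /legendre size_scale; last by rewrite invr_eq0 pnatr_eq0 muln_eq0 expn_eq0/= -lt0n fact_gt0.
apply: size_derivn.
have := size_exp ('X^2 - 1 : {poly R}) n; rewrite size_XX1/=.
have : size (('X^2 - 1 : {poly R}) ^+ n) != 0%N.
  by rewrite size_poly_eq0 expf_neq0// -size_poly_eq0 size_XX1.
by case: (size _) => // s _ /= ->; rewrite mul2n addnn.
Qed.

Lemma legendre_ode n : (0 < n)%N ->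
  ((1 - 'X^2) * (legendre n : {poly R})^`())^`() = - (legendre n *+ (n * n.+1)).
Proof.
move=> n0; have /= := rodrigues_ode (R := R) n0; rewrite /legendre.
set c := (_ ^-1); set y := _^`(n) => E.
rewrite derivZ -scalerAr derivZ derivM derivB derivXn derivC sub0r expr1 -/y.
rewrite scalerMnr -scalerN -E; congr (_ *: _); ring.
Qed.

Lemma coef_sqr_top (q : {poly R}) n : (size q <= n.+1)%N -> (q ^+ 2)`_n.*2 = q`_n ^+ 2.
Proof.
move=> sq; rewrite expr2 coefM.
have nn : (n < n.*2.+1)%N by lia.
rewrite (bigD1 (Ordinal nn))//= [X in _ + X]big1 ?addr0 => [|j].
  by rewrite (_ : (n.*2 - n = n)%N); last by lia.
rewrite -val_eqE/= => jn; case: (ltngtP j n) jn => // jn _.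
  by rewrite mulrC nth_default ?mul0r//; apply: leq_trans sq _; lia.
by rewrite nth_default ?mul0r//; apply: leq_trans sq _; lia.
Qed.

Context {p : nat} {g : 'I_p.+1 -> R}.
Hypotheses (p0 : (0 < p)%N) (gg : is_gll g).

Lemma gll_inj : injective g.
Proof.
case: gg => ltg _ i j gij; apply/val_inj => /=.
have [/ltg|/ltg|//] := ltngtP i j; by rewrite gij ltxx.
Qed.

(** The [p + 1] nodes are distinct roots of a polynomial of degree [p + 1], hence all of its roots.
    In particular 1 and -1 are nodes. *)
Lemma gll_nodal : exists2 c : R, c != 0 &
  (1 - 'X^2) * (legendre p)^`() = c *: nodal g.
Proof.
have sL : size ((legendre p)^`() : {poly R}) = p.
  rewrite -derivn1 -(prednK p0); apply: size_derivn; rewrite size_legendre; lia.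
have s1 : size (1 - 'X^2 : {poly R}) = 3%N by rewrite -opprB size_polyN size_XX1.
have sN : size ((1 - 'X^2) * (legendre p)^`() : {poly R}) = p.+2.
  by rewrite size_mul -?size_poly_eq0 ?sL ?s1// -lt0n.
have d : nodal g %| (1 - 'X^2) * (legendre p)^`().
  apply: nodal_dvd; first exact: gll_inj.
  by move=> i; case: gg => _ /(_ i)/rootP.
have : nodal g %= (1 - 'X^2) * (legendre p)^`().
  by rewrite -(dvdp_size_eqp d) sN size_nodal.
case/eqpP => -[c1 c2]/= /andP[c10 c20] e.
exists (c2^-1 * c1); first by rewrite mulf_neq0// invr_eq0.
by rewrite -scalerA e scalerA mulVf// scale1r.
Qed.

Lemma gll_end b : exists i, g i = if b then 1 else - 1.
Proof.
have [c c0 e] := gll_nodal.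
have : root (nodal g) (if b then 1 else - 1).
  have := congr1 (fun q => q.[if b then 1 else - 1]) e.
  rewrite hornerZ rootE hornerM hornerD hornerN hornerXn hornerC.
  rewrite (_ : 1 - _ = 0) ?mul0r; last by case: b; ring.
  by move/esym/eqP; rewrite mulf_eq0 (negbTE c0).
rewrite rootE horner_prod => /eqP/eqP; rewrite prodf_seq_eq0 => /hasP[i _ /=].
by rewrite hornerXsubC subr_eq0 => /eqP ->; exists i.
Qed.

(** By Legendre's equation [W = nodal g] satisfies [(1 - X^2) W'' = - p (p + 1) W], and the
    right-hand side vanishes at the nodes. *)
Lemma nodal_deriv2 i : (1 - g i ^+ 2) * (nodal g)^`()^`().[g i] = 0.
Proof.
have [c c0 e] := gll_nodal.
have e1 := legendre_ode p0; rewrite e derivZ in e1.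
have e2 : c *: ((1 - 'X^2) * (nodal g)^`()^`()) = - (c *: nodal g) *+ (p * p.+1).
  by rewrite scalerAr -[c *: _^`()]derivZ e1 derivN derivMn -e mulrN mulrnAr mulNrn.
have := congr1 (fun q => q.[g i]) e2.
rewrite hornerZ hornerMn hornerN hornerZ.
have -> : (nodal g).[g i] = 0.
  by rewrite horner_prod (bigD1 i)//= hornerXsubC subrr mul0r.
rewrite mulr0 oppr0 mul0rn hornerM hornerD hornerN hornerXn hornerC => /eqP.
by rewrite mulf_eq0 (negbTE c0) => /eqP.
Qed.

Lemma lagr_deriv_node i : (1 - g i ^+ 2) * (lagr g i)^`().[g i] = 0.
Proof.
have [w w0 e] := nodal_lagr gll_inj i.
have := nodal_deriv2 i; rewrite e !derivZ derivM derivXsubC mul1r derivD derivM derivXsubC mul1r.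
rewrite hornerZ !hornerD hornerM hornerXsubC subrr mul0r addr0 mulrCA => /eqP.
rewrite mulf_eq0 (negbTE w0)/= -mulr2n mulrnAr mulrn_eq0/= => /eqP //.
Qed.

(* Fejer: [1 - \sum_i l_i^2] vanishes to second order at the interior nodes,
   hence equals [k W^2 / (1 - X^2)], and [k] is minus its leading coefficient. *)
Lemma lagr_sum_sqr : exists2 k : R, 0 <= k &
  (1 - 'X^2) * (1 - \sum_i lagr g i ^+ 2) = k *: nodal g ^+ 2.
Proof.
set S : {poly R} := \sum_i _; set G := 1 - S; set W := nodal g.
have sW : size W = p.+2 by apply: size_nodal.
have W0 : W != 0 by apply: nodal_neq0.
have sS : (size S <= p.*2.+1)%N.
  apply: leq_trans (size_sum _ _ _) _; apply/bigmax_leqP => i _.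
  apply: leq_trans (size_poly_exp_leq _ _) _; have := size_lagr g i; case: (size _) => [|s] //=; lia.
have sG : (size G <= p.*2.+1)%N.
  apply: leq_trans (size_polyD _ _) _; rewrite size_polyN geq_max sS andbT size_poly1.
  by [].
have G0 i : G.[g i] = 0.
  rewrite /G hornerD hornerN hornerC horner_sum (bigD1 i)//= horner_exp lagr_node ?eqxx; last exact: gll_inj.
  rewrite big1 ?expr1n ?addr0 ?subrr// => j /negbTE ji.
  by rewrite horner_exp lagr_node ?ji ?expr0n//; exact: gll_inj.
have /dvdpP[K GK] : W %| G by apply: nodal_dvd => //; exact: gll_inj.
have [K0|K0] := eqVneq K 0.
  by exists 0 => //; rewrite GK K0 mul0r mulr0 scale0r.
have sK : (size K <= p)%N.
  by move: sG; rewrite GK size_mul// sW; move: (size K) => s; lia.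
(* At a node [W] vanishes, so [G' = K W'] there; [G'] is 0 at the interior nodes by
   [lagr_deriv_node], and [W'] is nonzero at every node. *)
have KK i : ((1 - 'X^2) * K).[g i] = 0.
  have [w w0 e] := nodal_lagr gll_inj i.
  have W'0 : W^`().[g i] != 0.
    by rewrite /W e derivZ derivM derivXsubC mul1r hornerZ hornerD hornerM hornerXsubC subrr mul0r addr0 lagr_node ?eqxx ?mulr1//; exact: gll_inj.
  have : (1 - g i ^+ 2) * G^`().[g i] = 0.
    rewrite /G derivB derivC sub0r hornerN mulrN /S linear_sum horner_sum.
    rewrite (bigD1 i)//= big1 ?addr0 => [|j /negbTE ji].
      rewrite deriv_exp expr1 hornerMn hornerM lagr_node ?eqxx ?mulr1; last exact: gll_inj.
      by rewrite mulrnAr lagr_deriv_node mul0rn oppr0.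
    rewrite deriv_exp expr1 hornerMn hornerM lagr_node ?ji ?mulr0 ?mul0rn//; exact: gll_inj.
  have Wi : W.[g i] = 0 by rewrite /W e hornerZ hornerM hornerXsubC subrr mul0r mulr0.
  rewrite GK derivM hornerD !hornerM Wi mulr0 add0r mulrA => /eqP.
  rewrite mulf_eq0 (negbTE W'0) orbF => /eqP E.
  by rewrite hornerD hornerN hornerXn hornerC.
have /dvdpP[k Kk] : W %| (1 - 'X^2) * K by apply: nodal_dvd => //; exact: gll_inj.
have s1 : size (1 - 'X^2 : {poly R}) = 3%N by rewrite -opprB size_polyN size_XX1.
have sk : (size k <= 1)%N.
  have [->|k0] := eqVneq k 0; first by rewrite size_poly0.
  have := congr1 (fun q : {poly R} => size q) Kk.
  rewrite !size_mul -?size_poly_eq0 ?s1 ?sW ?size_poly_eq0//.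
  by move: sK; move: (size K) (size k) => a b; lia.
have kE := size1_polyC sk.
have E : (1 - 'X^2) * G = k`_0 *: W ^+ 2.
  by rewrite GK mulrA Kk -mulrA -mul_polyC -kE.
exists k`_0 => //.
have := congr1 (fun q : {poly R} => q`_(p.+1).*2) E.
rewrite coefZ coef_sqr_top ?sW//.
have /monicP := nodal_monic g; rewrite lead_coefE sW/= => -> .
rewrite expr1n mulr1 mulrBl mul1r coefB coefXnM.
have -> : G`_(p.+1).*2 = 0 by rewrite nth_default//; apply: leq_trans sG _; lia.
rewrite (_ : (p.+1.*2 < 2)%N = false); last by lia.
have -> : ((p.+1).*2 - 2 = p.*2)%N by lia.
rewrite /G coefB coef1 sub0r opprB; case: eqP => [|_]; first by lia.
rewrite subr0 /S coef_sum => <-; apply: sumr_ge0 => i _.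
by rewrite coef_sqr_top ?size_lagr// sqr_ge0.
Qed.

(** Dividing [lagr_sum_sqr] by [1 - x^2 > 0] shows that the squares of all Lagrange polynomials sum
    to at most 1 at [x]. The division fails only at 1 and -1, which are nodes. *)
Lemma lagr_gll_le1 i x : -1 <= x <= 1 -> `|(lagr g i).[x]| <= 1.
Proof.
move=> x1.
have [[j ->]|nx] := pselect (exists j, x = g j).
  by rewrite lagr_node; [case: eqP; rewrite ?normr1 ?normr0|exact: gll_inj].
have x2 : 0 < 1 - x ^+ 2.
  have [j1 j1E] := gll_end true; have [j2 j2E] := gll_end false.
  have : x != 1 by apply/eqP => xE; apply: nx; exists j1; rewrite j1E.
  have : x != -1 by apply/eqP => xE; apply: nx; exists j2; rewrite j2E.
  move: x1 => /andP[]; rewrite !le_eqVlt => /orP[/eqP<-|xl]; first by rewrite eqxx.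
  move=> /orP[/eqP->|xr]; first by rewrite eqxx.
  move=> _ _; nra.
have [k k0 E] := lagr_sum_sqr.
have := congr1 (fun q : {poly R} => q.[x]) E.
rewrite hornerM hornerD hornerN hornerXn hornerC hornerZ hornerD hornerN hornerC horner_exp => Ex.
have : 0 <= 1 - (\sum_i lagr g i ^+ 2).[x].
  by rewrite -(pmulr_rge0 _ x2) Ex mulr_ge0// sqr_ge0.
rewrite subr_ge0 horner_sum (bigD1 i)//= horner_exp => le1.
rewrite -(@expr_le1 _ 2)//; rewrite real_normK ?num_real//.
apply: le_trans le1; rewrite lerDl; apply: sumr_ge0 => j _.
by rewrite horner_exp sqr_ge0.
Qed.
End Gll.

Section Gll2.
Context {R : realType}.

Lemma horner_nneg_gt0 (q : {poly R}) y : q \is a polyOver Num.nneg -> q != 0 -> 0 < y -> 0 < q.[y].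
Proof.
move=> /polyOverP q0 qn y0; rewrite horner_coef.
have sq : (0 < size q)%N by rewrite size_poly_gt0.
have k : ((size q).-1 < size q)%N by rewrite prednK.
rewrite (bigD1 (Ordinal k))//= ltr_pwDl//; last first.
  by apply: sumr_ge0 => i _; rewrite mulr_ge0 ?exprn_ge0 ?(ltW y0)//; exact: q0.
rewrite mulr_gt0 ?exprn_gt0// lt_neqAle eq_sym; apply/andP; split; last exact: q0.
by rewrite -lead_coefE lead_coef_eq0.
Qed.

Lemma derivn_comp_affine (q : {poly R}) (c b : R) m :
  (q \Po (c *: 'X + b%:P))^`(m) = c ^+ m *: (q^`(m) \Po (c *: 'X + b%:P)).
Proof.
elim: m => [|m IH]; first by rewrite expr0 scale1r.
rewrite derivnS IH derivZ deriv_comp derivD derivZ derivX derivC addr0 -derivnS.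
by rewrite alg_polyC mulrC mul_polyC scalerA exprSr.
Qed.

(* Shifted to the endpoint [c = 1] or [c = -1], [(X^2 - 1)^n] becomes
   [(X^2 + 2 X)^n], which has nonnegative coefficients. *)
Lemma legendre_deriv_neq0 n (c y : R) : (0 < n)%N -> c ^+ 2 = 1 -> 0 < y ->
  (legendre n : {poly R})^`().[c * y + c] != 0.
Proof.
move=> n0 c1 y0.
rewrite /legendre derivZ hornerZ mulf_eq0 negb_or invr_eq0 pnatr_eq0 muln_eq0 expn_eq0/= -lt0n fact_gt0/=.
pose u : {poly R} := ('X^2 - 1) ^+ n; rewrite -/u -derivnS.
pose l : {poly R} := c *: 'X + c%:P.
have cn0 : c != 0 by apply/eqP => c0; move: c1; rewrite c0 expr0n => /eqP; rewrite eq_sym oner_eq0.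
have uE : u \Po l = ('X^2 + 2%:P * 'X) ^+ n.
  rewrite /u rmorphXn/= comp_polyB comp_Xn_poly comp_polyC; congr (_ ^+ n).
  have -> : l = c%:P * ('X + 1) by rewrite /l -mul_polyC mulrDr mulr1.
  rewrite exprMn -rmorphXn/= c1 mul1r.
  have -> : (2%:P : {poly R}) = 2%:R by rewrite -polyC_natr.
  ring.
have : (u \Po l)^`(n.+1).[y] != 0.
  rewrite gt_eqF//; apply: horner_nneg_gt0 => //.
    rewrite uE; apply: polyOver_derivn; apply: rpredX; apply: rpredD.
      by apply: rpredX; exact: polyOverX.
    by apply: rpredM; [rewrite polyOverC nnegrE|exact: polyOverX].
  have su : size (u \Po l) = (n.+1 + n.-1).+1.
    have -> : (n.+1 + n.-1 = 2 * n)%N by lia.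
    have s2 : size ('X^2 + 2%:P * 'X : {poly R}) = 3%N.
      rewrite size_polyDl size_polyXn//; rewrite mul_polyC.
      by apply: leq_ltn_trans (size_scale_leq _ _) _; rewrite size_polyX.
    have := size_exp ('X^2 + 2%:P * 'X : {poly R}) n; rewrite s2 -uE/=.
    have : size (u \Po l) != 0%N.
      by rewrite size_poly_eq0 uE expf_neq0// -size_poly_eq0 s2.
    by case: (size _) => // k _ /= ->.
  by rewrite -size_poly_eq0 (size_derivn su).
rewrite derivn_comp_affine hornerZ mulf_eq0 expf_eq0 (negbTE cn0) andbF/=.
by rewrite horner_comp hornerD hornerZ hornerX hornerC.
Qed.

(** [is_gll] only asks for roots; that they lie in [-1, 1] follows since the derivative of
    [legendre] has no root beyond the endpoints. *)
Lemma gll_le1 p (g : 'I_p.+1 -> R) i : (0 < p)%N -> is_gll g -> `|g i| <= 1.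
Proof.
move=> p0 [_ /(_ i)]; rewrite rootE hornerM mulf_eq0 => /orP[|L0].
  rewrite hornerD hornerN hornerXn hornerC subr_eq0 eq_sym => /eqP g1.
  by rewrite -(@expr_le1 _ 2)// real_normK ?num_real// g1.
rewrite leNgt; apply/negP => g1.
have [gi|gi] := leP 0 (g i).
  have := @legendre_deriv_neq0 p 1 (g i - 1) p0 (expr1n _ _).
  rewrite mul1r subrK L0 => /(_ _)/wrap[|//].
  by move: g1; rewrite ger0_norm// subr_gt0.
have := @legendre_deriv_neq0 p (-1) (- g i - 1) p0.
rewrite (_ : -1 * (- g i - 1) + -1 = g i); last by ring.
rewrite L0 sqrrN expr1n => /(_ erefl _)/wrap[|//].
by move: g1; rewrite ltr0_norm// subr_gt0.
Qed.
End Gll2.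

(** * Markov's inequality *)

Section Markov.
Context {R : realType}.

(* The pair (T_n, T_{n+1}) of Chebyshev polynomials. *)
Fixpoint cheb2 n : {poly R} * {poly R} :=
  match n with
  | 0 => (1, 'X)
  | m.+1 => let: (s, t) := cheb2 m in (t, ('X * t) *+ 2 - s)
  end.

Definition cheb n : {poly R} := (cheb2 n).1.

Lemma chebSS n : cheb n.+2 = ('X * cheb n.+1) *+ 2 - cheb n.
Proof. by rewrite /cheb /=; case: (cheb2 n). Qed.

Lemma size_cheb n : (size (cheb n) <= n.+1)%N.
Proof.
elim/ltn_ind: n => -[|[|n]] IH; rewrite ?size_poly1 ?size_polyX//.
rewrite chebSS; apply: leq_trans (size_polyD _ _) _.
rewrite size_polyN geq_max; apply/andP; split; last first.
  by apply: leq_trans (IH n _) _ => //; lia.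
rewrite -scaler_nat; apply: leq_trans (size_scale_leq _ _) _.
apply: leq_trans (size_polyMleq _ _) _; rewrite size_polyX/=.
exact: IH.
Qed.

Lemma cheb_cos n (t : R) : (cheb n).[cos t] = cos (n%:R * t).
Proof.
elim/ltn_ind: n => -[|[|n]] IH.
- by rewrite hornerC mul0r cos0.
- by rewrite hornerX mul1r.
rewrite chebSS hornerD hornerN hornerMn hornerM hornerX !IH//.
have -> : n.+2%:R * t = n.+1%:R * t + t by rewrite -addn1 natrD mulrDl mul1r.
have -> : n%:R * t = n.+1%:R * t - t by rewrite -[n.+1]addn1 natrD mulrDl mul1r addrK.
rewrite cosB cosD; ring.
Qed.

(** The source of the factor [p ^ 2] in [markov_end]. *)
Lemma cheb_deriv1 n : (cheb n)^`().[1] = n%:R ^+ 2.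
Proof.
have c1 m : (cheb m).[1] = 1 by rewrite -[in LHS]cos0 cheb_cos mulr0 cos0.
elim/ltn_ind: n => -[|[|n]] IH.
- by rewrite derivC hornerC expr0n.
- by rewrite derivX hornerC expr1n.
rewrite chebSS derivB derivMn derivM derivX mul1r.
rewrite hornerD hornerN hornerMn hornerD hornerM hornerX !IH//.
rewrite c1 -[n.+2]addn2 -[n.+1]addn1 !natrD; ring.
Qed.

Variable p : nat.
Hypothesis p0 : (0 < p)%N.

Definition chebnode (i : 'I_p.+1) : R := cos (i%:R * (pi / p%:R)).

Let arg (i : 'I_p.+1) : (i%:R * (pi / p%:R) : R) \in `[0, pi].
Proof.
rewrite in_itv/= mulr_ge0 ?divr_ge0 ?pi_ge0//=.
rewrite mulrCA ler_piMr ?pi_ge0// ler_pdivrMr ?ltr0n// mul1r ler_nat.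
by rewrite -ltnS.
Qed.

Lemma chebnode_lt (i j : 'I_p.+1) : (i < j)%N -> chebnode j < chebnode i.
Proof.
move=> ij; rewrite /chebnode ltr_cos//.
by rewrite ltr_pM2r ?ltr_nat// divr_gt0 ?pi_gt0 ?ltr0n.
Qed.

Lemma chebnode_inj : injective chebnode.
Proof.
move=> i j ij; apply/val_inj => /=.
by have [/chebnode_lt|/chebnode_lt|//] := ltngtP i j; rewrite ij ltxx.
Qed.

Lemma cheb_node i : (cheb p).[chebnode i] = (-1) ^+ i.
Proof.
rewrite cheb_cos (_ : _ * _ = i%:R * pi); last by field; rewrite pnatr_eq0 -lt0n.
elim: (nat_of_ord i) => [|m IH]; first by rewrite mul0r cos0.
by rewrite -addn1 natrD mulrDl mul1r cosDpi IH exprD expr1 mulrN1.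
Qed.

Lemma prod_XsubC_mono (I : Type) (s : seq I) (P : pred I) (a : I -> R) y :
  (forall i, a i <= y) -> let q := \prod_(i <- s | P i) ('X - (a i)%:P) in
  0 <= q.[y] /\ 0 <= q^`().[y].
Proof.
move=> ay q; apply: (big_ind (fun q : {poly R} => 0 <= q.[y] /\ 0 <= q^`().[y])).
- by rewrite derivC !hornerC; split.
- by move=> f r [q0 q1] [r0 r1]; rewrite derivM hornerD !hornerM addr_ge0// mulr_ge0.
- by move=> i _; rewrite derivXsubC hornerXsubC hornerC subr_ge0.
Qed.

(** The nodes decrease, so among the factors [(g i - g j)^-1] exactly those with [j < i] are
    negative. The product of the [X - g j] has a nonnegative derivative at 1, which is to the right
    of its roots. *)
Lemma lagr_chebnode_sign (i : 'I_p.+1) : 0 <= (-1) ^+ i * (lagr chebnode i)^`().[1].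
Proof.
rewrite /lagr scaler_prod derivZ hornerZ mulrA mulr_ge0//; last first.
  by have [] := @prod_XsubC_mono _ (index_enum 'I_p.+1) (fun j => j != i) chebnode 1 (fun j => cos_le1 _).
have -> : (-1) ^+ i = \prod_(j < p.+1 | j != i) (-1) ^+ (j < i)%N :> R.
  rewrite prodrXr; congr (_ ^+ _).
  rewrite -(big_mkord (fun j => j != i :> nat) (fun j => (j < i)%N : nat)).
  have ip : (i <= p.+1)%N by rewrite ltnW.
  rewrite (big_cat_nat (n := i))//= [X in (_ + X)%N]big_nat_cond [X in (_ + X)%N]big1 ?addn0; last first.
    by move=> j /andP[/andP[ij _] _]; rewrite ltnNge ij.
  rewrite big_nat_cond (eq_bigr (fun=> 1%N)) => [|j /andP[/andP[_ ->]]//].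
  rewrite (eq_bigl (fun j => (0 <= j < i)%N && true)) => [|j].
    by rewrite -big_nat_cond sum_nat_const_nat subn0 muln1.
  by case: ltngtP; rewrite /= ?andbT ?andbF.
rewrite -big_split/=; apply: prodr_ge0 => j ji.
case: ltngtP => ij; rewrite ?expr0 ?expr1 ?mul1r ?mulN1r.
- by rewrite -invrN invr_ge0 opprB subr_ge0 ltW// chebnode_lt.
- by rewrite invr_ge0 subr_ge0 ltW// chebnode_lt.
- by move/val_inj: ij ji => ->; rewrite eqxx.
Qed.

(* Lagrange interpolation at the Chebyshev extremal points: the weights
   [l_i'(1)] alternate in sign, as does T_p at the nodes. *)
Lemma markov_end (q : {poly R}) (M : R) : (size q <= p.+1)%N ->
  (forall t, -1 <= t <= 1 -> `|q.[t]| <= M) -> `|q^`().[1]| <= p%:R ^+ 2 * M.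
Proof.
move=> sq qM.
have -> : q^`().[1] = \sum_i q.[chebnode i] * (lagr chebnode i)^`().[1].
  rewrite {1}(lagr_interp chebnode_inj sq) linear_sum horner_sum.
  by apply: eq_bigr => i _; rewrite linearZ hornerZ.
apply: le_trans (ler_norm_sum _ _ _) _.
rewrite -cheb_deriv1.
have -> : (cheb p)^`().[1] = \sum_i `|(lagr chebnode i)^`().[1]|.
  rewrite {1}(lagr_interp chebnode_inj (size_cheb p)) linear_sum horner_sum.
  apply: eq_bigr => i _; rewrite linearZ hornerZ cheb_node.
  rewrite -[LHS]ger0_norm ?lagr_chebnode_sign// normrM normrX normrN1 expr1n mul1r.
  by [].
rewrite mulr_suml; apply: ler_sum => i _; rewrite normrM mulrC ler_wpM2l//.
by apply: qM; rewrite cos_geN1 cos_le1.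
Qed.

(** The point [x] is made an endpoint of a subinterval of [-1, 1], parametrised by [t -> a t + b]
    with [x] at [t = 1]. It can be given length at least 1, so [|a| >= 1/2], and this costs the
    factor 2 over [markov_end]. *)
Lemma markov (q : {poly R}) (M : R) : (size q <= p.+1)%N ->
  (forall t, -1 <= t <= 1 -> `|q.[t]| <= M) ->
  forall x, -1 <= x <= 1 -> `|q^`().[x]| <= 2 * p%:R ^+ 2 * M.
Proof.
move=> sq qM x x1.
have M0 : 0 <= M by apply: le_trans (qM x x1).
have [a [b [a2 abx ab]]] : exists a b, [/\ 1 / 2 <= `|a|, a + b = x &
    forall t, -1 <= t <= 1 -> -1 <= a * t + b <= 1].
  have [x0|x0] := leP 0 x.
    exists ((1 + x) / 2), ((x - 1) / 2); split => [||t t1]; first by rewrite ger0_norm; lra.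
      by field.
    by nra.
  exists ((x - 1) / 2), ((x + 1) / 2); split => [||t t1]; first by rewrite ler0_norm; lra.
    by field.
  by nra.
pose l : {poly R} := a *: 'X + b%:P; pose r := q \Po l.
have sr : (size r <= p.+1)%N.
  apply: leq_trans (size_comp_poly_leq _ _) _.
  have : (size l <= 2)%N.
    apply: leq_trans (size_polyD _ _) _; rewrite geq_max.
    rewrite (leq_trans (size_scale_leq _ _)) ?size_polyX//=.
    by rewrite (leq_trans (size_polyC_leq1 _)).
  move: sq; move: (size q) (size l) => k m; nia.
have := @markov_end r M sr.
rewrite /r deriv_comp hornerM horner_comp.
have hE t : l.[t] = a * t + b by rewrite hornerD hornerZ hornerX hornerC.
rewrite hE mulr1 abx /l derivD derivZ derivX derivC addr0 hornerZ hornerC mulr1 normrM.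
move=> /(_ _)/wrap[] => [t t1|H].
  by rewrite horner_comp hE; apply: qM; apply: ab.
have {}H : `|q^`().[x]| * (1 / 2) <= p%:R ^+ 2 * M.
  by apply: le_trans H; rewrite ler_wpM2l.
rewrite -mulrA; lra.
Qed.

End Markov.

(** * Tensor-product polynomials on the reference cube *)

Section Calculus.
Context {R : realType} {d : nat}.
Implicit Types (x y xi : 'rV[R]_d) (f : 'rV[R]_d -> R).

Lemma coord_le_norm x k : `|x ord0 k| <= `|x|.
Proof.
rewrite [leRHS]/Num.Def.normr/= mx_normrE.
exact: (le_bigmax _ (fun ij => `|x ij.1 ij.2|) (ord0, k)).
Qed.

Lemma norm_le_coord x (M : R) : 0 <= M -> (forall k, `|x ord0 k| <= M) -> `|x| <= M.
Proof.
move=> M0 xM; rewrite [leLHS]/Num.Def.normr/= mx_normrE.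
by apply: bigmax_le => // -[i k] _ /=; rewrite ord1.
Qed.

Lemma differentiable_bigsum (I : Type) (s : seq I) (F : I -> 'rV[R]_d -> R) x :
  (forall i, differentiable (F i) x) -> differentiable (fun y => \sum_(i <- s) F i y) x.
Proof.
move=> dF; elim: s => [|i s IH].
  rewrite (_ : (fun _ => _) = cst 0); first exact: differentiable_cst.
  by apply/funext => y; rewrite big_nil.
rewrite (_ : (fun _ => _) = F i + (fun y => \sum_(i <- s) F i y)).
  exact: differentiableD.
by apply/funext => y; rewrite big_cons.
Qed.

Lemma differentiable_bigprod (I : Type) (s : seq I) (F : I -> 'rV[R]_d -> R) x :
  (forall i, differentiable (F i) x) -> differentiable (fun y => \prod_(i <- s) F i y) x.
Proof.
move=> dF; elim: s => [|i s IH].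
  rewrite (_ : (fun _ => _) = cst 1); first exact: differentiable_cst.
  by apply/funext => y; rewrite big_nil.
rewrite (_ : (fun _ => _) = F i * (fun y => \prod_(i <- s) F i y)).
  exact: differentiableM.
by apply/funext => y; rewrite big_cons.
Qed.

Definition monomial q (a : {ffun 'I_d -> 'I_q.+1}) x := \prod_k x ord0 k ^+ a k.

Lemma differentiable_Qpoly q f x : Qpoly q f -> differentiable f x.
Proof.
move=> [c fE]; rewrite (_ : f = fun y => \sum_a c a * \prod_k y ord0 k ^+ a k); last exact/funext.
apply: differentiable_bigsum => a.
apply: (@differentiableM _ _ (cst (c a)) (fun y => \prod_k y ord0 k ^+ a k)).
  exact: differentiable_cst.
apply: differentiable_bigprod => k.
case: (nat_of_ord (a k)) => [|n].
  by rewrite (_ : (fun _ => _) = cst 1); [exact: differentiable_cst|apply/funext => y; rewrite expr0].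
rewrite (_ : (fun _ => _) = (fun y : 'rV[R]_d => y ord0 k) ^+ n.+1).
  exact/differentiableX/differentiable_coord.
by apply/funext => y; rewrite exprfctE.
Qed.

Lemma derive_partial f x xi : differentiable f x ->
  'D_xi f x = \sum_k xi ord0 k * partial f k x.
Proof.
move=> df; rewrite deriveE// [in LHS](row_sum_delta xi) linear_sum.
by apply: eq_bigr => k _; rewrite linearZ /partial deriveE.
Qed.

Lemma is_derive_line f x xi (t : R) : differentiable f (x + t *: xi) ->
  is_derive t 1 (fun s : R => f (x + s *: xi)) ('D_xi f (x + t *: xi)).
Proof.
move=> df.
have E : (fun h : R => h^-1 *: (((fun s : R => f (x + s *: xi)) \o shift t) (h *: 1) - f (x + t *: xi)))
       = (fun h : R => h^-1 *: ((f \o shift (x + t *: xi)) (h *: xi) - f (x + t *: xi))).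
  apply/funext => h /=; congr (_ *: (f _ - _)).
  by rewrite /GRing.scale/= mulr1 -/(GRing.scale _ _) scalerDl addrCA.
apply: DeriveDef; first by rewrite /derivable E; exact: diff_derivable.
by rewrite /derive E.
Qed.

(** Freezing all variables but one reduces partial derivatives and Markov's inequality to univariate
    polynomials. *)
Lemma Qpoly_slice q f x k : Qpoly q f -> exists2 P : {poly R}, (size P <= q.+1)%N &
  forall t, f (x + t *: delta_mx ord0 k) = P.[x ord0 k + t].
Proof.
move=> [c fE].
exists (\sum_a (c a * \prod_(l | l != k) x ord0 l ^+ a l) *: 'X^(a k)).
  apply: leq_trans (size_sum _ _ _) _; apply/bigmax_leqP => a _.
  by apply: leq_trans (size_scale_leq _ _) _; rewrite size_polyXn ltn_ord.
move=> t; rewrite fE horner_sum; apply: eq_bigr => a _.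
rewrite hornerZ hornerXn -mulrA; congr (_ * _).
rewrite (bigD1 k)//= mulrC; congr (_ * _); last first.
  by rewrite !mxE !eqxx mulr1.
by apply: eq_bigr => l /negbTE lk; rewrite !mxE lk andbF mulr0 addr0.
Qed.

Lemma partial_slice f x k (P : {poly R}) : differentiable f x ->
  (forall t, f (x + t *: delta_mx ord0 k) = P.[x ord0 k + t]) ->
  partial f k x = P^`().[x ord0 k].
Proof.
move=> df fP.
have := @is_derive_line f x (delta_mx ord0 k) 0; rewrite scale0r addr0 => /(_ df) D.
rewrite /partial -(@derive_val _ _ _ _ _ _ _ D).
have -> : (fun s : R => f (x + s *: delta_mx ord0 k)) = horner (P \Po ('X + (x ord0 k)%:P)).
  by apply/funext => t; rewrite fP horner_comp hornerD hornerX hornerC addrC.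
rewrite derive_val deriv_comp derivD derivX derivC addr0 mulr1 horner_comp.
by rewrite hornerD hornerX hornerC add0r.
Qed.

Lemma Qpoly_lin (I : Type) (s : seq I) q (F : I -> 'rV[R]_d -> R) (c : I -> R) :
  (forall i, Qpoly q (F i)) -> Qpoly q (fun x => \sum_(i <- s) c i * F i x).
Proof.
move=> FQ; elim: s => [|i s [b IH]].
  by exists (fun=> 0) => x; rewrite big_nil big1// => a _; rewrite mul0r.
have [b' E] := FQ i; exists (fun a => c i * b' a + b a) => x.
rewrite big_cons E IH mulr_sumr -big_split/=; apply: eq_bigr => a _.
by rewrite mulrDl mulrA.
Qed.

Lemma Qpoly_monomial q (a : {ffun 'I_d -> 'I_q.+1}) : Qpoly q (monomial a).
Proof.
exists (fun b => (b == a)%:R) => x; rewrite (bigD1 a)//= eqxx mul1r [X in _ + X]big1 ?addr0//.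
by move=> b /negbTE ->; rewrite mul0r.
Qed.

Lemma partial_Qpoly q f k : Qpoly q f -> Qpoly q (partial f k).
Proof.
move=> Qf; have [c fE] := Qf.
(* The truncated predecessor is harmless at exponent 0, where the coefficient [(a k)%:R] vanishes.
   The degree bound [q] is kept rather than lowered, so that derivatives can be iterated within one
   space. *)
pose lower (a : {ffun 'I_d -> 'I_q.+1}) : {ffun 'I_d -> 'I_q.+1} :=
  [ffun l => if l == k then inord (a k).-1 else a l].
have := @Qpoly_lin _ (index_enum _) q (fun a => monomial (lower a))
  (fun a => c a * (a k)%:R) (fun a => Qpoly_monomial (lower a)).
congr (Qpoly q _); apply/funext => x; apply/esym.
pose P : {poly R} := \sum_a (c a * \prod_(l | l != k) x ord0 l ^+ a l) *: 'X^(a k).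
rewrite (@partial_slice f x k P).
- rewrite /P linear_sum horner_sum; apply: eq_bigr => a _.
  rewrite linearZ/= derivXn hornerZ hornerMn hornerXn /monomial [in RHS](bigD1 k)//=.
  have ak : (a k < q.+1)%N by [].
  rewrite ffunE eqxx inordK; last by case: (nat_of_ord (a k)) ak => //= n /ltnW.
  rewrite [in RHS](eq_bigr (fun l => x ord0 l ^+ a l)) => [|l /negbTE lk]; last by rewrite ffunE lk.
  rewrite -[X in _ * X = _]mulr_natr; ring.
- exact: differentiable_Qpoly Qf.
- move=> t; rewrite fE horner_sum; apply: eq_bigr => a _.
  rewrite hornerZ hornerXn -mulrA; congr (_ * _).
  rewrite (bigD1 k)//= mulrC; congr (_ * _); last first.
    by rewrite !mxE !eqxx mulr1.
  by apply: eq_bigr => l /negbTE lk; rewrite !mxE lk andbF mulr0 addr0.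
Qed.

Lemma markov_Qpoly p f (M : R) : (0 < p)%N -> Qpoly p f ->
  (forall x, ref_closed x -> `|f x| <= M) ->
  forall k x, ref_closed x -> `|partial f k x| <= 2 * p%:R ^+ 2 * M.
Proof.
move=> p0 Qf fM k x xc.
have [P sP fP] := Qpoly_slice x k Qf.
rewrite (partial_slice (differentiable_Qpoly x Qf) fP).
apply: (markov p0 sP); last by rewrite -ler_norml; exact: xc.
move=> t t1; have := fP (t - x ord0 k); rewrite subrKC => <-.
apply: fM => l; rewrite !mxE/=; have [->|lk] := eqVneq l k; rewrite ?mulr1 ?mulr0 ?addr0 ?subrKC//.
by rewrite ler_norml.
Qed.

Lemma ref_closed_convex x y (t : R) : ref_closed x -> ref_closed y -> 0 <= t <= 1 ->
  ref_closed (x + t *: (y - x)).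
Proof.
move=> xc yc t01 k; rewrite !mxE; have := xc k; have := yc k; rewrite !ler_norml; nra.
Qed.

Lemma mvt_line f x y : (forall z, differentiable f z) ->
  exists2 t, 0 <= t <= 1 & f y - f x = 'D_(y - x) f (x + t *: (y - x)).
Proof.
move=> df.
have [||t] := @MVT_segment R (fun s => f (x + s *: (y - x))) (fun s => 'D_(y - x) f (x + s *: (y - x))) 0 1 ler01.
- by move=> s _; exact: is_derive_line.
- apply: continuous_subspaceT => s; apply: differentiable_continuous.
  by apply/derivable1_diffP; have [] := @is_derive_line f x (y - x) s (df _).
- rewrite in_itv/= => t01; rewrite scale0r scale1r addr0 subrKC subr0 mulr1 => E.
  by exists t.
Qed.

Lemma derive_norm_le f x xi (M : R) : differentiable f x ->
  (forall k, `|partial f k x| <= M) -> `|'D_xi f x| <= d%:R * M * `|xi|.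
Proof.
move=> df fM; rewrite derive_partial//; apply: le_trans (ler_norm_sum _ _ _) _.
apply: (@le_trans _ _ (\sum_(k < d) M * `|xi|)).
  by apply: ler_sum => k _; rewrite normrM mulrC ler_pM// coord_le_norm.
by rewrite sumr_const card_ord -[leLHS]mulr_natl mulrA.
Qed.

Lemma lipschitz_ref f (M : R) : (forall z, differentiable f z) ->
  (forall k x, ref_closed x -> `|partial f k x| <= M) ->
  forall x y, ref_closed x -> ref_closed y -> `|f y - f x| <= d%:R * M * `|y - x|.
Proof.
move=> df fM x y xc yc; have [t t01 ->] := mvt_line x y df.
by apply: derive_norm_le => // k; apply: fM; exact: ref_closed_convex.
Qed.

(** The mean value theorem puts the derivative at an intermediate point, and [lipschitz_ref] for
    each partial derivative brings it back to [x]. One factor d comes from [lipschitz_ref], the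
    other from the sum over coordinates. *)
Lemma taylor_ref q f (M : R) : Qpoly q f ->
  (forall k l x, ref_closed x -> `|partial (partial f k) l x| <= M) ->
  forall x y, ref_closed x -> ref_closed y ->
  `|f y - f x - 'D_(y - x) f x| <= d%:R ^+ 2 * M * `|y - x| ^+ 2.
Proof.
move=> Qf fM x y xc yc.
have df z : differentiable f z by exact: differentiable_Qpoly Qf.
have [t t01 ->] := mvt_line x y df.
rewrite !derive_partial// -sumrB; apply: le_trans (ler_norm_sum _ _ _) _.
apply: (@le_trans _ _ (\sum_(k < d) d%:R * M * `|y - x| ^+ 2)); last first.
  by rewrite sumr_const card_ord -[leLHS]mulr_natl le_eqVlt; apply/orP; left; apply/eqP; ring.
apply: ler_sum => k _; rewrite -mulrBr normrM expr2 mulrA mulrC.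
apply: ler_pM => //; last exact: coord_le_norm.
set z := x + _; have zc : ref_closed z by exact: ref_closed_convex.
have M0 : 0 <= M by apply: le_trans (fM k k x xc).
apply: (@le_trans _ _ (d%:R * M * `|z - x|)).
  apply: lipschitz_ref => //; first by move=> w; exact: differentiable_Qpoly (partial_Qpoly k Qf).
  by move=> l w; exact: fM.
rewrite ler_wpM2l ?mulr_ge0// /z addrC addKr normrZ.
by case/andP: t01 => t0 t1; rewrite ger0_norm// ler_piMl.
Qed.

Definition grid_node {p} (g : 'I_p.+1 -> R) (b : {ffun 'I_d -> 'I_p.+1}) : 'rV[R]_d :=
  \row_k g (b k).

(** For a monomial this is a product of univariate interpolation formulas, expanded by
    distributivity. *)
Lemma tensor_interp p (g : 'I_p.+1 -> R) f x : injective g -> Qpoly p f ->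
  f x = \sum_(b : {ffun 'I_d -> 'I_p.+1}) f (grid_node g b) * \prod_k (lagr g (b k)).[x ord0 k].
Proof.
move=> ginj [c fE]; rewrite fE.
under [RHS]eq_bigr do rewrite fE mulr_suml.
rewrite exchange_big/=; apply: eq_bigr => a _.
transitivity (c a * \prod_k \sum_(i < p.+1) g i ^+ a k * (lagr g i).[x ord0 k]).
  congr (_ * _); apply: eq_bigr => k _.
  have s : (size ('X^(a k) : {poly R}) <= p.+1)%N by rewrite size_polyXn ltn_ord.
  have := congr1 (fun q => q.[x ord0 k]) (lagr_interp ginj s).
  rewrite hornerXn horner_sum => ->; apply: eq_bigr => i _.
  by rewrite hornerZ hornerXn.
rewrite bigA_distr_bigA/= mulr_sumr; apply: eq_bigr => b _.
rewrite -mulrA; congr (_ * _); rewrite -big_split/=; apply: eq_bigr => k _.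
by rewrite mxE.
Qed.

Lemma ref_closed_compact : compact (@ref_closed R d).
Proof.
have := @rV_compact R d (fun=> `[-1, 1]%classic) (fun=> @segment_compact _ _ _).
congr compact; apply/seteqP; split => x /= xc k; have := xc k; by rewrite in_itv/= ler_norml.
Qed.

Lemma ref_closed0 : @ref_closed R d 0.
Proof. by move=> k; rewrite mxE normr0. Qed.

End Calculus.

(** * Lebesgue measure *)

Section Measure.
Context {R : realType}.

Definition cube n (a : 'rV[R]_n) (r : R) : set 'rV[R]_n :=
  [set x | forall k, `|x ord0 k - a ord0 k| < r].

Lemma measurable_cube n (a : 'rV[R]_n) r : measurable (cube a r).
Proof.
have -> : cube a r = \bigcap_(k in [set: 'I_n]) ((fun x : 'rV[R]_n => x ord0 k : measurableTypeR R) @^-1` `]a ord0 k - r, a ord0 k + r[).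
  apply/seteqP; split => [x xr k _|x xr k] /=.
    by rewrite in_itv/=; have := xr k; rewrite ltr_distl.
  by have := xr k I; rewrite /= in_itv/= ltr_distl.
apply: fin_bigcap_measurable => // k _.
rewrite -[X in measurable X]setTI; apply: measurable_coord => //.
Qed.

Lemma lebesgue_cube n (a : 'rV[R]_n) r : 0 <= r ->
  lebesgue_rV n (cube a r) = ((2 * r) ^+ n)%:E.
Proof.
move=> r0; elim: n a => [|n IH] a.
  rewrite expr0 /= diracE mem_set//; by case.
rewrite [LHS]/= /lebesgue_step /pushforward.
rewrite (_ : _ @^-1` _ = `]a ord0 ord0 - r, a ord0 ord0 + r[%classic `*`
    cube (\row_j a ord0 (lift ord0 j)) r).
  rewrite product_measure1E//; last exact: measurable_cube.
  rewrite IH.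
  transitivity (lebesgue_measure (`](a ord0 ord0 - r)%R, (a ord0 ord0 + r)%R[%classic : set R) * ((2 * r) ^+ n)%:E)%E; first by [].
  rewrite lebesgue_measure_itv/= lte_fin.
  rewrite (_ : (if _ then _ else _) = (2 * r)%:E).
    by rewrite -EFinM -exprS.
  case: ifPn => h; first by rewrite -EFinB; congr _%:E; ring.
  by congr _%:E; lra.
apply/seteqP; split => [[x y] xy|[x y] [/= xx yy] k] /=.
  split => /=.
    by have := xy ord0; rewrite /cons_rV !mxE unlift_none /= in_itv/= ltr_distl.
  by move=> k; have := xy (lift ord0 k); rewrite !mxE liftK.
move: xx; rewrite in_itv/= -ltr_distl => xx.
by rewrite mxE; case: unliftP => [j|] -> //=; have := yy j; rewrite !mxE.
Qed.

(** The sigma-algebra is generated by the coordinates, so open sets have to be reached: an open set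
    is the countable union of the cubes it contains with rational centre and radius
    [1 / (m + 1)]. *)
Lemma open_measurable_rV n (A : set 'rV[R]_n) : open A -> measurable A.
Proof.
move=> oA.
pose B (z : {ffun 'I_n -> rat} * nat) : set 'rV[R]_n :=
  cube (\row_k ratr (z.1 k)) z.2.+1%:R^-1.
have -> : A = \bigcup_(z in [set z | B z `<=` A]) B z.
  apply/seteqP; split => [x Ax|x [z zA Bz]]; last exact: zA.
  have /nbhs_ballP[e /= e0 eA] := open_nbhs_nbhs (conj oA Ax).
  have [m me] : exists m : nat, m.+1%:R^-1 < e / 2.
    have e2 : 0 < e / 2 by rewrite divr_gt0.
    have [m _ mP] := near_infty_natSinv_lt (PosNum e2).
    by exists m; exact: mP (leqnn _).
  have ex k : exists q : rat, `|x ord0 k - ratr q| < m.+1%:R^-1.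
    have : x ord0 k - m.+1%:R^-1 < x ord0 k + m.+1%:R^-1.
      by rewrite ltrBlDr -addrA ltrDl addr_gt0// invr_gt0.
    move=> /rat_in_itvoo[q]; rewrite in_itv/= => qP; exists q.
    by rewrite distrC ltr_distl.
  pose q : {ffun 'I_n -> rat} := [ffun k => projT1 (cid (ex k))].
  have qP k : `|x ord0 k - ratr (q k)| < m.+1%:R^-1 by rewrite ffunE; case: cid.
  exists (q, m); last by move=> k; rewrite mxE.
  move=> y /= yB; apply: eA; rewrite -ball_normE/=.
  apply: (@le_lt_trans _ _ (2 * m.+1%:R^-1)); last by rewrite mulrC -ltr_pdivlMr.
  apply: norm_le_coord => [|k]; first by rewrite mulr_ge0// invr_ge0.
  have := yB k; have := qP k; rewrite !mxE /= => h1 h2.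
  rewrite -(subrKA (ratr (q k)) (x ord0 k)) (le_trans (ler_normD _ _))//.
  by rewrite [`|ratr _ - _|]distrC mulr_natl mulr2n lerD// ltW.
rewrite bigcup_mkcond; apply: countable_bigcupT_measurable; first exact: countableP.
by move=> z; case: ifP => // _; exact: measurable_cube.
Qed.

Lemma closed_measurable_rV n (A : set 'rV[R]_n) : closed A -> measurable A.
Proof.
move=> cA; rewrite -[A]setCK; apply: measurableC; apply: open_measurable_rV.
exact: closed_openC.
Qed.

Lemma measurable_within n (A : set 'rV[R]_n) (f : 'rV[R]_n -> R) : measurable A ->
  {within A, continuous f} -> measurable_fun A (f : 'rV[R]_n -> measurableTypeR R).
Proof.
move=> mA cf; apply: (measurability _ (measurable_realfun.RGenOpens.measurableE R)).
move=> _ [_ [a [b ->] <-]].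
have oab : open `]a, b[%classic by exact: interval_open.
have /open_subspaceP[U oU UE] := (continuousP _).1 cf _ oab.
rewrite setIC -UE; apply: measurableI => //; exact: open_measurable_rV.
Qed.

Lemma continuous_measurable_rV n m (f : 'rV[R]_n -> 'rV[R]_m) : continuous f ->
  measurable_fun setT f.
Proof.
move=> cf; apply: measurable_to_rV => i; apply: measurable_within => //.
apply: continuous_subspaceT => x.
apply: (@continuous_comp _ _ _ f (fun y => y ord0 i)); first exact: cf.
exact: coord_continuous.
Qed.

End Measure.

(** * Comparison of integrals with step functions *)

Section StepFunctions.
Context {dd : measure_display} {T : measurableType dd} {R : realType}.
Context (mu : {measure set T -> \bar R}).
Context {I : eqType} (s : seq I) (c : I -> R) (A : I -> set T).
Hypotheses (us : uniq s) (mA : forall i, measurable (A i)) (c0 : forall i, 0 <= c i).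
Implicit Types (D : set T) (F : T -> R).

Let step (x : T) : R := \sum_(i <- s) c i * \1_(A i) x.

Let mstep D : measurable_fun D (EFin \o step : T -> \bar R).
Proof.
apply/measurable_EFinP; apply: measurable_sum => i.
by apply: measurable_funM => //; exact: measurable_indic.
Qed.

Let step0 x : 0 <= step x.
Proof. by apply: sumr_ge0 => i _; rewrite mulr_ge0// indicE. Qed.

Lemma integral_step D : measurable D ->
  (\int[mu]_(x in D) (step x)%:E = \sum_(i <- s) (c i)%:E * mu (A i `&` D))%E.
Proof.
move=> mD; under eq_integral do rewrite -sumEFin.
rewrite ge0_integral_sum//=; last 2 first.
- move=> i; apply/measurable_EFinP; apply: measurable_funM => //; exact: measurable_indic.
- by move=> i x _; rewrite lee_fin mulr_ge0// indicE.
apply: eq_bigr => i _; under eq_integral do rewrite EFinM.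
rewrite ge0_integralZl_EFin//; first by congr (_ * _)%E; exact: integral_indic.
apply/measurable_EFinP; exact: measurable_indic.
Qed.

Lemma Rintegral_le_step D F (w : I -> R) : measurable D -> measurable_fun D F ->
  (forall x, D x -> 0 <= F x) -> (forall x, D x -> F x <= step x) ->
  (forall i, (mu (A i) <= (w i)%:E)%E) ->
  \int[mu]_(x in D) F x <= \sum_(i <- s) c i * w i.
Proof.
move=> mD mF F0 Fs Aw.
have i0 : (0 <= \int[mu]_(x in D) (F x)%:E)%E by apply: integral_ge0 => x Dx; rewrite lee_fin F0.
have le : (\int[mu]_(x in D) (F x)%:E <= (\sum_(i <- s) c i * w i)%:E)%E.
  apply: (@le_trans _ _ (\int[mu]_(x in D) (step x)%:E)%E).
    apply: ge0_le_integral => //.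
    - exact/measurable_EFinP.
  rewrite integral_step// -sumEFin; apply: lee_sum => i _.
  rewrite EFinM; apply: lee_wpmul2l; first by rewrite lee_fin.
  apply: le_trans (Aw i); apply: le_measure; rewrite ?inE//; exact: measurableI.
rewrite /Rintegral -lee_fin fineK// ge0_fin_numE//.
by apply: le_lt_trans le _; rewrite ltry.
Qed.

Hypothesis tA : forall i j, i \in s -> j \in s -> i != j -> A i `&` A j = set0.

Lemma step_le F x : 0 <= F x -> (forall i, i \in s -> A i x -> c i <= F x) -> step x <= F x.
Proof.
move=> F0 cF.
have [[i is_ Ai]|nA] := pselect (exists2 i, i \in s & A i x).
  rewrite /step (bigD1_seq i)//= indicE mem_set//= mulr1 big_seq_cond [X in _ + X]big1 ?addr0; first exact: cF.
  move=> j /andP[js ji]; rewrite indicE memNset ?mulr0//= => Aj.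
  by have := tA js is_ ji; rewrite -subset0 => /(_ x); apply.
rewrite /step big_seq big1// => i is_; rewrite indicE memNset ?mulr0// => Ai.
by apply: nA; exists i.
Qed.

(** The bound [M] and the finite measure of [D] make the integral finite; an infinite one would be
    read as 0 by [Rintegral]. *)
Lemma Rintegral_ge_step D F (M : R) (w : I -> R) : measurable D -> measurable_fun D F ->
  (forall x, D x -> 0 <= F x <= M) -> (mu D < +oo)%E ->
  (forall i, i \in s -> A i `<=` D) ->
  (forall i x, i \in s -> A i x -> c i <= F x) ->
  (forall i, i \in s -> mu (A i) = (w i)%:E) ->
  \sum_(i <- s) c i * w i <= \int[mu]_(x in D) F x.
Proof.
move=> mD mF FM muD AD cF Aw.
have i0 : (0 <= \int[mu]_(x in D) (F x)%:E)%E.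
  by apply: integral_ge0 => x /FM /andP[]; rewrite lee_fin.
have fin : (\int[mu]_(x in D) (F x)%:E < +oo)%E.
  apply: (@le_lt_trans _ _ (\int[mu]_(x in D) (M%:E))%E).
    apply: ge0_le_integral => //.
    - by move=> x /FM /andP[]; rewrite lee_fin.
    - exact/measurable_EFinP.
    - by move=> x /FM /andP[]; rewrite lee_fin.
  rewrite integral_cst//.
  have : mu D \is a fin_num by rewrite ge0_fin_numE.
  by move=> /fineK <-; rewrite -EFinM ltry.
rewrite /Rintegral -lee_fin fineK; last by rewrite ge0_fin_numE.
apply: (@le_trans _ _ (\int[mu]_(x in D) (step x)%:E)%E); last first.
  apply: ge0_le_integral => //.
  - by move=> x _; rewrite lee_fin.
  - exact/measurable_EFinP.
  - move=> x Dx; rewrite lee_fin; apply: step_le => [|i]; last exact: cF.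
    by have /andP[] := FM _ Dx.
rewrite integral_step// -sumEFin big_seq [leRHS]big_seq.
by apply: lee_sum => i is_; rewrite setIidl ?Aw// ?EFinM//; exact: AD.
Qed.

(** The step function with all coefficients 1 is at most 1 because the sets are disjoint; integrate
    it over [D]. *)
Lemma sum_measure_le D (w : I -> R) (b : R) : measurable D ->
  (forall i, i \in s -> A i `<=` D) -> (forall i, i \in s -> mu (A i) = (w i)%:E) ->
  (mu D <= b%:E)%E -> (forall i, c i = 1) -> \sum_(i <- s) w i <= b.
Proof.
move=> mD AD Aw Db c1.
rewrite -lee_fin; apply: le_trans Db.
apply: (@le_trans _ _ (\int[mu]_(x in D) (step x)%:E)%E).
  rewrite integral_step// -sumEFin big_seq [leRHS]big_seq.
  by apply: lee_sum => i is_; rewrite setIidl ?Aw// ?c1 ?mul1e//; exact: AD.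
rewrite -[leRHS]mul1e -(integral_cst mu mD 1).
apply: ge0_le_integral => //; first by move=> x _; rewrite lee_fin.
move=> x Dx; rewrite lee_fin; apply: (step_le (F := cst 1)) => //=.
by move=> i _ _; rewrite c1.
Qed.

End StepFunctions.

(** * Multilinear cell maps *)

Section CellMap.
Context {R : realType} {d : nat} (g : 'rV[R]_d -> 'rV[R]_d) (a b : R).
Hypotheses (d0 : (0 < d)%N) (a0 : 0 < a).
Hypothesis gQ : forall l, Qpoly 1 (fun x => g x ord0 l).
Hypothesis g_bnd : forall x, ref_closed x -> forall xi,
  a * `|xi| <= `|'D_xi g x| <= b * `|xi|.
Implicit Types (x y z xi : 'rV[R]_d).

Let e k : 'rV[R]_d := delta_mx ord0 k.

(** Vectors are rows and act from the left, so this is the transpose of the usual Jacobian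
    matrix. *)
Definition jacobi x : 'M[R]_d := \matrix_(k, l) partial (fun y => g y ord0 l) k x.

Lemma norm_delta k : `|delta_mx ord0 k : 'rV[R]_d| <= 1.
Proof.
apply: norm_le_coord => // l; rewrite mxE eqxx/=.
by case: (l == k); rewrite ?normr1 ?normr0.
Qed.

Lemma derive_coord x xi l : ('D_xi g x) ord0 l = 'D_xi (fun y => g y ord0 l) x.
Proof.
rewrite derive_mx ?mxE//; apply/derivable_mxP => i j; rewrite ord1.
exact/diff_derivable/(differentiable_Qpoly _ (gQ j)).
Qed.

Lemma derive_jacobi x xi : 'D_xi g x = xi *m jacobi x.
Proof.
apply/rowP => l; rewrite derive_coord derive_partial; last exact: differentiable_Qpoly (gQ l).
by rewrite mxE; apply: eq_bigr => k _; rewrite mxE.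
Qed.

Lemma b_ge_a : a <= b.
Proof.
have := g_bnd (@ref_closed0 R d) (const_mx 1).
have n0 : 0 < `|const_mx 1 : 'rV[R]_d|.
  by apply: lt_le_trans (coord_le_norm _ (Ordinal d0)); rewrite mxE normr1.
by move=> /andP[h1 h2]; rewrite -(ler_pM2r n0); exact: le_trans h2.
Qed.

Lemma b_ge0 : 0 <= b. Proof. exact: le_trans (ltW a0) b_ge_a. Qed.

Lemma jacobi_le x k l : ref_closed x -> `|partial (fun y => g y ord0 l) k x| <= b.
Proof.
move=> xc; have /andP[_] := g_bnd xc (e k); rewrite derive_jacobi => h.
have -> : partial (fun y => g y ord0 l) k x = (e k *m jacobi x) ord0 l.
  by rewrite -rowE !mxE.
apply: le_trans (coord_le_norm _ _) _; apply: le_trans h _.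
by rewrite ler_piMr ?norm_delta// b_ge0.
Qed.

(** Markov's inequality in degree 1 bounds the second derivatives of a multilinear map by twice the
    bound on the first. *)
Lemma g_taylor x y : ref_closed x -> ref_closed y ->
  `|g y - g x - (y - x) *m jacobi x| <= 2 * d%:R ^+ 2 * b * `|y - x| ^+ 2.
Proof.
move=> xc yc; have b0 := b_ge0.
apply: norm_le_coord => [|l].
  by rewrite !mulr_ge0// exprn_ge0.
rewrite -derive_jacobi; rewrite !mxE -/(('D_(y - x) g x) ord0 l) derive_coord.
have := @taylor_ref R d 1 (fun y => g y ord0 l) (2 * b) (gQ l) _ x y xc yc.
move=> /(_ _)/wrap[k m z zc|].
  have := @markov_Qpoly R d 1 _ b isT (partial_Qpoly k (gQ l)) _ m z zc.
  by rewrite expr1n mulr1; apply => w wc; exact: jacobi_le.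
move=> h; apply: le_trans h _; rewrite le_eqVlt; apply/orP; left; apply/eqP; ring.
Qed.

Lemma jacobi_norm_ge x xi : ref_closed x -> a * `|xi| <= `|xi *m jacobi x|.
Proof. by move=> xc; rewrite -derive_jacobi; case/andP: (g_bnd xc xi). Qed.

Lemma jacobi_unit x : ref_closed x -> jacobi x \in unitmx.
Proof.
move=> xc; rewrite -row_free_unit -kermx_eq0; apply/eqP/row_matrixP => i.
rewrite row0; set u := row i _.
have : u *m jacobi x = 0 by rewrite /u -row_mul mulmx_ker row0.
move=> u0; have := jacobi_norm_ge u xc; rewrite u0 normr0 pmulr_rle0// normr_le0.
by move/eqP.
Qed.

(** At this distance the quadratic remainder of [g_taylor] takes away at most half of the linear
    part. *)
Lemma g_expand x y : ref_closed x -> ref_closed y ->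
  4 * d%:R ^+ 2 * b * `|y - x| <= a -> a / 2 * `|y - x| <= `|g y - g x|.
Proof.
move=> xc yc xy.
have h1 := jacobi_norm_ge (y - x) xc; have h2 := g_taylor xc yc.
have h3 : `|(y - x) *m jacobi x| <= `|g y - g x| + `|g y - g x - (y - x) *m jacobi x|.
  by rewrite -{1}(subKr (g y - g x) ((y - x) *m jacobi x)) ler_normB.
have : 2 * d%:R ^+ 2 * b * `|y - x| ^+ 2 <= a / 2 * `|y - x|.
  rewrite (expr2 `|y - x|) mulrA ler_wpM2r//; lra.
lra.
Qed.

Lemma differentiable_g_coord x l : differentiable (fun y => g y ord0 l) x.
Proof. exact: differentiable_Qpoly (gQ l). Qed.

Lemma g_continuous : continuous g.
Proof.
move=> x; apply/(@cvgrPdist_le R _ _ (nbhs x)) => eps eps0.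
have H : \forall y \near nbhs x, forall l, `|g x ord0 l - g y ord0 l| <= eps.
  apply: filter_forall => l.
  have := differentiable_continuous (differentiable_g_coord x l).
  by move/cvgrPdist_le => /(_ _ eps0).
apply: filterS H => y H; apply: norm_le_coord; first exact: ltW.
by move=> l; rewrite !mxE.
Qed.

(* A minimiser of the distance to [z] over the small cube is interior, and there
   the gradient [2 (g x - z) J^T] vanishes. *)
Lemma g_open x0 s z r : ref_closed x0 -> 0 < s ->
  (forall y, `|y - x0| <= s -> ref_closed y) ->
  4 * d%:R ^+ 2 * b * s <= a -> 2 * (d%:R + 1) * r < a * s -> `|z - g x0| <= r ->
  exists2 x, `|x - x0| < s & g x = z.
Proof.
move=> x0c s0 sc sa rs zr.
have r0 : 0 <= r by exact: le_trans zr.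
have d1 : 1 <= d%:R :> R by rewrite ler1n.
pose K := [set x : 'rV[R]_d | `|x - x0| <= s].
have Kc : compact K.
  have := @rV_compact R d (fun k => `[x0 ord0 k - s, x0 ord0 k + s]%classic) (fun k => @segment_compact _ _ _).
  congr compact; apply/seteqP; split => x /= xK.
    by apply: norm_le_coord => [|k]; [exact: ltW|have := xK k; rewrite in_itv/= !mxE ler_distl].
  move=> k; rewrite in_itv/= -ler_distl; apply: le_trans xK.
  by have := coord_le_norm (x - x0) k; rewrite !mxE.
pose f x := \sum_(l < d) (g x ord0 l - z ord0 l) ^+ 2.
have df x xi : is_derive x xi f
    (\sum_(l < d) 2 * (g x ord0 l - z ord0 l) * 'D_xi (fun y => g y ord0 l) x).
  have -> : f = \sum_(l < d) ((fun x => g x ord0 l) - cst (z ord0 l)) ^+ 2.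
    by apply/funext => y; rewrite fct_sumE; apply: eq_bigr => l _; rewrite exprfctE.
  apply: is_derive_sum => l.
  have dl : is_derive x xi (fun y => g y ord0 l) ('D_xi (fun y => g y ord0 l) x).
    exact/derivableP/diff_derivable/differentiable_g_coord.
  apply: is_derive_eq; rewrite expr1 subr0; reflexivity.
have cf : continuous f.
  move=> x; apply: differentiable_continuous.
  apply: differentiable_bigsum => l.
  have -> : (fun x => (g x ord0 l - z ord0 l) ^+ 2) = ((fun x => g x ord0 l) - cst (z ord0 l)) ^+ 2.
    by apply/funext => y; rewrite exprfctE.
  apply: differentiableX; apply: differentiableB; [exact: differentiable_g_coord|exact: differentiable_cst].
have [||x xK xmin] := @EVT_min_rV R d f K _ Kc _.
- by exists x0; rewrite /K/= subrr normr0 ltW.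
- exact: continuous_subspaceT.
rewrite inE /K/= in xK.
have xc : ref_closed x by exact: sc.
have fx : f x <= (d%:R * r) ^+ 2.
  apply: le_trans (xmin x0 _) _; first by rewrite inE /K/= subrr normr0 ltW.
  apply: (@le_trans _ _ (\sum_(l < d) r ^+ 2)).
    apply: ler_sum => l _; rewrite -[leLHS]real_normK ?num_real// lerXn2r ?nnegrE//.
    by rewrite distrC; apply: le_trans zr; have := coord_le_norm (z - g x0) l; rewrite !mxE.
  rewrite sumr_const card_ord -[leLHS]mulr_natl exprMn ler_wpM2r ?sqr_ge0//.
  by rewrite expr2 ler_peMr.
have gxz : `|g x - z| <= d%:R * r.
  apply: norm_le_coord => [|l]; first by rewrite mulr_ge0.
  rewrite -(@ler_pXn2r _ 2) ?nnegrE ?mulr_ge0// real_normK ?num_real//; apply: le_trans fx.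
  rewrite !mxE /f (bigD1 l)//= lerDl; apply: sumr_ge0 => m _; exact: sqr_ge0.
(* On the surface of the cube [g x] would be at least [a s / 2] away from [g x0] by [g_expand], but
   the distance is at most [(d + 1) r]. *)
have xs : `|x - x0| < s.
  rewrite lt_neqAle xK andbT; apply/eqP => xE.
  have := @g_expand x0 x x0c xc; rewrite xE => /(_ sa).
  have : `|g x - g x0| <= `|g x - z| + `|z - g x0| by exact: ler_distD.
  lra.
exists x => //.
have grad k : ((g x - z) *m (jacobi x)^T) ord0 k = 0.
  pose rho := s - `|x - x0|; have rho0 : 0 < rho by rewrite subr_gt0.
  have Dt (t : R) : is_derive t 1 (fun u => f (x + u *: e k)) ('D_(e k) f (x + t *: e k)).
    apply: is_derive_line; apply: differentiable_bigsum => l.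
    have -> : (fun x => (g x ord0 l - z ord0 l) ^+ 2) = ((fun x => g x ord0 l) - cst (z ord0 l)) ^+ 2.
      by apply/funext => y; rewrite exprfctE.
    apply: differentiableX; apply: differentiableB; [exact: differentiable_g_coord|exact: differentiable_cst].
  have := @derive1_at_min R (fun u => f (x + u *: e k)) (- rho) rho 0.
  move=> /(_ _ _ _ _)/wrap[||||D0].
  - lra.
  - by move=> t _; have [] := Dt t.
  - by rewrite in_itv/=; apply/andP; split; lra.
  - move=> t; rewrite in_itv/= -ltr_norml => ts; rewrite scale0r addr0; apply: xmin.
    rewrite inE /K/= addrAC; apply: le_trans (ler_normD _ _) _.
    have : `|t *: e k| <= `|t| by rewrite normrZ ler_piMr ?norm_delta.
    rewrite /rho in ts; lra.
  have := Dt 0; rewrite scale0r addr0 => D1.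
  have := @derive_val _ _ _ _ _ _ _ D0; rewrite (@derive_val _ _ _ _ _ _ _ D1).
  rewrite (@derive_val _ _ _ _ _ _ _ (df x (e k))) => S0.
  have : 2 * ((g x - z) *m (jacobi x)^T) ord0 k = 0.
    rewrite -S0 mxE mulr_sumr; apply: eq_bigr => l _.
    by rewrite !mxE /partial; ring.
  by move/eqP; rewrite mulf_eq0 pnatr_eq0/= => /eqP.
have : (g x - z) *m (jacobi x)^T = 0 by apply/rowP => k; rewrite grad mxE.
move/(congr1 (mulmx^~ (invmx (jacobi x)^T))); rewrite mulmxK; last by rewrite unitmx_tr jacobi_unit.
by rewrite mul0mx => /eqP; rewrite subr_eq0 => /eqP.
Qed.

End CellMap.

Section Auxiliary.
Context {R : realType} {d : nat}.
Implicit Types (x y z xi : 'rV[R]_d).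

(** Lets a finite element function be differentiated on a cell from a remainder estimate, without
    differentiating the inverse of the geometry map. *)
Lemma is_derive_quadratic (v : 'rV[R]_d -> R) y xi (L C t0 : R) : 0 < t0 ->
  (forall t, 0 < `|t| < t0 -> `|v (y + t *: xi) - v y - t * L| <= C * t ^+ 2) ->
  is_derive y xi v L.
Proof.
move=> t00 vC.
have cv : (fun h : R => h^-1 *: ((v \o shift y) (h *: xi) - v y)) @ 0^' --> L.
  apply/subr_cvg0.
  apply: (@cvg_to_0_linear _ _ C t0 t00) => t /[dup] tt0 /andP[t1 _].
  have tn0 : t != 0 by rewrite -normr_gt0.
  have tt : `|t| * `|t| = t ^+ 2 by rewrite -expr2 real_normK ?num_real.
  rewrite -(ler_pM2r t1) -normrM -(mulrA C) tt /=.
  have -> : (t^-1 *: (v (t *: xi + y) - v y) - L) * t = v (y + t *: xi) - v y - t * L.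
    rewrite (addrC y) -[t^-1 *: _]/(t^-1 * _).
    by move: (v (t *: xi + y)) => w; field.
  exact: vC.
by apply: DeriveDef; [apply/cvg_ex; exists L|apply/cvg_lim].
Qed.

Lemma ref_open_room x : ref_open x ->
  exists2 rho : R, 0 < rho & forall y, `|y - x| <= rho -> ref_closed y.
Proof.
move=> xo; exists (1 - `|x|).
  rewrite subr_gt0 [ltLHS]/Num.Def.normr/= mx_normrE.
  by apply: bigmax_lt => // -[i k] _ /=; rewrite ord1.
move=> y yx k; apply: le_trans (coord_le_norm y k) _.
rewrite -(subrK x y); apply: le_trans (ler_normD _ _) _; lra.
Qed.

Lemma Qpoly_continuous p (f : 'rV[R]_d -> R) : Qpoly p f -> continuous f.
Proof. by move=> Qf x; apply: differentiable_continuous; exact: differentiable_Qpoly Qf. Qed.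

Lemma Qpoly_max p (f : 'rV[R]_d -> R) : Qpoly p f ->
  exists2 x, ref_closed x & forall y, ref_closed y -> `|f y| <= `|f x|.
Proof.
move=> Qf.
have [|||x xc xmax] := @EVT_max_rV R d (fun x => `|f x|) ref_closed.
- by exists 0; exact: ref_closed0.
- exact: ref_closed_compact.
- apply: continuous_subspaceT => x.
  apply: (@continuous_comp _ _ _ f (fun t : R => `|t|)); first exact: (Qpoly_continuous Qf).
  exact: norm_continuous.
by exists x; [rewrite inE in xc|move=> y yc; apply: xmax; rewrite inE].
Qed.

End Auxiliary.

(** * Gradients on a cell through its geometry map *)

Section CellGradient.
Context {R : realType} {d : nat} (g : 'rV[R]_d -> 'rV[R]_d) (a b : R).
Hypotheses (d0 : (0 < d)%N) (a0 : 0 < a).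
Hypothesis gQ : forall l, Qpoly 1 (fun x => g x ord0 l).
Hypothesis g_bnd : forall x, ref_closed x -> forall xi,
  a * `|xi| <= `|'D_xi g x| <= b * `|xi|.
Context (p : nat) (q v : 'rV[R]_d -> R).
Hypotheses (p0 : (0 < p)%N) (Qq : Qpoly p q) (vq : forall x, ref_closed x -> v (g x) = q x).
Implicit Types (x y z xi : 'rV[R]_d).

Let e k : 'rV[R]_d := delta_mx ord0 k.
Let J := jacobi g.
(** The direction at [x] which the derivative of [g] maps to [e k]. *)
Let eta x k : 'rV[R]_d := e k *m invmx (J x).

Let b0 : 0 <= b. Proof. exact: b_ge0 g_bnd. Qed.
Let dn : 1 <= d%:R :> R. Proof. by rewrite ler1n. Qed.

Lemma ref_openW x : ref_open x -> ref_closed x.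
Proof. by move=> xo k; exact: ltW. Qed.

(** On the cell [v] is [q] composed with the inverse of [g], which is never formed. For small [t],
    [g_open] supplies [x2] with [g x2 = g x + t e_k]; Taylor for [g] shows that [x2 - x] is [t eta]
    up to O(t^2), and Taylor for [q] concludes. The two terms of [C] are these two errors, with
    [|x2 - x| < C1 |t|]. *)
Lemma cell_derive x k : ref_open x -> is_derive (g x) (e k) v ('D_(eta x k) q x).
Proof.
move=> xo; have xc := ref_openW xo.
have [rho rho0 room] := ref_open_room xo.
(* With this constant the radius [s = C1 |t|] satisfies [a s = 4 (d + 1) |t|], twice what [g_open]
   has to exceed. *)
have [C1 C1E] : exists C1, C1 = 4 * (d%:R + 1) / a by eexists.
have C10 : 0 < C1 by rewrite C1E divr_gt0// mulr_gt0//; lra.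
have [x1 x1c q_le] := Qpoly_max Qq; set M := `|q x1| in q_le.
have q1_le j y : ref_closed y -> `|partial q j y| <= 2 * p%:R ^+ 2 * M.
  by move=> yc; apply: (markov_Qpoly p0 Qq).
have q2_le j l y : ref_closed y -> `|partial (partial q j) l y| <= 2 * p%:R ^+ 2 * (2 * p%:R ^+ 2 * M).
  by move=> yc; apply: (markov_Qpoly p0 (partial_Qpoly j Qq)) => // w; exact: q1_le.
set M1 := 2 * p%:R ^+ 2 * M in q1_le q2_le; set M2 := 2 * p%:R ^+ 2 * M1 in q2_le.
have M00 : 0 <= M by exact: normr_ge0.
have M10 : 0 <= M1 by rewrite /M1 !mulr_ge0// exprn_ge0.
have M20 : 0 <= M2 by rewrite /M2 !mulr_ge0// exprn_ge0.
pose C := d%:R ^+ 2 * M2 * C1 ^+ 2 + d%:R * M1 * (2 * d%:R ^+ 2 * b * C1 ^+ 2 / a).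
(* The first bound keeps the cube of radius [s] inside the reference cube; the second gives the
   smallness condition of [g_open]. *)
pose t0 := Num.min (rho / C1) (a / (4 * d%:R ^+ 2 * b + 1) / C1).
have den0 : 0 < 4 * d%:R ^+ 2 * b + 1 by rewrite ltr_wpDl// !mulr_ge0.
apply: (@is_derive_quadratic _ _ _ _ _ _ C t0).
  by rewrite lt_min !divr_gt0.
move=> t /andP[tp]; rewrite lt_min !ltr_pdivlMr// => /andP[t1 t2].
pose s := C1 * `|t|; have s0 : 0 < s by rewrite mulr_gt0.
have srho : s <= rho by rewrite /s mulrC ltW.
have sa : 4 * d%:R ^+ 2 * b * s <= a.
  have : s * (4 * d%:R ^+ 2 * b + 1) <= a by rewrite /s (mulrC C1) ltW.
  lra.
have [|||x2 x2s gx2] := @g_open R d g a b d0 a0 gQ g_bnd x s (g x + t *: e k) `|t| xc s0 _ sa.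
- by move=> y yx; apply: room; exact: le_trans srho.
- rewrite /s C1E (_ : a * _ = 4 * (d%:R + 1) * `|t|); last by field; rewrite gt_eqF.
  by rewrite ltr_pM2r//; move: dn; lra.
- by rewrite addrAC subrr add0r normrZ ler_piMr// norm_delta.
have x2c : ref_closed x2 by apply: room; apply: le_trans srho; exact: ltW.
set z := x2 - x in x2s.
have tay := g_taylor d0 a0 gQ g_bnd xc x2c.
have tE : g x + t *: e k - g x = t *: e k by rewrite addrAC subrr add0r.
rewrite gx2 tE -/z -/J in tay.
have zt : a * `|z - t *: eta x k| <= 2 * d%:R ^+ 2 * b * `|z| ^+ 2.
  apply: le_trans (jacobi_norm_ge gQ g_bnd _ xc) _.
  rewrite mulmxBl -scalemxAl /eta mulmxKV; last exact: (jacobi_unit a0 gQ g_bnd).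
  by rewrite distrC.
have z2 : `|z| ^+ 2 <= C1 ^+ 2 * t ^+ 2.
  rewrite -[t ^+ 2]real_normK ?num_real// -exprMn lerXn2r ?nnegrE ?normr_ge0//; exact: ltW.
have tq := taylor_ref Qq q2_le xc x2c; rewrite -/z in tq.
rewrite -gx2 !vq//.
have -> : q x2 - q x - t * 'D_(eta x k) q x = (q x2 - q x - 'D_z q x) + 'D_(z - t *: eta x k) q x.
  rewrite (_ : 'D_(z - t *: eta x k) q x = 'D_z q x - t * 'D_(eta x k) q x); first by ring.
  have dq := differentiable_Qpoly x Qq.
  rewrite !(derive_partial _ dq) mulr_sumr -sumrB; apply: eq_bigr => j _.
  by rewrite !mxE; ring.
apply: le_trans (ler_normD _ _) _; rewrite /C mulrDl; apply: lerD.
  by apply: le_trans tq _; rewrite -[leRHS]mulrA ler_wpM2l// !mulr_ge0.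
apply: le_trans (derive_norm_le _ _ (fun j => q1_le j x xc)) _; first exact: differentiable_Qpoly Qq.
rewrite -[leRHS]mulrA ler_wpM2l ?mulr_ge0//.
rewrite [leRHS]mulrAC ler_pdivlMr// mulrC; apply: le_trans zt _.
by rewrite -[leRHS]mulrA ler_wpM2l// !mulr_ge0.
Qed.

Lemma cell_partial x k : ref_open x -> partial v k (g x) = 'D_(eta x k) q x.
Proof. by move=> xo; have := cell_derive k xo => D; rewrite /partial derive_val. Qed.

Lemma cell_partial_le x k (M : R) : ref_open x ->
  (forall j, `|partial q j x| <= M) -> `|partial v k (g x)| <= d%:R * M / a.
Proof.
move=> xo qM; rewrite cell_partial//.
have M0 : 0 <= M by apply: le_trans (qM k).
apply: le_trans (derive_norm_le _ _ qM) _; first exact: differentiable_Qpoly Qq.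
rewrite ler_wpM2l ?mulr_ge0// -(ler_pM2l a0) divff ?gt_eqF//.
apply: le_trans (jacobi_norm_ge gQ g_bnd _ (ref_openW xo)) _.
by rewrite /eta mulmxKV ?norm_delta//; exact: (jacobi_unit a0 gQ g_bnd (ref_openW xo)).
Qed.

Lemma ref_partial_sqr_le x j : ref_open x ->
  partial q j x ^+ 2 <= (d%:R * b) ^+ 2 * \sum_k partial v k (g x) ^+ 2.
Proof.
move=> xo; have xc := ref_openW xo.
set S := \sum_k _; have S0 : 0 <= S by apply: sumr_ge0 => k _; exact: sqr_ge0.
have -> : partial q j x = \sum_k J x j k * partial v k (g x).
  (* Row [j] of the Jacobian gives the coordinates of [e j] in the basis formed by the [eta x k]:
     the chain rule read backwards. *)
  have ej : e j = \sum_k J x j k *: eta x k.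
    rewrite -[e j](mulmxK (jacobi_unit a0 gQ g_bnd xc)) -/J.
    rewrite [e j *m J x]row_sum_delta mulmx_suml; apply: eq_bigr => k _.
    by rewrite -scalemxAl -rowE mxE.
  rewrite {1}/partial -/(e j) ej deriveE; last exact: differentiable_Qpoly Qq.
  rewrite linear_sum; apply: eq_bigr => k _.
  by rewrite linearZ cell_partial// deriveE//; exact: differentiable_Qpoly Qq.
have vS k : `|partial v k (g x)| <= Num.sqrt S.
  rewrite -sqrtr_sqr ler_sqrt// /S (bigD1 k)//= lerDl; apply: sumr_ge0 => l _; exact: sqr_ge0.
rewrite -[S]sqr_sqrtr// -exprMn -[leLHS]real_normK ?num_real//.
rewrite lerXn2r ?nnegrE ?mulr_ge0//.
apply: le_trans (ler_norm_sum _ _ _) _.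
apply: (@le_trans _ _ (\sum_(k < d) b * Num.sqrt S)).
  apply: ler_sum => k _; rewrite normrM ler_pM// /J mxE.
  exact: (jacobi_le d0 a0 gQ g_bnd).
by rewrite sumr_const card_ord -[leLHS]mulr_natl mulrA.
Qed.

(* Where a partial derivative of [q] is maximal, Markov's inequality keeps it
   large on a cube of radius ~ p^-2, and the image of that cube contains a
   cube. *)
Lemma cell_energy_lower (s : R) : 0 < s -> 12 * d%:R * p%:R ^+ 2 * s <= 1 ->
  4 * d%:R ^+ 2 * b * s <= a ->
  exists (y0 : 'rV[R]_d) (m : R), [/\ 0 <= m,
    cube y0 (a * s / (4 * (d%:R + 1))) `<=` g @` ref_open,
    forall y, cube y0 (a * s / (4 * (d%:R + 1))) y -> m ^+ 2 <= \sum_k partial v k y ^+ 2 &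
    forall x y, ref_closed x -> ref_closed y -> `|v (g x) - v (g y)| <= 4 * d%:R ^+ 2 * b * m].
Proof.
move=> s0 sp sa.
have p1 : 1 <= p%:R :> R by rewrite ler1n.
have dn1 := dn; have a01 := a0.
have bp : 0 < b by apply: lt_le_trans (b_ge_a d0 g_bnd).
have [j [xs [xsc qmax]]] : exists j xs, ref_closed xs /\
    forall k y, ref_closed y -> `|partial q k y| <= `|partial q j xs|.
  pose X k := projT1 (cid2 (Qpoly_max (partial_Qpoly k Qq))).
  have XP k : ref_closed (X k) /\ forall y, ref_closed y -> `|partial q k y| <= `|partial q k (X k)|.
    by rewrite /X; case: cid2.
  have [j _ jmax] := @arg_maxP _ R 'I_d (Ordinal d0) xpredT (fun k => `|partial q k (X k)|) isT.
  exists j, (X j); split; first by have [] := XP j.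
  by move=> k y yc; apply: le_trans ((XP k).2 y yc) _; exact: jmax.
set M := `|partial q j xs| in qmax.
have M0 : 0 <= M by exact: normr_ge0.
(* The maximum point [xs] may lie on the boundary of the reference cube. Shrinking it by [2 s]
   leaves room for a cube of radius [s] in the open reference cube, all of whose points are within
   [3 s] of [xs]. *)
pose x0 := (1 - 2 * s) *: xs.
have s12 : 12 * s <= 1.
  apply: le_trans sp; rewrite ler_wpM2r ?(ltW s0)// -mulrA ler_peMr// mulr_ege1//.
  by rewrite expr_ge1.
have x0x y : `|y - x0| <= s -> `|y - xs| <= 3 * s /\ ref_open y.
  move=> yx.
  have x1 : `|xs| <= 1 by apply: norm_le_coord => // k; exact: xsc.
  split.
    have -> : y - xs = (y - x0) + (- (2 * s)) *: xs.
      by apply/rowP => k; rewrite !mxE; ring.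
    apply: le_trans (ler_normD _ _) _; rewrite normrZ normrN gtr0_norm; last by lra.
    have : 2 * s * `|xs| <= 2 * s by rewrite ler_piMr//; lra.
    lra.
  move=> k; apply: le_lt_trans (coord_le_norm y k) _.
  rewrite -(subrK x0 y); apply: le_lt_trans (ler_normD _ _) _.
  rewrite [`|x0|]normrZ ger0_norm; last by lra.
  have : (1 - 2 * s) * `|xs| <= 1 - 2 * s by rewrite ler_piMr//; lra.
  lra.
have x0c : ref_closed x0 by apply: ref_openW; apply: (x0x _ _).2; rewrite subrr normr0 ltW.
pose r := a * s / (4 * (d%:R + 1)).
have D0 : 0 < 4 * (d%:R + 1) :> R by lra.
have r0 : 0 < r by rewrite divr_gt0// mulr_gt0.
have rs : 2 * (d%:R + 1) * r < a * s.
  rewrite (_ : _ * r = a * s / 2); last by rewrite /r; field; lra.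
  have : 0 < a * s by rewrite mulr_gt0.
  lra.
have cub y : cube (g x0) r y -> exists2 x, ref_open x /\ `|x - xs| <= 3 * s & g x = y.
  move=> yc; have [||x xx0 gx] := @g_open R d g a b d0 a0 gQ g_bnd x0 s y r x0c s0 _ sa rs.
  - by move=> z /x0x[_ /ref_openW].
  - by apply: norm_le_coord => [|k]; [exact: ltW|rewrite !mxE; apply: ltW; exact: yc].
  - by exists x => //; have [] := x0x x (ltW xx0).
(* The value of [m] comes from [M / 2 <= |partial q j x|] and the factor [d b] of
   [ref_partial_sqr_le]. *)
exists (g x0), (M / (2 * d%:R * b)); split.
- by rewrite divr_ge0 ?normr_ge0// !mulr_ge0.
- by move=> y /cub[x [xo _] <-]; exists x.
- move=> y /cub[x [xo xxs] <-]; have xc := ref_openW xo.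
  have : M / 2 <= `|partial q j x|.
    have := @lipschitz_ref R d (partial q j) (2 * p%:R ^+ 2 * M) _ _ xs x xsc xc.
    move=> /(_ _ _)/wrap[z|l z zc|h].
    + exact: differentiable_Qpoly (partial_Qpoly j Qq).
    + by apply: (markov_Qpoly p0 (partial_Qpoly j Qq)) => // w; exact: qmax.
    (* By Markov the partial derivative changes by at most [6 d p^2 s M] over the distance [3 s];
       the 12 in the hypothesis makes this at most [M / 2]. *)
    have h1 : d%:R * (2 * p%:R ^+ 2 * M) * `|x - xs| <= M / 2.
      apply: (@le_trans _ _ (d%:R * (2 * p%:R ^+ 2 * M) * (3 * s))).
        by rewrite ler_wpM2l// !mulr_ge0.
      have : M * (12 * d%:R * p%:R ^+ 2 * s) <= M * 1 by rewrite ler_wpM2l.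
      lra.
    have : M <= `|partial q j x| + `|partial q j x - partial q j xs|.
      rewrite /M -{1}(subKr (partial q j x) (partial q j xs)); exact: ler_normB.
    lra.
  move=> h; have := ref_partial_sqr_le j xo.
  set S := \sum_k _ => hS.
  rewrite exprMn exprVn ler_pdivrMr ?exprn_gt0 ?mulr_gt0//; last lra.
  have : (M / 2) ^+ 2 <= `|partial q j x| ^+ 2 by rewrite lerXn2r ?nnegrE// divr_ge0.
  rewrite real_normK ?num_real// !exprMn exprVn in hS * => h2.
  lra.
- move=> x y xc yc; rewrite !vq//.
  apply: (@le_trans _ _ (d%:R * M * `|x - y|)).
    apply: lipschitz_ref => // z; exact: differentiable_Qpoly Qq.
  rewrite (_ : _ * (M / _) = d%:R * M * 2); last by field; rewrite !gt_eqF//; lra.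
  rewrite ler_wpM2l ?mulr_ge0//; apply: norm_le_coord => // k; rewrite !mxE.
  apply: le_trans (ler_normB _ _) _; have := xc k; have := yc k; lra.
Qed.

End CellGradient.

(** * Mesh geometry *)

Section Euclidean.
Context {R : realType} {d : nat}.
Implicit Types (x y e : 'rV[R]_d) (A B : set 'rV[R]_d).

Lemma dotp_ge0 x : 0 <= dotp x x.
Proof. by apply: sumr_ge0 => k _; rewrite -expr2 sqr_ge0. Qed.

Lemma enorm_ge0 x : 0 <= enorm x.
Proof. exact: sqrtr_ge0. Qed.

Lemma norm_le_enorm x : `|x| <= enorm x.
Proof.
apply: norm_le_coord => [|k]; first exact: enorm_ge0.
rewrite -sqrtr_sqr ler_sqrt ?dotp_ge0// /dotp (bigD1 k)//= -expr2 lerDl.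
by apply: sumr_ge0 => l _; rewrite -expr2 sqr_ge0.
Qed.

Lemma enorm_le_norm x : enorm x <= d%:R * `|x|.
Proof.
rewrite -[leRHS]ger0_norm ?mulr_ge0// -sqrtr_sqr ler_sqrt ?sqr_ge0//.
apply: (@le_trans _ _ (\sum_(k < d) `|x| ^+ 2)).
  apply: ler_sum => k _; rewrite -expr2 -[leLHS]real_normK ?num_real//.
  by rewrite lerXn2r ?nnegrE// coord_le_norm.
rewrite sumr_const card_ord -[leLHS]mulr_natl exprMn ler_wpM2r ?sqr_ge0//.
rewrite -natrX ler_nat; case: (d) => // n; rewrite -mulnn leq_pmulr//.
Qed.

Lemma diam_ge0 A : 0 <= diam A.
Proof.
rewrite /diam; set S := [set _ | _ in A & _ in A].
have [Ss|nS] := pselect (has_sup S); last by rewrite sup_out.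
have [t [x Ax [y Ay txy]]] := Ss.1.
have St : S t by exists x => //; exists y.
by apply: le_trans (sup_upper_bound Ss St); rewrite -txy enorm_ge0.
Qed.

Lemma diam_has_ub A (M : R) : (forall x, A x -> `|x| <= M) ->
  has_ubound [set enorm (x - y) | x in A & y in A].
Proof.
move=> AM; exists (d%:R * (M + M)) => _ [x Ax [y Ay <-]].
apply: le_trans (enorm_le_norm _) _; rewrite ler_wpM2l//.
by apply: le_trans (ler_normB _ _) _; rewrite lerD// AM.
Qed.

Lemma diam_ub A (M : R) x y : (forall x, A x -> `|x| <= M) -> A x -> A y ->
  `|x - y| <= diam A.
Proof.
move=> AM Ax Ay; apply: le_trans (norm_le_enorm _) _.
by apply: (ub_le_sup (diam_has_ub AM)); exists x => //; exists y.
Qed.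

Lemma diam_subset A B (M : R) : (forall x, B x -> `|x| <= M) -> A `<=` B -> A !=set0 ->
  diam A <= diam B.
Proof.
move=> BM AB [x0 Ax0]; apply: ge_sup; first by exists (enorm (x0 - x0)), x0 => //; exists x0.
move=> _ [x Ax [y Ay <-]]; apply: (ub_le_sup (diam_has_ub BM)).
by exists x; [exact: AB|exists y => //; exact: AB].
Qed.

Lemma closure_ball A x (eps : R) : closure A x -> 0 < eps -> exists2 y, A y & `|x - y| < eps.
Proof.
move=> Ax eps0; have [y [Ay xy]] := Ax _ (nbhsx_ballx x eps eps0).
by exists y => //; rewrite -ball_normE in xy.
Qed.

Lemma closure_bounded A (M : R) : (forall x, A x -> `|x| <= M) ->
  forall x, closure A x -> `|x| <= M + 1.
Proof.
move=> AM x Ax; have [y Ay xy] := closure_ball Ax ltr01.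
rewrite -(subrK y x); apply: le_trans (ler_normD _ _) _.
by rewrite addrC lerD ?AM// ltW.
Qed.

Lemma bounded_setP A : bounded_set A -> exists M : R, forall x, A x -> `|x| <= M.
Proof. by move=> [M [_ AM]]; exists (M + 1) => x Ax; apply: AM => //; rewrite ltrDl. Qed.

(* Just below a boundary point, in the direction [- e], there is a ball that does
   not meet Omega. *)
Lemma interior_closure_lipschitz (Omega : set 'rV[R]_d) : open Omega ->
  lipschitz_domain Omega -> interior (closure Omega) `<=` Omega.
Proof.
move=> oO lip x ix; apply: contrapT => nOx.
have cx : closure Omega x by exact: interior_subset.
have bx : boundary Omega x by split => //= /interior_subset.
have [e [r [L [gamma [ee r0 gL epi]]]]] := lip x bx.
have ge : dotp x e <= gamma (x - dotp x e *: e).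
  rewrite leNgt; apply/negP => h; apply: nOx; apply/(epi x) => //.
  by rewrite subrr /enorm /dotp big1 ?sqrtr0// => k _; rewrite mxE mul0r.
have /nbhs_ballP[eps /= eps0 epsO] := ix.
have enorme : enorm e = 1 by rewrite /enorm ee sqrtr1.
have dn : 0 <= d%:R :> R by [].
(* With [t] and [|z - y|] at most [r1], the point [y] has Euclidean distance at most [2 d r1 < r]
   from [x], so the epigraph description applies to it. *)
pose r1 := r / (4 * (d%:R + 1)).
have r10 : 0 < r1 by rewrite divr_gt0// mulr_gt0// ltr_wpDl.
have r1E : (d%:R + 1) * r1 = r / 4 by rewrite /r1; field; lra.
pose t := Num.min r1 (eps / 2).
have t0 : 0 < t by rewrite lt_min r10 divr_gt0.
have tr : t <= r1 by rewrite ge_min lexx.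
have te : t <= eps / 2 by rewrite ge_min lexx orbT.
pose z := x - t *: e.
have cz : closure Omega z.
  apply: epsO; rewrite -ball_normE/= /z opprB addrC subrK normrZ gtr0_norm//.
  have : t * `|e| <= t by rewrite ler_piMr ?(ltW t0)//; rewrite -enorme norm_le_enorm.
  lra.
have dotB (u w : 'rV[R]_d) : dotp (u - w) e = dotp u e - dotp w e.
  by rewrite /dotp -sumrB; apply: eq_bigr => k _; rewrite !mxE mulrBl.
have dotZ (c : R) (u : 'rV[R]_d) : dotp (c *: u) e = c * dotp u e.
  by rewrite /dotp mulr_sumr; apply: eq_bigr => k _; rewrite mxE mulrA.
have ez : dotp z e = dotp x e - t by rewrite /z dotB dotZ ee mulr1.
have pz : z - dotp z e *: e = x - dotp x e *: e.
  by rewrite ez /z scalerBl; apply/rowP => k; rewrite !mxE; ring.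
(* At [z] the graph function exceeds the height along [e] by at least [t]. Passing from [z] to [y]
   changes this excess by at most [(D - 1) |z - y|], so [D |z - y| < t] keeps it positive, and [y]
   cannot be in Omega. *)
have [D DE] : exists D, D = `|L| * (d%:R * (1 + d%:R)) + d%:R + 1 by eexists.
have D0 : 0 < D by rewrite DE ltr_wpDl// addr_ge0// !mulr_ge0// addr_ge0.
pose q := Num.min (t / D) r1.
have q0 : 0 < q by rewrite lt_min !divr_gt0.
have [y Oy zy] := closure_ball cz q0.
move: zy; rewrite lt_min ltr_pdivlMr// => /andP[zy1 zy2].
have dotle (u : 'rV[R]_d) : `|dotp u e| <= d%:R * `|u|.
  apply: le_trans (ler_norm_sum _ _ _) _.
  apply: (@le_trans _ _ (\sum_(k < d) `|u|)); last by rewrite sumr_const card_ord -[leLHS]mulr_natl.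
  apply: ler_sum => k _; rewrite normrM -[leRHS]mulr1 ler_pM// ?coord_le_norm//.
  by apply: le_trans (coord_le_norm _ _) _; rewrite -enorme norm_le_enorm.
have e1 : `|e| <= 1 by rewrite -enorme norm_le_enorm.
have yr : enorm (y - x) < r.
  apply: le_lt_trans (enorm_le_norm _) _.
  have : `|y - x| <= `|z - y| + t.
    rewrite (_ : y - x = - (z - y) + - (t *: e)); last first.
      by rewrite /z; apply/rowP => k; rewrite !mxE; ring.
    apply: le_trans (ler_normD _ _) _; rewrite !normrN lerD2l normrZ gtr0_norm//.
    by rewrite ler_piMr// ltW.
  move=> h; have : `|y - x| <= 2 * r1 by lra.
  move=> h2; have : d%:R * `|y - x| <= (d%:R + 1) * (2 * r1).
    by apply: ler_pM => //; lra.
  lra.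
have {Oy} := (epi y yr).1 Oy.
have := gL (z - dotp z e *: e) (y - dotp y e *: e).
rewrite pz => gLy.
have h1 : `|(x - dotp x e *: e) - (y - dotp y e *: e)| <= (1 + d%:R) * `|z - y|.
  rewrite -pz (_ : _ - _ = (z - y) - dotp (z - y) e *: e); last first.
    by rewrite dotB; apply/rowP => k; rewrite !mxE; ring.
  apply: le_trans (ler_normB _ _) _; rewrite mulrDl mul1r lerD2l normrZ.
  by rewrite -[leRHS]mulr1 ler_pM.
have h2 : `|gamma (x - dotp x e *: e) - gamma (y - dotp y e *: e)| <= `|L| * (d%:R * ((1 + d%:R) * `|z - y|)).
  apply: le_trans gLy _; apply: (@le_trans _ _ (`|L| * enorm (x - dotp x e *: e - (y - dotp y e *: e)))).
    by rewrite ler_wpM2r ?enorm_ge0// ler_norm.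
  rewrite ler_wpM2l//; apply: le_trans (enorm_le_norm _) _.
  by rewrite ler_wpM2l.
have h3 := dotle (z - y); rewrite dotB ez in h3.
move: h2 h3; rewrite !ler_norml => /andP[_ h2] /andP[h3 _] h4.
have : `|L| * (d%:R * ((1 + d%:R) * `|z - y|)) + d%:R * `|z - y| = `|z - y| * D - `|z - y|.
  by rewrite DE; ring.
have := normr_ge0 (z - y).
lra.
Qed.

End Euclidean.

Section MeshGeometry.
Context {R : realType} {d : nat} {Omega : set 'rV[R]_d} {X : discretization R d} {sigma rho : R}.
Hypotheses (d0 : (0 < d)%N) (hO : admissible_domain Omega)
  (hX : admissible_mesh Omega sigma rho X) (p0 : (0 < deg X)%N) (hgll : is_gll (gll X)).
Implicit Types (x y z : 'rV[R]_d) (j k : 'I_(ncell X)).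

Local Notation delta j := (diam (cell j)).
Local Notation h := (meshsize X).
Let D : R := d%:R.
Let D1 : 1 <= D. Proof. by rewrite ler1n. Qed.

Lemma gmap_Qpoly j l : Qpoly 1 (fun x => gmap j x ord0 l).
Proof. exact: (mesh_multilinear hX). Qed.

Lemma gmap_inj j : {in ref_closed &, injective (@gmap _ _ X j)}.
Proof. exact: (mesh_injective hX). Qed.

(** Otherwise shape regularity would make every derivative of the geometry map vanish; the map would
    be constant on the reference cube, against injectivity. The positivity of [sigma] and of the
    diameters is derived from this. *)
Lemma shape_gt0 j : 0 < sigma * delta j.
Proof.
rewrite ltNge; apply/negP => sd.
have D0 x xi : ref_closed x -> 'D_xi (@gmap _ _ X j) x = 0.
  move=> xc; apply/eqP; rewrite -normr_le0; apply: le_trans (norm_le_enorm _) _.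
  have /andP[_ h2] := mesh_shape_regular hX j xc xi.
  by apply: le_trans h2 _; rewrite mulr_le0_ge0// enorm_ge0.
have gc x y : ref_closed x -> ref_closed y -> gmap j x = gmap j y.
  move=> xc yc; apply/rowP => l; apply/eqP; rewrite -subr_eq0 -normr_le0.
  have dg z : differentiable (fun w => gmap j w ord0 l) z by exact: differentiable_Qpoly (gmap_Qpoly j l).
  have := @lipschitz_ref R d (fun w => gmap j w ord0 l) 0 dg _ y x yc xc.
  rewrite mulr0 mul0r; apply => k z zc.
  rewrite /partial -(derive_coord (fun l => gmap_Qpoly j l)) D0// mxE normr0.
  exact: lexx.
have c1 : ref_closed (const_mx 1 : 'rV[R]_d) by move=> k; rewrite mxE normr1.
have c0 := @ref_closed0 R d.
have := gmap_inj (mem_set c1) (mem_set c0) (gc _ _ c1 c0).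
by move/rowP/(_ (Ordinal d0)); rewrite !mxE => /eqP; rewrite oner_eq0.
Qed.

Lemma delta_gt0 j : 0 < delta j.
Proof.
rewrite lt_neqAle diam_ge0 andbT; apply/eqP => e.
by have := shape_gt0 j; rewrite -e mulr0 ltxx.
Qed.

Lemma sigma_gt0 j : 0 < sigma.
Proof. by have := shape_gt0 j; rewrite pmulr_lgt0 ?delta_gt0. Qed.

Lemma gmap_bnd j x : ref_closed x -> forall xi,
  delta j / (sigma * D) * `|xi| <= `|'D_xi (@gmap _ _ X j) x| <= D * sigma * delta j * `|xi|.
Proof.
move=> xc xi; have /andP[h1 h2] := mesh_shape_regular hX j xc xi.
have s0 := sigma_gt0 j; have d1 := delta_gt0 j; have D0 : 0 < D by exact: lt_le_trans D1.
apply/andP; split.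
  rewrite -(ler_pM2l D0); apply: le_trans (enorm_le_norm _).
  apply: le_trans h1; rewrite (_ : D * _ = sigma^-1 * delta j * `|xi|); last by field; rewrite !gt_eqF.
  by rewrite ler_wpM2l ?norm_le_enorm// mulr_ge0 ?invr_ge0// ltW.
apply: le_trans (norm_le_enorm _) _; apply: le_trans h2 _.
rewrite (_ : D * sigma * delta j * _ = sigma * delta j * (D * `|xi|)); last by ring.
by rewrite ler_wpM2l ?enorm_le_norm// ltW// mulr_gt0.
Qed.

Lemma delta_le_h j : delta j <= h.
Proof. exact: (le_bigmax _ (fun j => delta j) j). Qed.

Lemma h_gt0 j : 0 < h.
Proof. exact: lt_le_trans (delta_gt0 j) (delta_le_h j). Qed.

Lemma rho_gt0 j : 0 < rho.
Proof. by have := lt_le_trans (h_gt0 j) (mesh_quasi_uniform hX j); rewrite pmulr_lgt0 ?delta_gt0. Qed.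

Lemma h_le_delta j : h / rho <= delta j.
Proof. by rewrite ler_pdivrMr ?rho_gt0 1?mulrC ?(mesh_quasi_uniform hX). Qed.

Lemma closure_Omega_bounded : exists M : R, forall x, closure Omega x -> `|x| <= M.
Proof.
have [_ _ /bounded_setP[M MP] _ _] := hO.
by exists (M + 1); exact: closure_bounded.
Qed.

Lemma closure_cell_sub j : closure (cell j) `<=` closure Omega.
Proof. by rewrite -(mesh_cover hX) => x xj; exists j. Qed.

(** The cover hypothesis only places cells in the closure of Omega. Being open, a cell lies in the
    interior of that closure, which is inside Omega by the Lipschitz property. *)
Lemma cell_sub_Omega j : cell j `<=` Omega.
Proof.
have [_ oO _ _ lO] := hO.
move=> x xj; apply: (interior_closure_lipschitz oO lO).
have : nbhs x (cell j) by apply: open_nbhs_nbhs; split => //; exact: (mesh_open hX).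
apply: filterS => y yj; apply: (@closure_cell_sub j); exact: subset_closure.
Qed.

Lemma cell_diam j x y : cell j x -> cell j y -> `|x - y| <= delta j.
Proof.
have [M MP] := closure_Omega_bounded.
move=> xj yj; apply: (@diam_ub _ _ _ M) => // z zj; apply: MP.
by apply: (@closure_cell_sub j); exact: subset_closure.
Qed.

Lemma closure_cell_diam j x y : closure (cell j) x -> cell j y -> `|x - y| < 2 * delta j.
Proof.
move=> xj yj; have [z zj xz] := closure_ball xj (delta_gt0 j).
have -> : x - y = (x - z) + (z - y) by rewrite subrKA.
apply: le_lt_trans (ler_normD _ _) _; have := cell_diam zj yj; lra.
Qed.

Lemma gmap_continuous j : continuous (@gmap _ _ X j).
Proof. by apply: g_continuous => l; exact: gmap_Qpoly. Qed.

Lemma gmap_closure j x : ref_closed x -> closure (cell j) (gmap j x).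
Proof.
move=> xc B /(gmap_continuous (x := x)) /nbhs_ballP[eps /= eps0 epsB].
have x1 : `|x| <= 1 by apply: norm_le_coord.
pose t := Num.min (1 / 2) (eps / 2).
have t0 : 0 < t by rewrite lt_min !divr_gt0.
have t1 : t <= 1 / 2 by rewrite ge_min lexx.
have t2 : t <= eps / 2 by rewrite ge_min lexx orbT.
exists (gmap j ((1 - t) *: x)); split.
  exists ((1 - t) *: x) => // k; rewrite mxE normrM ger0_norm; last lra.
  have := xc k => xk; apply: (@le_lt_trans _ _ (1 - t)); last lra.
  by rewrite ler_piMr//; lra.
apply: epsB; rewrite -ball_normE/= (_ : x - _ = t *: x); last by apply/rowP => k; rewrite !mxE; ring.
rewrite normrZ gtr0_norm//; apply: (@le_lt_trans _ _ t); last lra.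
by rewrite ler_piMr// ltW.
Qed.

Lemma cell_pointsP j x : x \in cell_points j -> exists2 a : {ffun 'I_d -> 'I_(deg X).+1},
  ref_closed (grid_node (gll X) a) & x = gmap j (grid_node (gll X) a).
Proof.
move=> /mapP[a _ ->]; exists a => // k; rewrite mxE; exact: gll_le1 p0 hgll.
Qed.

Lemma cell_point_closure j x : x \in cell_points j -> closure (cell j) x.
Proof. by move=> /cell_pointsP[a ac ->]; exact: gmap_closure. Qed.

Lemma mem_cell_points j a : gmap j (grid_node (gll X) a) \in cell_points j.
Proof. by apply/mapP; exists a => //; rewrite mem_enum. Qed.

Lemma vertex_cell_point j w : ref_vertex w -> gmap j w \in cell_points j.
Proof.
move=> wv.
have ex (l : 'I_d) : exists i, gll X i = w ord0 l.
  by case: (wv l) => ->; [have [i iE] := gll_end p0 hgll true|have [i iE] := gll_end p0 hgll false]; exists i.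
have -> : w = grid_node (gll X) [ffun l => projT1 (cid (ex l))].
  by apply/rowP => k; rewrite mxE ffunE; case: cid.
exact: mem_cell_points.
Qed.

(** By conformity a nonempty intersection is a common face with common vertices; a vertex is a
    support point of both cells because 1 and -1 are nodes. *)
Lemma shared_point j k : closure (cell j) `&` closure (cell k) !=set0 ->
  exists2 x, x \in cell_points j & x \in cell_points k.
Proof.
move=> jk; have [<-|njk] := eqVneq j k.
  by exists (gmap j (const_mx 1)); apply: vertex_cell_point => l; rewrite mxE; left.
have [e|[s [t [_ _ _ _ vE]]]] := mesh_conforming hX njk; first by move: jk; rewrite e => -[].
(* A vertex of the face: its free coordinates are set to 1. *)
pose w : 'rV[R]_d := \row_l (if s l is Some false then -1 else 1).
have wv : ref_vertex w by move=> l; rewrite mxE; case: (s l) => [[]|]; [left|right|left].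
have ws : ref_face s w.
  split=> [l|l b sl]; rewrite mxE; last by rewrite sl; case: b {sl}.
  by case: (s l) => [[]|]; rewrite ?normrN normr1.
have [w' [_ w'v] e] : (gmap k @` (ref_face t `&` ref_vertex)) (gmap j w).
  by rewrite -vE; exists w.
by exists (gmap j w); [exact: vertex_cell_point|rewrite -e; exact: vertex_cell_point].
Qed.

Lemma Omega_connected : connected Omega.
Proof.
have [[x0 Ox0] _ _ [pc _] _] := hO.
pose Pth y := [set z : 'rV[R]_d | exists g, [/\ path_in Omega g, g 0 = x0, g 1 = y & (g @` `[0, 1]) z]].
have -> : Omega = \bigcup_(g in [set g : R -> 'rV[R]_d | path_in Omega g /\ g 0 = x0]) (g @` `[0, 1]%classic).
  apply/seteqP; split => [y Oy|y [g [[_ gO] _] [t t01 <-]]]; last exact: gO.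
  have [g [gp g0 g1]] := pc _ _ Ox0 Oy; exists g => //.
  by exists 1 => //; rewrite /= in_itv/= ler01 lexx.
apply: bigcup_connected.
  exists x0 => g [_ g0]; exists 0 => //; by rewrite /= in_itv/= ler01 lexx.
move=> g [[gc _] _]; apply: connected_continuous_connected => //.
exact/connected_intervalP/interval_is_interval.
Qed.

Definition adj j k := has (mem (cell_points j)) (cell_points k).

Lemma cell_nonempty j : cell j !=set0.
Proof. by exists (gmap j 0), 0 => // k; rewrite mxE normr0. Qed.

(** If [k] is not reached, the closed cells reachable from [j] and the other closed cells form two
    closed sets that cover Omega. They are disjoint by [shared_point] and both meet Omega, which is
    connected. *)
Lemma mesh_connected j k : connect adj j k.
Proof.
apply: contrapT => /negP njk.
pose S := [set l | connect adj j l].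
pose F1 := \bigcup_(l in S) closure (cell l).
pose F2 := \bigcup_(l in ~` S) closure (cell l).
have c1 : closed F1 by apply: closed_bigcup => [|l _]; [exact: finite_finset|exact: closed_closure].
have c2 : closed F2 by apply: closed_bigcup => [|l _]; [exact: finite_finset|exact: closed_closure].
have F12 : Omega `<=` F1 `|` F2.
  move=> x /subset_closure; rewrite -(mesh_cover hX) => -[l _ xl].
  by have [Sl|Sl] := pselect (S l); [left|right]; exists l.
have F0 : F1 `&` F2 = set0.
  apply/seteqP; split => // x [[l Sl xl] [m Sm xm]]; apply: Sm.
  have [y yl ym] := @shared_point l m (ex_intro _ x (conj xl xm)).
  by apply: connect_trans Sl _; apply: connect1; apply/hasP; exists y.
have OF1 : Omega `&` F1 = Omega.
  apply: Omega_connected.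
  - have [x xj] := cell_nonempty j; exists x; split; first exact: cell_sub_Omega xj.
    by exists j; [exact: connect0|exact: subset_closure].
  - exists (~` F2); first exact: closed_openC.
    apply/seteqP; split => x [Ox Fx]; split => //.
      by move=> F2x; have : (F1 `&` F2) x by []; rewrite F0.
    by case: (F12 x Ox).
  - by exists F1.
have [x xk] := cell_nonempty k.
have : (Omega `&` F1) x by rewrite OF1; exact: cell_sub_Omega xk.
move=> [_ F1x]; have : (F1 `&` F2) x.
  by split => //; exists k; [exact/negP|exact: subset_closure].
by rewrite F0.
Qed.

End MeshGeometry.

(** * Energy of finite element functions *)

Section Energy.
Context {R : realType} {d : nat} {Omega : set 'rV[R]_d} {X : discretization R d} {sigma rho : R}.
Hypotheses (d0 : (0 < d)%N) (hO : admissible_domain Omega)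
  (hX : admissible_mesh Omega sigma rho X) (p0 : (0 < deg X)%N) (hgll : is_gll (gll X)).
Implicit Types (x y z : 'rV[R]_d) (j : 'I_(ncell X)) (u : 'rV[R]_d -> R).

Local Notation delta j := (diam (cell j)).
Local Notation h := (meshsize X).
Local Notation mu := (@lebesgue_rV R d).
Let D : R := d%:R.
Let D1 : 1 <= D. Proof. by rewrite ler1n. Qed.

(* A cell of diameter [delta] contains cubes of radius [cube_ratio d sigma * delta / p ^ 2]
   on which the energy is controlled from below; cf. [cell_lower]. *)
Definition cube_ratio (n : nat) (s : R) : R :=
  (12 * n%:R ^+ 4 * (1 + s ^+ 2))^-1 / (4 * (n%:R + 1) * (s * n%:R)).

Let rho1 := cube_ratio d sigma.

Lemma cube_ratio_gt0 j : 0 < rho1.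
Proof.
have s0 := sigma_gt0 d0 hX j; have D0 : 0 < D by apply: lt_le_trans D1.
by rewrite /rho1 /cube_ratio -/D divr_gt0 ?invr_gt0// !mulr_gt0 ?exprn_gt0// ?ltr_wpDr ?sqr_ge0// ltW.
Qed.

Lemma a_gt0 j : 0 < delta j / (sigma * D).
Proof.
rewrite divr_gt0 ?(delta_gt0 d0 hX)// mulr_gt0 ?(sigma_gt0 d0 hX j)//.
exact: lt_le_trans D1.
Qed.

Lemma cell_lower j p (q v : 'rV[R]_d -> R) : (0 < p)%N -> Qpoly p q ->
  (forall x, ref_closed x -> v (gmap j x) = q x) ->
  exists (ym : 'rV[R]_d * R), [/\ 0 <= ym.2,
    cube ym.1 (delta j * rho1 / p%:R ^+ 2) `<=` cell j,
    forall y, cube ym.1 (delta j * rho1 / p%:R ^+ 2) y -> ym.2 ^+ 2 <= \sum_k partial v k y ^+ 2 &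
    forall x y, ref_closed x -> ref_closed y ->
      `|v (gmap j x) - v (gmap j y)| <= 4 * D ^+ 3 * sigma * delta j * ym.2].
Proof.
move=> pp Qq vq.
have s0 := sigma_gt0 d0 hX j; have D0 : 0 < D by apply: lt_le_trans D1.
have dj := delta_gt0 d0 hX j.
have D1' := D1.
have p1 : 1 <= p%:R ^+ 2 :> R by rewrite expr_ge1// ler1n.
(* Chosen so that [s = s1 / p^2] meets both smallness conditions of [cell_energy_lower]; here
   [b / a = D^2 sigma^2]. *)
have [s1 s1E] : exists s1, s1 = (12 * D ^+ 4 * (1 + sigma ^+ 2))^-1 by eexists.
have q0 : 0 < 12 * D ^+ 4 * (1 + sigma ^+ 2).
  by rewrite !mulr_gt0 ?exprn_gt0// ltr_wpDr ?sqr_ge0.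
have s10 : 0 < s1 by rewrite s1E invr_gt0.
have D4 : D <= D ^+ 4 by rewrite -[leLHS]expr1 ler_weXn2l.
have D40 : 0 < D ^+ 4 by rewrite exprn_gt0.
have ss0 : 0 <= sigma ^+ 2 by rewrite sqr_ge0.
have s1a : 12 * D * s1 <= 1.
  rewrite s1E -[leRHS](mulfV (lt0r_neq0 q0)) ler_wpM2r ?invr_ge0 ?(ltW q0)//; nra.
have s1b : 4 * D ^+ 4 * sigma ^+ 2 * s1 <= 1.
  rewrite s1E -[leRHS](mulfV (lt0r_neq0 q0)) ler_wpM2r ?invr_ge0 ?(ltW q0)//; nra.
have a0 : 0 < delta j / (sigma * D) by rewrite divr_gt0// mulr_gt0.
have pp0 : 0 < p%:R ^+ 2 :> R by lra.
have [|||y0 [m [m0 cs cm vm]]] := @cell_energy_lower R d (@gmap _ _ X j) _ _ d0 a0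
  (fun l => gmap_Qpoly hX j l) (@gmap_bnd _ _ _ _ _ _ d0 hX j) p q v pp Qq vq (s1 / p%:R ^+ 2).
- by rewrite divr_gt0.
- rewrite (_ : _ * (s1 / _) = 12 * D * s1)//; rewrite /D; field.
  by rewrite pnatr_eq0 -lt0n.
- rewrite -/D (_ : _ * (s1 / _) = delta j / (sigma * D) * (4 * D ^+ 4 * sigma ^+ 2 * s1) / p%:R ^+ 2); last first.
    by field; rewrite pnatr_eq0 -lt0n pp !gt_eqF.
  rewrite ler_pdivrMr//; apply: (@le_trans _ _ (delta j / (sigma * D))).
    by rewrite ler_piMr// ltW.
  by rewrite ler_peMr// ltW.
have rE : delta j / (sigma * D) * (s1 / p%:R ^+ 2) / (4 * (D + 1)) = delta j * rho1 / p%:R ^+ 2.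
  rewrite s1E /rho1 /cube_ratio -/D; field.
  by rewrite !pnatr_eq0 -!lt0n pp d0 !gt_eqF//; lra.
rewrite -/D rE in cs cm.
exists (y0, m); split => //= x y xc yc; apply: le_trans (vm x y xc yc) _.
by rewrite -/D le_eqVlt; apply/orP; left; apply/eqP; ring.
Qed.

Lemma cell_disjoint i j : i != j -> cell i `&` cell j = set0.
Proof. by move=> ij; move/trivIsetP : (mesh_disjoint hX); apply. Qed.

Lemma measurable_cell j : measurable (cell j).
Proof. by apply: open_measurable_rV; exact: (mesh_open hX). Qed.

(** The cells contain disjoint cubes of radius at least [h / rho] times the cube ratio, all inside
    the cube of radius [2 h] about [x]; the bound is the ratio of the volumes. *)
Lemma packing (s : seq 'I_(ncell X)) x j0 : uniq s -> (forall j, j \in s -> closure (cell j) x) ->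
  (size s)%:R <= (2 * rho / rho1) ^+ d.
Proof.
move=> us sx; have h0 := h_gt0 d0 hX j0; have r0 := rho_gt0 d0 hX j0; have c0 := cube_ratio_gt0 j0.
(* Only the cubes of [cell_lower] are wanted, so it is applied to the zero function in degree 1. *)
have Q0 : Qpoly 1 (fun _ : 'rV[R]_d => 0 : R).
  by exists (fun=> 0) => z; rewrite big1// => a _; rewrite mul0r.
pose y j := (projT1 (cid (@cell_lower j 1 (fun=> 0) (fun=> 0) isT Q0 (fun _ _ => erefl)))).1.
have yP j : cube (y j) (delta j * rho1) `<=` cell j.
  by rewrite /y; case: cid => -[y0 m] [_] /=; rewrite expr1n divr1.
have dr j : 0 <= delta j * rho1 by rewrite mulr_ge0// ltW// (delta_gt0 d0 hX).
have := @sum_measure_le _ _ R mu _ s (fun=> 1) (fun j => cube (y j) (delta j * rho1)) us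
  (fun j => @measurable_cube R d _ _) (fun=> ler01) _ (cube x (2 * h))
  (fun j => (2 * (delta j * rho1)) ^+ d) ((2 * (2 * h)) ^+ d) (@measurable_cube R d _ _) _ _ _ (fun=> erefl).
move=> /(_ _ _ _ _)/wrap[i j is_ js ij|j js z zj|j js||H].
- apply/seteqP; split => // z [zi zj].
  have : (cell i `&` cell j) z by split; exact: yP.
  by rewrite (cell_disjoint ij).
- move=> k; have := closure_cell_diam d0 hO hX (sx _ js) (yP _ _ zj) => xz.
  have := coord_le_norm (x - z) k; rewrite !mxE distrC => xzk.
  have := delta_le_h j; lra.
- exact: lebesgue_cube.
- by rewrite -(@lebesgue_cube R d x (2 * h)) ?mulr_ge0// ltW.
have H2 : (size s)%:R * (2 * (h / rho * rho1)) ^+ d <= (2 * (2 * h)) ^+ d.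
  apply: le_trans H; rewrite mulr_natl -iter_addr_0 -count_predT -big_const_seq big_seq [leRHS]big_seq.
  have dj j : 0 <= delta j by rewrite ltW// (delta_gt0 d0 hX).
  have q0 : 0 <= h / rho by rewrite divr_ge0// ltW.
  apply: ler_sum => j js; rewrite lerXn2r//.
  - by rewrite nnegrE (mulr_ge0 (ler0n R 2) (mulr_ge0 q0 (ltW c0))).
  - by rewrite nnegrE (mulr_ge0 (ler0n R 2) (mulr_ge0 (dj j) (ltW c0))).
  - by rewrite ler_wpM2l// ler_wpM2r ?(ltW c0)// (h_le_delta d0 hX).
have P0 : 0 < (2 * (h / rho * rho1)) ^+ d.
  by apply: exprn_gt0; apply: mulr_gt0 => //; exact: mulr_gt0 (divr_gt0 h0 r0) c0.
rewrite -(ler_pM2r P0) -exprMn; apply: le_trans H2 _.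
rewrite le_eqVlt; apply/orP; left; apply/eqP; congr (_ ^+ _); field.
by rewrite !gt_eqF.
Qed.

Let cells := \bigcup_(j in [set: 'I_(ncell X)]) cell j.

Lemma open_cells : open cells.
Proof. by apply: bigcup_open => j _; exact: (mesh_open hX). Qed.

Lemma grad_cell j u k y : cell j y -> grad X u k y = partial u k y.
Proof. by move=> yj; rewrite /grad patchE mem_set//; exists j. Qed.

(** On a cell the derivative is the pointwise limit of difference quotients with steps
    [1 / (n + 1)]. They are formed from the extension of [u] by 0, since the values of [u] off the
    closure of Omega are arbitrary. *)
Lemma measurable_grad u k : fe_space Omega X u -> measurable_fun setT (grad X u k).
Proof.
move=> [uc uq].
have mcells : measurable cells by apply: open_measurable_rV; exact: open_cells.
apply/(measurable_restrictT _ _).1 => //.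
pose ut : 'rV[R]_d -> R := u \_ (closure Omega).
have mut : measurable_fun setT ut.
  apply/(measurable_restrictT _ _).1.
    by apply: closed_measurable_rV; exact: closed_closure.
  apply: measurable_within uc; apply: closed_measurable_rV; exact: closed_closure.
pose sh (n : nat) (y : 'rV[R]_d) := y + harmonic n *: (delta_mx ord0 k : 'rV[R]_d).
pose hn (n : nat) y : R := n.+1%:R * (ut (sh n y) - ut y).
apply: (@measurable_fun_cvg _ _ _ _ hn).
  move=> n; apply: measurable_funTS; apply: measurable_funM => //.
  apply: measurable_funB => //; apply: measurableT_comp => //.
  apply: continuous_measurable_rV => y.
  exact: (@continuousD _ _ _ id (cst (harmonic n *: (delta_mx ord0 k : 'rV[R]_d))) y (fun _ => id) (@cst_continuous _ _ _ y)).
move=> y [j _ yj].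
have [z zo gz] := yj; have [q Qq uqE] := uq j.
have := cell_derive d0 (a_gt0 j) (fun l => gmap_Qpoly hX j l) (@gmap_bnd _ _ _ _ _ _ d0 hX j)
  p0 Qq uqE k zo.
rewrite gz => Du; have [/cvg_ex[L cL] _] := Du.
have -> : partial u k y = L by rewrite /partial /derive; exact: cvg_lim cL.
have H0 : @harmonic R @ \oo --> (0 : R)^'.
  move=> P /= [eps /= eps0 epsP].
  have := near_infty_natSinv_lt (PosNum eps0); apply: filterS => n nP.
  apply: epsP; last by rewrite gt_eqF// invr_gt0.
  by rewrite /ball_/= sub0r normrN ger0_norm// invr_ge0.
have yc : closure Omega y by apply: (closure_cell_sub hX (j := j)); exact: subset_closure.
have oy : nbhs y (cell j) by apply: open_nbhs_nbhs; split => //; exact: (mesh_open hX).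
have {oy} /nbhs_ballP[eps /= eps0 epsj] := oy.
apply: cvg_trans (cvg_comp _ _ H0 cL); apply: near_eq_cvg.
have := near_infty_natSinv_lt (PosNum eps0); apply: filterS => n nP.
have cy : closure Omega (y + n.+1%:R^-1 *: delta_mx ord0 k); last first.
  by rewrite /= /hn /sh /harmonic /= invrK [_ *: _ + y]addrC /ut !patchE (mem_set yc) (mem_set cy).
apply: (closure_cell_sub hX (j := j)); apply: subset_closure; apply: epsj.
rewrite -ball_normE/= opprD addrA subrr sub0r normrN normrZ.
rewrite ger0_norm ?invr_ge0//; apply: le_lt_trans nP.
by rewrite ler_piMr ?invr_ge0// norm_delta.
Qed.

End Energy.

Section Energy2.
Context {R : realType} {d : nat} {Omega : set 'rV[R]_d} {X : discretization R d} {sigma rho : R}.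
Hypotheses (d0 : (0 < d)%N) (hO : admissible_domain Omega)
  (hX : admissible_mesh Omega sigma rho X) (p0 : (0 < deg X)%N) (hgll : is_gll (gll X)).
Implicit Types (x y z : 'rV[R]_d) (j : 'I_(ncell X)) (u : 'rV[R]_d -> R).

Local Notation delta j := (diam (cell j)).
Local Notation h := (meshsize X).
Local Notation mu := (@lebesgue_rV R d).
Local Notation rho1 := (cube_ratio d sigma).
Let D : R := d%:R.
Let D1 : 1 <= D. Proof. by rewrite ler1n. Qed.

Definition energy u y : R := \sum_k grad X u k y ^+ 2.

Lemma energy_ge0 u y : 0 <= energy u y.
Proof. by apply: sumr_ge0 => k _; exact: sqr_ge0. Qed.

Lemma energy_cell j u y : cell j y -> energy u y = \sum_k partial u k y ^+ 2.
Proof. by move=> yj; apply: eq_bigr => k _; rewrite (grad_cell _ _ yj). Qed.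

Lemma energy_out u y : (forall j, ~ cell j y) -> energy u y = 0.
Proof.
move=> ny; rewrite /energy big1// => k _; rewrite /grad patchE memNset ?expr0n//.
by move=> [j _ /ny].
Qed.

Lemma measurable_energy u : fe_space Omega X u -> measurable_fun setT (energy u).
Proof.
by move=> uf; apply: measurable_sum => k; apply: measurable_funX; exact: (measurable_grad d0 hX p0 k uf).
Qed.

Lemma energy_cell_le j u q (M : R) : Qpoly (deg X) q ->
  (forall x, ref_closed x -> u (gmap j x) = q x) ->
  (forall k x, ref_closed x -> `|partial q k x| <= M) ->
  forall y, cell j y -> energy u y <= D * (D * M / (delta j / (sigma * D))) ^+ 2.
Proof.
move=> Qq uq qM y yj; have [x xo <-] := yj; rewrite (energy_cell _ (imageP _ xo)).
have xc := ref_openW xo.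
apply: (@le_trans _ _ (\sum_(k < d) (D * M / (delta j / (sigma * D))) ^+ 2)).
  apply: ler_sum => k _; rewrite -[leLHS]real_normK ?num_real//.
  have H := cell_partial_le d0 (a_gt0 d0 hX j) (fun l => gmap_Qpoly hX j l)
    (@gmap_bnd _ _ _ _ _ _ d0 hX j) p0 Qq uq k xo (fun i => qM i x xc).
  by rewrite lerXn2r// nnegrE//; apply: le_trans H.
by rewrite sumr_const card_ord -[leLHS]mulr_natl.
Qed.

(** Supplies the bound [M] of [Rintegral_ge_step]. *)
Lemma energy_bounded u : fe_space Omega X u -> exists M : R, forall y, 0 <= energy u y <= M.
Proof.
move=> [_ uq].
have ex j : exists M : R, forall y, cell j y -> energy u y <= M.
  have [q Qq uE] := uq j.
  have [x xc xmax] := Qpoly_max Qq.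
  exists (D * (D * (2 * (deg X)%:R ^+ 2 * `|q x|) / (delta j / (sigma * D))) ^+ 2).
  apply: (energy_cell_le Qq uE) => k z zc; exact: (markov_Qpoly p0 Qq).
pose M j := projT1 (cid (ex j)).
have MP j y : cell j y -> energy u y <= M j by rewrite /M; case: cid => M0 /= H; exact: H.
exists (\sum_j `|M j|) => y; rewrite energy_ge0/=.
have [[j yj]|ny] := pselect (exists j, cell j y); last first.
  by rewrite energy_out ?sumr_ge0// => j yj; apply: ny; exists j.
apply: le_trans (MP _ _ yj) _; rewrite (bigD1 j)//= -[leLHS]addr0 lerD ?ler_norm//.
by rewrite sumr_ge0.
Qed.

(** The first factor is the square of the oscillation constant of [cell_lower]; the second is the
    inverse volume of its cube after quasi-uniformity, up to powers of [h] and [p]. *)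
Definition energy_const (n : nat) (s r : R) : R :=
  (4 * n%:R ^+ 3 * s) ^+ 2 * (r / (2 * cube_ratio n s)) ^+ n.

(* [h^2 / h^d] is the scaling of the difference of nodal values against the
   energy; [p^(2d)] is the volume of the cubes of [cell_lower]. *)
Lemma energy_lower (j0 : 'I_(ncell X)) u (s : seq 'I_(ncell X)) (G : set 'rV[R]_d) : fe_space Omega X u ->
  uniq s -> measurable G -> (mu G < +oo)%E -> (forall j, j \in s -> cell j `<=` G) ->
  exists omega : 'I_(ncell X) -> R, [/\ forall j, 0 <= omega j,
    forall j x y, x \in cell_points j -> y \in cell_points j -> `|u x - u y| <= omega j &
    \sum_(j <- s) omega j ^+ 2 <=
      energy_const d sigma rho * (h ^+ 2 / h ^+ d * (deg X)%:R ^+ (2 * d)) * H1seminorm2 X G u].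
Proof.
move=> uf us mG Gfin sG; have [uc uq] := uf.
have ex j : exists ym : 'rV[R]_d * R, [/\ 0 <= ym.2,
    cube ym.1 (delta j * rho1 / (deg X)%:R ^+ 2) `<=` cell j,
    forall y, cube ym.1 (delta j * rho1 / (deg X)%:R ^+ 2) y -> ym.2 ^+ 2 <= \sum_k partial u k y ^+ 2 &
    forall x y, ref_closed x -> ref_closed y ->
      `|u (gmap j x) - u (gmap j y)| <= 4 * D ^+ 3 * sigma * delta j * ym.2].
  by have [q Qq uE] := uq j; exact: (cell_lower d0 hX p0 Qq uE).
pose ym j := projT1 (cid (ex j)).
have ymP j : [/\ 0 <= (ym j).2,
    cube (ym j).1 (delta j * rho1 / (deg X)%:R ^+ 2) `<=` cell j,
    forall y, cube (ym j).1 (delta j * rho1 / (deg X)%:R ^+ 2) y -> (ym j).2 ^+ 2 <= \sum_k partial u k y ^+ 2 &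
    forall x y, ref_closed x -> ref_closed y ->
      `|u (gmap j x) - u (gmap j y)| <= 4 * D ^+ 3 * sigma * delta j * (ym j).2].
  by rewrite /ym; case: cid.
move: {ex} ym ymP => ym ymP.
have dj j : 0 < delta j by exact: (delta_gt0 d0 hX).
have D0 : 0 < D by apply: lt_le_trans D1.
have om0 j : 0 <= 4 * D ^+ 3 * sigma * delta j * (ym j).2.
  have s0 := sigma_gt0 d0 hX j; have [m0 _ _ _] := ymP j.
  by rewrite mulr_ge0// ltW// !mulr_gt0// exprn_gt0.
exists (fun j => 4 * D ^+ 3 * sigma * delta j * (ym j).2); split => //.
  move=> j x y /(cell_pointsP p0 hgll)[a ac ->] /(cell_pointsP p0 hgll)[b bc ->].
  by have [_ _ _] := ymP j; apply.
have [M MP] := energy_bounded uf.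
pose r j := delta j * rho1 / (deg X)%:R ^+ 2.
have pp : 0 < (deg X)%:R ^+ 2 :> R by rewrite exprn_gt0// ltr0n.
have c0 j : 0 < rho1 by exact: (cube_ratio_gt0 d0 hX j).
have r0 j : 0 < r j by rewrite /r; apply: divr_gt0 => //; exact: mulr_gt0 (dj j) (c0 j).
have H : \sum_(j <- s) (ym j).2 ^+ 2 * (2 * r j) ^+ d <= H1seminorm2 X G u.
  apply: (@Rintegral_ge_step _ _ R mu _ s (fun j => (ym j).2 ^+ 2) (fun j => cube (ym j).1 (r j))
    us (fun j => @measurable_cube R d _ _) (fun j => sqr_ge0 _) _ G (energy u) M) => //.
  - move=> i j _ _ ij; apply/seteqP; split => // z [zi zj].
    have [_ ci _ _] := ymP i; have [_ cj _ _] := ymP j.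
    have : (cell i `&` cell j) z by split; [exact: ci|exact: cj].
    by rewrite (cell_disjoint hX ij).
  - by apply: measurable_funTS; exact: measurable_energy.
  - by move=> j js z zj; apply: (sG j js); have [_ cj _ _] := ymP j; exact: cj.
  - move=> j z js zj; have [_ cj cm _] := ymP j.
    by rewrite (energy_cell _ (cj _ zj)); exact: cm.
  - by move=> j js; apply: lebesgue_cube; exact: ltW.
have h0 : 0 < h by exact: (h_gt0 d0 hX j0).
have rh0 : 0 < rho by exact: (rho_gt0 d0 hX j0).
have c00 := c0 j0; have s0 : 0 < sigma by exact: (sigma_gt0 d0 hX j0).
set I := H1seminorm2 X G u in H *.
(* Quasi-uniformity replaces the cell diameter by [h]: from above in its square, from below in the
   radius of the cube. *)
have S0 j : j \in s -> (4 * D ^+ 3 * sigma * delta j * (ym j).2) ^+ 2 <=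
    (4 * D ^+ 3 * sigma) ^+ 2 * h ^+ 2 / (2 * (h / rho * rho1 / (deg X)%:R ^+ 2)) ^+ d *
      ((ym j).2 ^+ 2 * (2 * r j) ^+ d).
  move=> js; have q0 : 0 < 2 * (h / rho * rho1 / (deg X)%:R ^+ 2).
    by apply: mulr_gt0 => //; apply: divr_gt0 => //; apply: mulr_gt0 => //; exact: divr_gt0.
  rewrite (_ : (_ ^+ 2 : R) = (4 * D ^+ 3 * sigma) ^+ 2 * (ym j).2 ^+ 2 * delta j ^+ 2); last by ring.
  rewrite -[leRHS]mulrA -[leRHS]mulrA -mulrA.
  rewrite ler_wpM2l ?sqr_ge0// mulrC [leRHS](_ : _ = h ^+ 2 * ((ym j).2 ^+ 2 *
    ((2 * r j) ^+ d / (2 * (h / rho * rho1 / (deg X)%:R ^+ 2)) ^+ d))); last by rewrite mulrCA; ring.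
  apply: ler_pM => //; rewrite ?sqr_ge0 ?lerXn2r ?nnegrE ?(ltW h0) ?(ltW (dj j)) ?delta_le_h//.
  rewrite ler_peMr ?sqr_ge0// ler_pdivlMr ?exprn_gt0// mul1r lerXn2r//.
  - by rewrite nnegrE ltW.
  - by rewrite nnegrE mulr_ge0// ltW.
  - rewrite ler_wpM2l// /r ler_wpM2r ?invr_ge0 ?(ltW pp)// ler_wpM2r ?(ltW c00)//.
    exact: (h_le_delta d0 hX).
apply: (@le_trans _ _ (\sum_(j <- s) (4 * D ^+ 3 * sigma) ^+ 2 * h ^+ 2 / (2 * (h / rho * rho1 / (deg X)%:R ^+ 2)) ^+ d *
      ((ym j).2 ^+ 2 * (2 * r j) ^+ d))).
  by rewrite big_seq [leRHS]big_seq; exact: ler_sum.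
rewrite -mulr_sumr (_ : energy_const d sigma rho * _ = (4 * D ^+ 3 * sigma) ^+ 2 * h ^+ 2 /
  (2 * (h / rho * rho1 / (deg X)%:R ^+ 2)) ^+ d); last first.
  rewrite /energy_const -/D exprM.
  have -> : 2 * (h / rho * rho1 / (deg X)%:R ^+ 2) = h * (rho / (2 * rho1))^-1 * ((deg X)%:R ^+ 2)^-1.
    by field; rewrite !gt_eqF// ltr0n.
  set t := rho / (2 * rho1); set P := (deg X)%:R ^+ 2.
  by rewrite [(h / t / P) ^+ d]exprMn [(h / t) ^+ d]exprMn !exprVn !invfM !invrK; ring.
apply: ler_wpM2l => //; apply: divr_ge0; first by rewrite mulr_ge0// sqr_ge0.
apply: exprn_ge0; apply: mulr_ge0 => //; apply: divr_ge0; last exact: ltW.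
by apply: mulr_ge0; [rewrite divr_ge0// ltW|exact: ltW].
Qed.

(** Up to powers of [h] and [p]: the number of cells at a point, the supremum of the energy density
    on them, and the volume of a cube of radius [2 h] around a cell. *)
Definition basis_const (n : nat) (s r : R) : R :=
  (2 * r / cube_ratio n s) ^+ n * (n%:R * (2 * n%:R ^+ 2 * s * r) ^+ 2 * 4 ^+ n).

Lemma mem_support_points j x : x \in cell_points j -> x \in support_points X.
Proof.
move=> xj; rewrite mem_undup; apply/flattenP; exists (cell_points j) => //.
by apply/mapP; exists j => //; rewrite mem_enum.
Qed.

(* On a cell containing [x] the pullback of the basis function is a product of
   one-dimensional Lagrange polynomials, each at most 1 by Fejer; elsewhere it
   vanishes. *)
Lemma basis_energy_le j x y : is_nodal_basis Omega X -> x \in support_points X -> cell j y ->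
  energy (phi X x) y <=
    if x \in cell_points j then D * (D * (2 * (deg X)%:R ^+ 2) / (delta j / (sigma * D))) ^+ 2 else 0.
Proof.
move=> [bfe [_ bval]] xs yj.
have [_ /(_ j)[q Qq uE]] := bfe x xs.
have ginj : injective (gll X) by exact: gll_inj hgll.
have nc a : ref_closed (grid_node (gll X) a : 'rV[R]_d).
  by move=> k; rewrite mxE; exact: gll_le1 p0 hgll.
have qn a : q (grid_node (gll X) a) = (x == gmap j (grid_node (gll X) a))%:R.
  rewrite -uE//; apply: bval => //; apply: (@mem_support_points j); exact: mem_cell_points.
case: ifPn => xj.
  have q1 z : ref_closed z -> `|q z| <= 1.
    move=> zc; have [a _ xE] := cell_pointsP p0 hgll xj.
    rewrite (tensor_interp z ginj Qq) (bigD1 a)//= qn xE eqxx mul1r [X in _ + X]big1 ?addr0.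
      rewrite normr_prod; apply: prodr_ile1 => k _; rewrite normr_ge0/=.
      by apply: lagr_gll_le1 => //; rewrite -ler_norml; exact: zc.
    move=> b ba; rewrite qn xE; case: eqP => [e|]; last by rewrite mul0r.
    have /rowP e' := gmap_inj hX (mem_set (nc a)) (mem_set (nc b)) e.
    case/eqP: ba; apply/ffunP => k; have := e' k; rewrite !mxE => /ginj ->.
    by [].
  rewrite -[2 * _]mulr1; apply: (energy_cell_le Qq uE) => // k z zc.
  exact: (markov_Qpoly p0 Qq q1).
have q0 z : ref_closed z -> `|q z| <= 0.
  move=> zc; rewrite (tensor_interp z ginj Qq) big1 ?normr0// => b _.
  rewrite qn; case: eqP => [e|]; last by rewrite mul0r.
  by rewrite e mem_cell_points in xj.
have := energy_cell_le (M := 0) Qq uE _ yj; rewrite mulr0 mul0r expr0n mulr0; apply.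
by move=> k z zc; have := markov_Qpoly p0 Qq q0 k zc; rewrite mulr0.
Qed.

Lemma basis_Aform_le (j0 : 'I_(ncell X)) x : is_nodal_basis Omega X -> x \in support_points X ->
  Aform Omega X (phi X x) (phi X x) <=
    basis_const d sigma rho * ((deg X)%:R ^+ 4 * (h ^+ d / h ^+ 2)).
Proof.
move=> bas xs; have xfe := bas.1 x xs.
have D0 : 0 < D by apply: lt_le_trans D1.
have h0 : 0 < h by exact: (h_gt0 d0 hX j0).
have rh0 : 0 < rho by exact: (rho_gt0 d0 hX j0).
have s0 : 0 < sigma by exact: (sigma_gt0 d0 hX j0).
have dj j : 0 < delta j by exact: (delta_gt0 d0 hX).
have pp : 0 < (deg X)%:R :> R by rewrite ltr0n.
have [_ oO _ _ _] := hO.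
pose s := [seq j <- enum 'I_(ncell X) | x \in cell_points j].
have us : uniq s by rewrite filter_uniq// enum_uniq.
pose c := D * (D * (2 * (deg X)%:R ^+ 2) / (h / rho / (sigma * D))) ^+ 2.
have c0 : 0 <= c by rewrite mulr_ge0 ?(ltW D0)// sqr_ge0.
have cj j : D * (D * (2 * (deg X)%:R ^+ 2) / (delta j / (sigma * D))) ^+ 2 <= c.
  have sD : 0 < sigma * D by exact: mulr_gt0.
  have hr : 0 < h / rho by exact: divr_gt0.
  have n0 : 0 <= D * (2 * (deg X)%:R ^+ 2) by rewrite !mulr_ge0 ?(ltW D0)// exprn_ge0.
  rewrite /c ler_wpM2l ?(ltW D0)// lerXn2r//.
  - by rewrite nnegrE divr_ge0// divr_ge0// ltW.
  - by rewrite nnegrE divr_ge0// divr_ge0// ltW.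
  rewrite ler_wpM2l// lef_pV2 ?posrE ?divr_gt0//.
  by rewrite ler_wpM2r ?invr_ge0 ?(ltW sD)// (h_le_delta d0 hX).
have sz := packing d0 hO hX (x := x) j0 us.
have {}sz : (size s)%:R <= (2 * rho / rho1) ^+ d.
  by apply: sz => j; rewrite mem_filter => /andP[xj _]; exact: (cell_point_closure hX p0 hgll).
have : Aform Omega X (phi X x) (phi X x) <= \sum_(j <- s) c * (4 * h) ^+ d.
  rewrite /Aform; apply: (@Rintegral_le_step _ _ R mu _ s (fun=> c) (fun j => cell j)
    (measurable_cell hX) (fun=> c0) Omega _ (fun=> (4 * h) ^+ d)).
  - exact: open_measurable_rV.
  - apply: measurable_funTS; rewrite (_ : (fun _ => _) = energy (phi X x)); first exact: measurable_energy.
    by apply/funext => y; apply: eq_bigr => k _; rewrite expr2.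
  - by move=> y _; apply: sumr_ge0 => k _; rewrite -expr2 sqr_ge0.
  - move=> y _; rewrite (_ : \sum_k _ = energy (phi X x) y); last by apply: eq_bigr => k _; rewrite expr2.
    have S0 : 0 <= \sum_(j <- s) c * \1_(cell j) y by apply: sumr_ge0 => j _; rewrite mulr_ge0// indicE.
    have [[j yj]|ny] := pselect (exists j, cell j y); last first.
      by rewrite energy_out// => j yj; apply: ny; exists j.
    apply: le_trans (basis_energy_le bas xs yj) _; case: ifPn => // xj.
    apply: le_trans (cj j) _; rewrite (bigD1_seq j)//=; last by rewrite mem_filter xj mem_enum.
    rewrite indicE mem_set// mulr1 lerDl; apply: sumr_ge0 => i _; rewrite mulr_ge0// indicE//.
  - move=> j; have e := @lebesgue_cube R d (gmap j 0) (2 * h).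
    have H : (2 * (2 * h)) ^+ d = (4 * h) ^+ d by congr (_ ^+ _); ring.
    rewrite -H -e ?mulr_ge0// ?(ltW h0)//.
    apply: (@le_measure _ _ _ mu); rewrite ?inE.
    + exact: (measurable_cell hX).
    + exact: measurable_cube.
    move=> z zj k; have g0 : cell j (gmap j 0) by exists 0 => // l; rewrite mxE normr0.
    have := cell_diam hO hX zj g0; have := coord_le_norm (z - gmap j 0) k; rewrite !mxE.
    have := delta_le_h j; have := dj j; lra.
move=> /le_trans; apply; rewrite big_const_seq count_predT iter_addr_0 -[leLHS]mulr_natl.
apply: (@le_trans _ _ ((2 * rho / rho1) ^+ d * (c * (4 * h) ^+ d))).
  by rewrite ler_wpM2r// mulr_ge0// exprn_ge0// mulr_ge0// ltW.
rewrite le_eqVlt; apply/orP; left; apply/eqP; rewrite /basis_const -/D /c [(4 * h) ^+ d]exprMn.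
set K := (2 * rho / rho1) ^+ d; set hd := h ^+ d; set fd := 4 ^+ d.
by field; rewrite !gt_eqF.
Qed.

End Energy2.

(** * Agglomerates *)

Section Sums.
Context {R : realType}.

Lemma ler_sum_subset (I : finType) (r s : seq I) (f : I -> R) : uniq r -> uniq s ->
  {subset r <= s} -> (forall i, 0 <= f i) -> \sum_(i <- r) f i <= \sum_(i <- s) f i.
Proof.
move=> ur us rs f0; rewrite (big_uniq _ ur) (big_uniq _ us)/= [leRHS](bigID (mem r))/=.
rewrite [X in _ <= X + _](eq_bigl (mem r)) ?lerDl ?sumr_ge0// => i.
by rewrite -!topredE/=; apply/andP/idP => [[]//|ir]; split => //; exact: rs.
Qed.

Lemma sqr_sum_le (I : Type) (s : seq I) (f : I -> R) :
  (\sum_(i <- s) f i) ^+ 2 <= (size s)%:R * \sum_(i <- s) f i ^+ 2.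
Proof.
elim: s => [|i s IH]; first by rewrite !big_nil expr0n mul0r.
rewrite !big_cons /= -[(size s).+1]addn1 natrD.
have : 2 * f i * (\sum_(j <- s) f j) <= (size s)%:R * f i ^+ 2 + \sum_(j <- s) f j ^+ 2.
  elim: s {IH} => [|j s IH]; first by rewrite !big_nil mulr0 mul0r addr0.
  rewrite !big_cons /= -[(size s).+1]addn1 natrD; have := sqr_ge0 (f i - f j); lra.
lra.
Qed.

End Sums.

Section Agglomerate.
Context {R : realType} {d : nat} {Omega : set 'rV[R]_d} {X : discretization R d}
  {B : hierarchy R d} {sigma rho : R}.
Hypotheses (d0 : (0 < d)%N) (hO : admissible_domain Omega)
  (hX : admissible_mesh Omega sigma rho X) (p0 : (0 < deg X)%N) (hgll : is_gll (gll X))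
  (bas : is_nodal_basis Omega X) (hB : is_hierarchy X B).
Context (i : 'I_(nagg B)).
Implicit Types (x y z : 'rV[R]_d) (j k : 'I_(ncell X)) (u v w : 'rV[R]_d -> R).

Local Notation h := (meshsize X).
Local Notation own := (owned i).
Local Notation agg_c := (@agg_cells R d X B i).
Local Notation layer_c := (@layer_cells R d X B i).

Lemma owned_support x : x \in own -> x \in support_points X.
Proof.
move=> xi; have [_ [_ /perm_mem E]] := hB; rewrite -E.
by apply/flattenP; exists own => //; apply/mapP; exists i => //; rewrite mem_enum.
Qed.

Lemma owned_uniq : uniq own.
Proof.
have [_ [_ /perm_uniq E]] := hB.
have : uniq (flatten [seq owned i | i : 'I_(nagg B)]) by rewrite E undup_uniq.
have : i \in enum 'I_(nagg B) by rewrite mem_enum.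
rewrite /image_mem; elim: (enum 'I_(nagg B)) => //= k s IH.
rewrite inE cat_uniq => /orP[/eqP ->|/IH H] /and3P[] // _ _; exact: H.
Qed.

Lemma support_cell x : x \in support_points X -> exists j, x \in cell_points j.
Proof. by rewrite mem_undup => /flattenP[s /mapP[j _ ->]] xs; exists j. Qed.

Lemma owned_agg x j : x \in own -> x \in cell_points j -> agg_c j.
Proof. by move=> xi xj; exists x => //; exact: (cell_point_closure hX p0 hgll). Qed.

Definition agg_seq := [seq j <- enum 'I_(ncell X) | `[< agg_c j >]].

Lemma mem_agg_seq j : (j \in agg_seq) = `[< agg_c j >].
Proof. by rewrite mem_filter mem_enum andbT. Qed.

Lemma agg_seq_uniq : uniq agg_seq.
Proof. by rewrite filter_uniq// enum_uniq. Qed.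

Lemma agg_seq_size j0 :
  (size agg_seq)%:R <= (2 * rho / cube_ratio d sigma) ^+ d * (size own)%:R.
Proof.
pose f x := [seq j <- enum 'I_(ncell X) | `[< closure (cell j) x >]].
have H : (size agg_seq <= size (flatten [seq f x | x <- own]))%N.
  apply: uniq_leq_size agg_seq_uniq _ => j; rewrite mem_agg_seq => /asboolP[x xi xj].
  by apply/flattenP; exists (f x); [exact: map_f|rewrite mem_filter mem_enum andbT; exact/asboolP].
apply: (@le_trans _ _ (size (flatten [seq f x | x <- own]))%:R); first by rewrite ler_nat.
elim: own => [|x s IH]; first by rewrite mulr0.
rewrite /= size_cat natrD -[(size s).+1]addn1 natrD mulrDr mulr1 addrC lerD//.
apply: (packing d0 hO hX (x := x) j0); first by rewrite filter_uniq// enum_uniq.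
by move=> j; rewrite mem_filter => /andP[/asboolP].
Qed.

Let core j := agg_c j /\ ~ layer_c j.
(** Only the cell being left has to be a core cell, so a walk may end in a layer cell. *)
Let step j k := `[< core j >] && adj j k.

Lemma core_adj j k : core j -> adj j k -> agg_c k.
Proof.
move=> [aj nj] /hasP[x xk xj].
have xi : x \in own by apply: contrapT => /negP xi; apply: nj; split => //; exists x.
exact: owned_agg xi xk.
Qed.

Lemma connect_agg j k : agg_c j -> connect step j k -> agg_c k.
Proof.
move=> aj /connectP[p pp ->]; elim/last_ind: p pp => // p l IH.
by rewrite rcons_path last_rcons => /andP[_ /andP[/asboolP c /(core_adj c)]].
Qed.

(** If walks from [j] meet core cells only, the restriction on steps never bites, and connectedness
    of the mesh makes every cell reachable. *)
Lemma connect_step_all j : (forall k, connect step j k -> core k) -> forall k, connect step j k.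
Proof.
move=> jc k; have /connectP[p pp ->] := mesh_connected hO hX p0 hgll j k.
elim/last_ind: p pp => [|p l IH]; first by rewrite connect0.
rewrite rcons_path last_rcons => /andP[pp al]; have := IH pp => jl.
by apply: (connect_trans jl); apply: connect1; rewrite /step al andbT; apply/asboolP; exact: (jc _ jl).
Qed.

(** Repetitions are removed so that the oscillation along the walk is bounded by a sum over
    [agg_seq] that counts each cell once. *)
Lemma agg_path j k : agg_c j -> connect step j k ->
  exists p, [/\ path adj j p, uniq (j :: p), {subset j :: p <= agg_seq} & last j p = k].
Proof.
move=> aj /connectP[p pp ->]; case/shortenP: pp => p' pp' up' _.
exists p'; split => //; first by apply: sub_path pp' => a b /andP[].
move=> l lp; rewrite mem_agg_seq; apply/asboolP; apply: connect_agg aj _.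
exact: path_connect pp' _ lp.
Qed.

Lemma path_oscillation u (omega : 'I_(ncell X) -> R) :
  (forall j x y, x \in cell_points j -> y \in cell_points j -> `|u x - u y| <= omega j) ->
  forall p j x y, path adj j p -> x \in cell_points j -> y \in cell_points (last j p) ->
  `|u x - u y| <= \sum_(k <- j :: p) omega k.
Proof.
move=> uo; elim=> [|k p IH] j x y /=; first by rewrite big_seq1 => _; exact: uo.
move=> /andP[/hasP[z zk zj] pp] xj yl; rewrite big_cons.
by apply: le_trans (ler_distD (u z) _ _) _; rewrite lerD//; [exact: uo|exact: IH yl].
Qed.

(* Either a walk through core cells reaches a layer cell, where [u] has a zero,
   or there is no layer cell and the agglomerate is the whole mesh. *)
Lemma nodal_oscillation u (omega : 'I_(ncell X) -> R) :
  (forall j, 0 <= omega j) ->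
  (forall j x y, x \in cell_points j -> y \in cell_points j -> `|u x - u y| <= omega j) ->
  (forall x, x \in support_points X -> x \notin own -> u x = 0) ->
  exists c, forall x, x \in own ->
    (u x - c) ^+ 2 <= (size agg_seq)%:R * \sum_(j <- agg_seq) omega j ^+ 2.
Proof.
move=> om0 uo u0.
have sq (t : R) : `|t| <= \sum_(j <- agg_seq) omega j ->
    t ^+ 2 <= (size agg_seq)%:R * \sum_(j <- agg_seq) omega j ^+ 2.
  move=> t1; apply: le_trans (sqr_sum_le _ _); rewrite -[leLHS]real_normK ?num_real//.
  by rewrite lerXn2r// nnegrE ?sumr_ge0.
have chain x j k : x \in own -> x \in cell_points j -> connect step j k ->
    forall y, y \in cell_points k -> `|u x - u y| <= \sum_(j <- agg_seq) omega j.
  move=> xi xj jk y yk; have [p [pp up sp pl]] := agg_path (owned_agg xi xj) jk.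
  apply: le_trans (path_oscillation uo pp xj _) _; first by rewrite pl.
  exact: ler_sum_subset up agg_seq_uniq sp om0.
have [[k0 lk0]|nl] := pselect (exists k, layer_c k).
  exists 0 => x xi; have [j xj] := support_cell (owned_support xi).
  have [k [jk lk]] : exists k, connect step j k /\ layer_c k.
    (* If no layer cell were reachable, every reachable cell would be core, hence every cell would
       be reachable, [k0] included. *)
    apply: contrapT => nk; case: (nk); exists k0; split => //.
    apply: connect_step_all => k jk; split; first exact: connect_agg (owned_agg xi xj) jk.
    by move=> lk; apply: nk; exists k.
  have [_ [y yk yi]] := lk; apply: sq.
  have := chain x j k xi xj jk y yk; rewrite (u0 y)//; exact: mem_support_points yk.
have [own0|[x0 x0i]] : own = [::] \/ (exists x0, x0 \in own).
  by case: own => [|x0 s]; [left|right; exists x0; rewrite mem_head].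
  by exists 0 => x; rewrite own0.
exists (u x0) => x xi; have [j xj] := support_cell (owned_support xi).
have [k0 x0k0] := support_cell (owned_support x0i).
apply: sq; apply: (chain x j k0) => //; apply: connect_step_all => k jk.
split; first exact: connect_agg (owned_agg xi xj) jk.
by move=> lk; apply: nl; exists k.
Qed.

Lemma fe_space_comb (s : seq 'rV[R]_d) (c : 'rV[R]_d -> R) :
  {subset s <= support_points X} -> fe_space Omega X (interp X s c).
Proof.
move=> ss; split.
  elim: s ss => [|x s IH] ss.
    rewrite /interp (_ : (fun _ => _) = cst 0); last by apply/funext => y; rewrite big_nil.
    exact/continuous_subspaceT/cst_continuous.
  rewrite /interp (_ : (fun _ => _) = (fun y => c x * phi X x y + interp X s c y)); last first.
    by apply/funext => y; rewrite big_cons.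
  have xs : x \in support_points X by apply: ss; rewrite mem_head.
  have cx := (bas.1 x xs).1.
  have cs : {within closure Omega, continuous (interp X s c)}.
    by apply: IH => y ys; apply: ss; rewrite inE ys orbT.
  move=> y; apply: (@cvgD _ _ _ _ _ (fun y => c x * phi X x y)); last exact: cs.
  by apply: (@cvgM _ _ _ _ (fun=> c x)); [exact: cvg_cst|exact: cx].
move=> j.
(* Off the support points [phi] is unspecified, so a pullback is chosen only for [x] in [s]. *)
have ex x : exists q, x \in s -> Qpoly (deg X) q /\ forall z, ref_closed z -> phi X x (gmap j z) = q z.
  have [xs|_] := boolP (x \in s); last by exists (fun=> 0).
  by have [q Qq qE] := (bas.1 x (ss x xs)).2 j; exists q.
pose q x := projT1 (cid (ex x)).
have qP x : x \in s -> Qpoly (deg X) (q x) /\ forall z, ref_closed z -> phi X x (gmap j z) = q x z.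
  by rewrite /q; case: cid.
have zeroQ : Qpoly (deg X) (fun _ : 'rV[R]_d => 0 : R).
  by exists (fun=> 0) => z; rewrite big1// => a _; rewrite mul0r.
exists (fun z => \sum_(x <- s) c x * (if x \in s then q x z else 0)).
  apply: (@Qpoly_lin R d _ s (deg X) (fun x z => if x \in s then q x z else 0) c) => x.
  by case E : (x \in s) => //; have [] := qP x E.
move=> z zc; rewrite /interp !big_seq; apply: eq_bigr => x xs.
by rewrite xs ((qP x xs).2 z zc).
Qed.

Lemma interp_val (s : seq 'rV[R]_d) (c : 'rV[R]_d -> R) y : uniq s ->
  {subset s <= support_points X} -> y \in support_points X ->
  interp X s c y = if y \in s then c y else 0.
Proof.
move=> us ss ys; have [_ [_ bval]] := bas.
have E x : x \in s -> c x * phi X x y = if x == y then c x else 0.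
  by move=> xs; rewrite (bval x y (ss x xs) ys); have [->|_] := eqVneq x y; rewrite ?mulr1 ?mulr0.
rewrite /interp (eq_big_seq _ E); case: ifPn => ysn.
  rewrite (bigD1_seq y)//= eqxx big1 ?addr0// => x /negbTE ->; exact: erefl.
by rewrite big_seq big1// => x xs; have [e|//] := eqVneq x y; rewrite -e xs in ysn.
Qed.

Let ipts := interior_points Omega X.

Lemma ipts_sub : {subset ipts <= support_points X}.
Proof. by move=> x; rewrite mem_filter => /andP[]. Qed.

Lemma ipts_uniq : uniq ipts.
Proof. by rewrite filter_uniq// undup_uniq. Qed.

Let wgt x := Aform Omega X (phi X x) (phi X x).

Lemma wgt_ge0 x : 0 <= wgt x.
Proof. by apply: Rintegral_ge0 => y _; apply: sumr_ge0 => k _; rewrite -expr2 sqr_ge0. Qed.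

(** [Pi_i] alters values on the boundary of Omega only, where [Dform] has no terms. The form thus
    becomes a weighted sum of nodal values with nonnegative weights. *)
Lemma Dform_locE u v : Dform_loc Omega X u v = \sum_(x <- ipts) wgt x * u x * v x.
Proof.
rewrite /Dform_loc /Dform; apply: eq_big_seq => x xs.
by rewrite /interpV !interp_val ?ipts_uniq// ?xs//; try exact: ipts_sub.
Qed.

Lemma Dform_loc_ge0 u : 0 <= Dform_loc Omega X u u.
Proof.
by rewrite Dform_locE; apply: sumr_ge0 => x _; rewrite -mulrA mulr_ge0 ?wgt_ge0// -expr2 sqr_ge0.
Qed.

Lemma finite_measure_bounded (G : set 'rV[R]_d) : measurable G -> G `<=` closure Omega ->
  (@lebesgue_rV R d G < +oo)%E.
Proof.
move=> mG GO; have [M MP] := closure_Omega_bounded hO.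
apply: (@le_lt_trans _ _ (@lebesgue_rV R d (cube 0 (`|M| + 1)))).
  apply: le_measure; rewrite ?inE//; first exact: measurable_cube.
  move=> x Gx k; rewrite mxE subr0; apply: le_lt_trans (coord_le_norm x k) _.
  by apply: le_lt_trans (MP x (GO x Gx)) _; rewrite ltr_pwDr// ler_norm.
by rewrite lebesgue_cube ?ltry// addr_ge0.
Qed.

Definition total_const (n : nat) (s r : R) : R :=
  basis_const n s r * (2 * r / cube_ratio n s) ^+ n * energy_const n s r.

(** The set [G] is left open so that the estimate serves both for [v] on [agg X i] and for [Pi_i v]
    on Omega. The product of the number of owned points, the largest weight and the squared
    oscillation is free of [h], since the powers from [basis_Aform_le] and [energy_lower] cancel. *)
Lemma D_constant_le u (G : set 'rV[R]_d) : fe_space Omega X u ->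
  (forall x, x \in support_points X -> x \notin own -> u x = 0) ->
  measurable G -> G `<=` closure Omega -> (forall j, agg_c j -> cell j `<=` G) ->
  exists c, Dform_loc Omega X (u - interp X own (fun=> c)) (u - interp X own (fun=> c)) <=
    total_const d sigma rho * ((deg X)%:R ^+ (4 + d) * ((size own)%:R ^+ 2 * (deg X)%:R ^+ d)) *
    H1seminorm2 X G u.
Proof.
move=> uf u0 mG GO cG.
have [own0|[x0 x0i]] : own = [::] \/ (exists x0, x0 \in own).
  by case: own => [|x0 s]; [left|right; exists x0; rewrite mem_head].
  exists 0; rewrite Dform_locE big_seq big1.
    by rewrite own0 expr0n mul0r !mulr0 mul0r.
  move=> x xs; have xsup := ipts_sub xs.
  rewrite /= !fctE interp_val ?own0 ?in_nil//.
  by rewrite u0 ?own0// subr0 !mulr0.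
have [j0 _] := support_cell (owned_support x0i).
have h0 : 0 < h by exact: (h_gt0 d0 hX j0).
have uG := finite_measure_bounded mG GO.
have agG j : j \in agg_seq -> cell j `<=` G by rewrite mem_agg_seq => /asboolP; exact: cG.
have [omega [om0 uo oE]] := energy_lower d0 hX p0 hgll j0 uf agg_seq_uniq mG uG agG.
have [c cP] := nodal_oscillation om0 uo u0; exists c.
set l := size own; set n := size agg_seq in cP; set S := \sum_(j <- agg_seq) _ in cP oE.
set I := H1seminorm2 X G u in oE *.
have nl : n%:R <= (2 * rho / cube_ratio d sigma) ^+ d * l%:R by exact: agg_seq_size.
have S0 : 0 <= S by apply: sumr_ge0 => j _; exact: sqr_ge0.
have [W WE] : exists W, W = basis_const d sigma rho * ((deg X)%:R ^+ 4 * (h ^+ d / h ^+ 2)) by eexists.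
have wW x : x \in support_points X -> wgt x <= W.
  by move=> xs; rewrite WE; exact: (basis_Aform_le d0 hO hX p0 hgll j0 bas xs).
have W0 : 0 <= W by apply: le_trans (wgt_ge0 x0) (wW _ (owned_support x0i)).
apply: (@le_trans _ _ (l%:R * (W * (n%:R * S)))).
  rewrite Dform_locE.
  apply: (@le_trans _ _ (\sum_(x <- ipts | x \in own) W * (n%:R * S))).
    rewrite (bigID (mem own))/= [X in _ + X]big_seq_cond [X in _ + X]big1 ?addr0 => [|x /andP[xs xi]].
      rewrite big_seq_cond [leRHS]big_seq_cond; apply: ler_sum => x /andP[xs xi].
      have xsup := ipts_sub xs.
      rewrite /= !fctE interp_val ?xi//; [|exact: owned_uniq|exact: owned_support].
      by rewrite -mulrA -expr2 ler_pM ?wgt_ge0 ?sqr_ge0 ?wW//; exact: cP.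
    have xsup := ipts_sub xs.
    rewrite /= !fctE interp_val ?(negbTE xi)//; [|exact: owned_uniq|exact: owned_support].
    by rewrite u0// subr0 !mulr0.
  rewrite big_const_seq iter_addr_0 -[leLHS]mulr_natl ler_wpM2r ?mulr_ge0// ler_nat.
  rewrite -size_filter; apply: uniq_leq_size; first by rewrite filter_uniq// ipts_uniq.
  by move=> x; rewrite mem_filter => /andP[].
apply: (@le_trans _ _ (l%:R * (W * ((2 * rho / cube_ratio d sigma) ^+ d * l%:R *
    (energy_const d sigma rho * (h ^+ 2 / h ^+ d * (deg X)%:R ^+ (2 * d)) * I))))).
  rewrite ler_wpM2l// ler_wpM2l// ler_pM//.
rewrite WE /total_const le_eqVlt; apply/orP; left; apply/eqP.
rewrite [(4 + d)%N]addnC exprD mulnC exprM expr2.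
set K := (2 * rho / cube_ratio d sigma) ^+ d; set hd := h ^+ d; set pd := (deg X)%:R ^+ d.
have hd0 : hd != 0 by rewrite expf_neq0// gt_eqF.
by field; rewrite hd0 gt_eqF.
Qed.

End Agglomerate.

(** * The estimates for the projection and for the quotient [mu_inv] *)

Section Bounds.
Context {R : realType} {d : nat} {Omega : set 'rV[R]_d} {X : discretization R d}
  {B : hierarchy R d} {sigma rho : R}.
Hypotheses (d0 : (0 < d)%N) (hO : admissible_domain Omega)
  (hX : admissible_mesh Omega sigma rho X) (p0 : (0 < deg X)%N) (hgll : is_gll (gll X))
  (bas : is_nodal_basis Omega X) (hB : is_hierarchy X B).
Context (i : 'I_(nagg B)) (p' : nat).
Implicit Types (u v w : 'rV[R]_d -> R).

Local Notation h := (meshsize X).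
Local Notation own := (owned i).
Local Notation Dn f := (Dform_loc Omega X f f).

Lemma H1seminorm2_ge0 (G : set 'rV[R]_d) u : 0 <= H1seminorm2 X G u.
Proof. by apply: Rintegral_ge0 => y _; exact: energy_ge0. Qed.

Definition level_bound : R := (deg X)%:R ^+ (4 + d)
               * (aggsize X i ^+ 2 / h ^+ 2)
               * (1 + (size own)%:R ^+ 2 * (deg X)%:R ^+ d + p'%:R ^- 2).

(** The constant is fixed before any mesh is given, when no sign of [s] or [r] is known: hence the
    absolute value and the added 1. The factor [r ^ 2] pays for [h <= rho H_i]. *)
Definition main_const (n : nat) (s r : R) : R := `|total_const n s r| * r ^+ 2 + 1.

Lemma main_const_gt0 : 0 < main_const d sigma rho.
Proof. by rewrite ltr_wpDl// mulr_ge0// sqr_ge0. Qed.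

Lemma level_bound_ge0 : 0 <= level_bound.
Proof.
apply: mulr_ge0.
  by apply: mulr_ge0; [exact: exprn_ge0|apply: divr_ge0; exact: sqr_ge0].
apply: addr_ge0; last by rewrite invr_ge0 exprn_ge0.
by apply: addr_ge0 => //; apply: mulr_ge0; exact: exprn_ge0.
Qed.

Lemma agg_sub_closure : agg X i `<=` closure Omega.
Proof.
by move=> x /interior_subset[j _ xj]; exact: (closure_cell_sub hX xj).
Qed.

Lemma cell_sub_agg j : @agg_cells R d X B i j -> cell j `<=` agg X i.
Proof.
move=> ij x xj; rewrite /agg /region /interior /=.
have : nbhs x (cell j) by apply: open_nbhs_nbhs; split => //; exact: (mesh_open hX).
by apply: filterS => y yj; exists j => //; exact: subset_closure.
Qed.

Lemma D_bound (G : set 'rV[R]_d) u : fe_space Omega X u ->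
  (forall x, x \in support_points X -> x \notin own -> u x = 0) ->
  measurable G -> G `<=` closure Omega -> (forall j, @agg_cells R d X B i j -> cell j `<=` G) ->
  exists c, Dn (u - interp X own (fun=> c)) <= main_const d sigma rho * level_bound * H1seminorm2 X G u.
Proof.
move=> uf u0 mG GO cG.
have [c cP] := D_constant_le d0 hO hX p0 hgll bas hB uf u0 mG GO cG.
exists c; apply: le_trans cP _; apply: ler_wpM2r; first exact: H1seminorm2_ge0.
set L := (deg X)%:R ^+ (4 + d) * _; have L0 : 0 <= L.
  by apply: mulr_ge0; [exact: exprn_ge0|apply: mulr_ge0; exact: exprn_ge0].
have B0 := level_bound_ge0.
apply: (@le_trans _ _ (`|total_const d sigma rho| * rho ^+ 2 * level_bound)); last first.
  by rewrite ler_wpM2r// lerDl.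
apply: (@le_trans _ _ (`|total_const d sigma rho| * L)); first by rewrite ler_wpM2r// ler_norm.
rewrite -mulrA ler_wpM2l//.
(* Without owned points there is no cell through which to compare [h] with [H_i], but then
   [L = 0]. *)
have [own0|[x0 x0i]] : own = [::] \/ (exists x0, x0 \in own).
  by case: own => [|x0 s]; [left|right; exists x0; rewrite mem_head].
  by rewrite /L own0 expr0n mul0r mulr0 mulr_ge0// sqr_ge0.
have [j x0j] := support_cell (owned_support hB x0i).
have aj := owned_agg hX p0 hgll x0i x0j.
have h0 : 0 < h by exact: (h_gt0 d0 hX j).
have r0 : 0 < rho by exact: (rho_gt0 d0 hX j).
have [M MP] := closure_Omega_bounded hO.
have hH : h <= rho * aggsize X i.
  apply: le_trans (mesh_quasi_uniform hX j) _; rewrite ler_wpM2l ?(ltW r0)//.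
  apply: (@diam_subset _ _ _ _ M); last exact: cell_nonempty.
    by move=> x /agg_sub_closure; exact: MP.
  exact: cell_sub_agg.
have q1 : 1 <= rho ^+ 2 * (aggsize X i ^+ 2 / h ^+ 2).
  have q0 : 1 <= rho * aggsize X i / h by rewrite ler_pdivlMr// mul1r.
  rewrite mulrA -exprMn -expr_div_n -[leLHS](expr1n R 2) lerXn2r ?nnegrE//.
  exact: le_trans q0.
rewrite /level_bound; set S := 1 + _ + _.
have LS : L <= (deg X)%:R ^+ (4 + d) * S.
  rewrite /L ler_wpM2l ?exprn_ge0// /S addrAC lerDr addr_ge0// invr_ge0 exprn_ge0//.
apply: le_trans LS _.
rewrite (_ : rho ^+ 2 * _ = rho ^+ 2 * (aggsize X i ^+ 2 / h ^+ 2) * ((deg X)%:R ^+ (4 + d) * S)); last by ring.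
apply: ler_peMl => //; apply: mulr_ge0; first exact: exprn_ge0.
apply: addr_ge0; last by rewrite invr_ge0 exprn_ge0.
by apply: addr_ge0 => //; apply: mulr_ge0; exact: exprn_ge0.
Qed.

Lemma constant_coarse c : coarse_space X p' i (interp X own (fun=> c)).
Proof.
exists (fun=> c) => //.
exists (fun a => if a == [ffun=> ord0] then c else 0) => x.
rewrite (bigD1 [ffun=> ord0])//= eqxx big1 ?mulr1 => [|k _]; last by rewrite ffunE expr0.
by rewrite big1 ?addr0// => a /negbTE ->; rewrite mul0r.
Qed.

Lemma coarse_sub v w : coarse_space X p' i v -> coarse_space X p' i w -> coarse_space X p' i (v - w).
Proof.
move=> [q Qq <-] [r Qr <-]; exists (q - r).
  have [a aE] := Qq; have [b bE] := Qr; exists (fun e => a e - b e) => x.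
  by rewrite !fctE aE bE -sumrB; apply: eq_bigr => e _; rewrite mulrBl.
by apply/funext => y; rewrite !fctE /interp -sumrB; apply: eq_bigr => x _; rewrite mulrBl.
Qed.

(** Pythagoras for a form that is only semidefinite: the cross term vanishes because [Q v - w] is a
    coarse function. *)
Lemma projection_minimal (Q : ('rV[R]_d -> R) -> 'rV[R]_d -> R) v w :
  is_D_projection Omega X p' i Q -> local_space X i v -> coarse_space X p' i w ->
  Dn (v - Q v) <= Dn (v - w).
Proof.
move=> QP vi wc; have [Qc orth] := QP v vi.
have := orth _ (coarse_sub Qc wc); rewrite !(Dform_locE bas) => o.
have := Dform_loc_ge0 bas (Q v - w); rewrite (Dform_locE bas).
set s := interior_points _ _ in o *.
have -> : \sum_(x <- s) Aform Omega X (phi X x) (phi X x) * (v - w) x * (v - w) x =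
    \sum_(x <- s) Aform Omega X (phi X x) (phi X x) * (v - Q v) x * (v - Q v) x
  + 2 * (\sum_(x <- s) Aform Omega X (phi X x) (phi X x) * (v - Q v) x * (Q v - w) x)
  + \sum_(x <- s) Aform Omega X (phi X x) (phi X x) * (Q v - w) x * (Q v - w) x.
  rewrite mulr_sumr -!big_split/=; apply: eq_bigr => x _; rewrite !fctE; ring.
rewrite o; lra.
Qed.

Lemma local_fe v : local_space X i v -> fe_space Omega X v /\
  (forall x, x \in support_points X -> x \notin own -> v x = 0).
Proof.
move=> [c ->]; split.
  by apply: (fe_space_comb bas) => x; exact: (owned_support hB).
move=> x xs /negbTE xi; rewrite (interp_val bas) ?xi//; first exact: (owned_uniq hB).
by move=> y; exact: (owned_support hB).
Qed.

Lemma projection_bound Q v : is_D_projection Omega X p' i Q -> local_space X i v ->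
  Dn (v - Q v) <= main_const d sigma rho * level_bound * H1seminorm2 X (agg X i) v.
Proof.
move=> QP vi; have [vf v0] := local_fe vi.
have mG : measurable (agg X i) by apply: open_measurable_rV; exact: open_interior.
have [c] := D_bound vf v0 mG agg_sub_closure (fun j => @cell_sub_agg j).
by apply: le_trans; apply: projection_minimal => //; exact: constant_coarse.
Qed.

(** [Aform_loc] is the energy over Omega of [u], the image of [v] under [Pi_i], so [D_bound] is
    applied to [u] with [G = Omega]. At the interior points, the only ones that [Dform_loc] sees,
    [u] and [v] agree. *)
Lemma mu_inv_bound : (mu_inv Omega X p' i <= (main_const d sigma rho * level_bound)%:E)%E.
Proof.
apply: ge_ereal_sup => _ [v [vi vA] <-]; rewrite lee_fin.
set u := interpV Omega X v.
have uf : fe_space Omega X u by apply: (fe_space_comb bas); exact: ipts_sub.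
have [vf v0] := local_fe vi.
have uv x : x \in interior_points Omega X -> u x = v x.
  move=> xs; rewrite /u /interpV (interp_val bas _ (ipts_uniq (Omega := Omega))) ?xs//.
    exact: ipts_sub.
  exact: ipts_sub xs.
have u0 x : x \in support_points X -> x \notin own -> u x = 0.
  move=> xs xi; rewrite /u /interpV (interp_val bas) ?ipts_uniq//; last exact: ipts_sub.
  by case: ifP => // _; exact: v0.
have [_ oO _ _ _] := hO.
have [c cP] := D_bound uf u0 (open_measurable_rV oO) (@subset_closure _ Omega)
  (fun j _ => cell_sub_Omega hO hX (j := j)).
have AE : Aform_loc Omega X v v = H1seminorm2 X Omega u.
  by congr Rintegral; apply/funext => x; apply: eq_bigr => k _; rewrite expr2.
have A0 : 0 < Aform_loc Omega X v v by rewrite lt_neqAle eq_sym vA AE H1seminorm2_ge0.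
rewrite ler_pdivrMr// AE; apply: le_trans cP.
rewrite [leRHS](_ : _ = Dn (v - interp X own (fun=> c))); last first.
  by rewrite !(Dform_locE bas); apply: eq_big_seq => x xs; rewrite !fctE uv.
(* Without a lower bound on the set [inf] would not be below its elements; 0 is one since the form
   is semidefinite. *)
apply: ge_inf; first by exists 0 => _ [w _ <-]; exact: (Dform_loc_ge0 bas).
by exists (interp X own (fun=> c)) => //; exact: constant_coarse.
Qed.

End Bounds.

Theorem theorem3 (R : realType) (d : nat) (hd : d = 2%N \/ d = 3%N)
  (Omega : set 'rV[R]_d) (hOmega : admissible_domain Omega)
  (sigma rho kappa : R) (hkappa : 1 <= kappa) :
  exists2 C : R, 0 < C &
  forall (X : discretization R d) (B : hierarchy R d) (p' : nat),
  (1 <= deg X)%N -> (1 <= p')%N ->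
  admissible_mesh Omega sigma rho X ->
  is_gll (gll X) ->
  is_nodal_basis Omega X ->
  is_hierarchy X B ->
  admissible_hierarchy X B kappa p' ->
  forall i : 'I_(nagg B),
  let bound := (deg X)%:R ^+ (4 + d)
               * (aggsize X i ^+ 2 / meshsize X ^+ 2)
               * (1 + (size (owned i))%:R ^+ 2 * (deg X)%:R ^+ d
                  + p'%:R ^- 2) in
  (forall Q, is_D_projection Omega X p' i Q ->
     forall v, local_space X i v ->
     Dform_loc Omega X (v - Q v) (v - Q v)
     <= C * bound * H1seminorm2 X (agg X i) v) /\
  (mu_inv Omega X p' i <= (C * bound)%:E)%E.
Proof.
have d0 : (0 < d)%N by case: hd => ->.
exists (main_const d sigma rho); first exact: main_const_gt0.
move=> X B p' p0 _ hX hgll bas hB _ i bound; split.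
  by move=> Q QP v vi; exact: (projection_bound d0 hOmega hX p0 hgll bas hB QP vi).
exact: (mu_inv_bound d0 hOmega hX p0 hgll bas hB).
Qed.
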